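(* Let $\Phi^i$ be an i-Willmore surface carrying a family of i-M-circles. Suppose that the top view of the family is a hyperbolic pencil of circles. Then the surface $\Phi^i$ is i-M-equivalent to a piece of the surface $$z=\left(a_1(x^2+y^2)+a_2x+a_3\right)\ln(x^2+y^2)+\frac{b_1y+b_2x}{x^2+y^2}+(c_1y+c_2x)(x^2+y^2)$$ for some $a_1,a_2,a_3,b_1,b_2,c_1,c_2\in\mathbb{R}$.
   Context: Isotropic space is $\mathbb{R}^3$ with coordinates $(x,y,z)$; the top view is the projection $(x,y,z)\mapsto(x,y,0)$. An i-M-sphere is a surface $z=\frac a2(x^2+y^2)+bx+cy+d$ with $a,b,c,d\in\mathbb{R}$; the number $a$ is its i-mean curvature. An i-M-circle is an intersection curve of two distinct i-M-spheres. Extended isotropic space is $\mathbb{R}^3\cup\ell_\infty$, where $\ell_\infty$ is an ideal line (a copy of $\mathbb{R}$), and an i-M-sphere with i-mean curvature $a$ meets $\ell_\infty$ at the point $a$. An i-M-transformation is a bijection of $\mathbb{R}^3\cup\ell_\infty$ taking i-M-spheres to i-M-spheres; the group of these is generated by $(x,y,z)\mapsto(x+1,y,z)$, rotations about the $z$-axis, $(x,y,z)\mapsto(x,y,z+ax+by)$, $(x,y,z)\mapsto(x,y,z+x^2+y^2-1)$, $(x,y,z)\mapsto(x,y,z+h)$, $(x,y,z)\mapsto(x,y,az)$ $(a\neq0)$, $(x,y,z)\mapsto(x,y,z)/(x^2+y^2)$ and $(x,y,z)\mapsto(x,y,z)/\sqrt2$. Two surfaces are i-M-equivalent if one is the image of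 the other under an i-M-transformation. An i-Willmore surface is the graph $z=F(x,y)$ of a biharmonic function ($\Delta\Delta F=0$) on a planar region, possibly analytically continued to a multi-valued one; by restriction to a smaller part one may assume it single-valued. The surface carries a family of i-M-circles if it contains an arc of each i-M-circle of the family. A hyperbolic pencil of circles in the plane is the set of all circles (lines allowed) orthogonal to two fixed crossing circles (lines allowed), crossing meaning that the two intersect in two points (counting infinity for lines); a one-parametric family (parametrized by a nondegenerate segment, with distinct members) has a hyperbolic pencil as top view if its members' top views are circles of such a pencil. *)

(* Defs.v *)
(* Stdlib's real numbers with Coquelicot. *)
From Stdlib Require Export Reals.
From Coquelicot Require Export Coquelicot.

#[global] Open Scope R_scope.

Definition plane : Type := (R * R)%type.
Definition space : Type := (plane * R)%type.

Definition image {A B : Type} (f : A -> B) (S : A -> Prop) : B -> Prop :=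
  fun q => exists p, S p /\ f p = q.

Definition same_set {A : Type} (S T : A -> Prop) : Prop :=
  forall p, S p <-> T p.

Definition dot (u v : plane) : R := fst u * fst v + snd u * snd v.
Definition sub (u v : plane) : plane := (fst u - fst v, snd u - snd v).
Definition sqnorm (u : plane) : R := dot u u.

Definition top_view (S : space -> Prop) : plane -> Prop := image fst S.

(** * i-M-spheres, i-M-circles, i-M-transformations *)

Definition im_sphere_eqn (a b c d : R) (p : space) : Prop :=
  let '((x, y), z) := p in
  z = a / 2 * (x ^ 2 + y ^ 2) + b * x + c * y + d.

Definition im_sphere (S : space -> Prop) : Prop :=
  exists a b c d, same_set S (im_sphere_eqn a b c d).

(* [infinite S] excludes the intersections of two i-M-spheres that are not
   curves: the empty set and single points. *)
Definition infinite {A : Type} (S : A -> Prop) : Prop :=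
  forall l : list A, exists p, S p /\ ~ List.In p l.

Definition im_circle (K : space -> Prop) : Prop :=
  exists S1 S2, im_sphere S1 /\ im_sphere S2 /\ ~ same_set S1 S2 /\
    same_set K (fun p => S1 p /\ S2 p) /\ infinite K.

(* [inl p] is a point of R^3, [inr a] the point [a] of the ideal line. *)
Definition ext_space : Type := (space + R)%type.

Definition ext_im_sphere (S : ext_space -> Prop) : Prop :=
  exists a b c d, same_set S (fun P =>
    match P with
    | inl p => im_sphere_eqn a b c d p
    | inr i => i = a
    end).

(* The equivalence says that both [f] and its inverse take i-M-spheres to
   i-M-spheres, so that these maps form a group. *)
Definition im_transformation (f : ext_space -> ext_space) : Prop :=
  (forall P Q, f P = f Q -> P = Q) /\
  (forall Q, exists P, f P = Q) /\
  (forall S, ext_im_sphere S <-> ext_im_sphere (image f S)).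

Definition im_equivalent (S T : space -> Prop) : Prop :=
  exists f, im_transformation f /\
    same_set (image inl T) (image f (image inl S)).

(** * i-Willmore surfaces *)

Definition connected_set {T : UniformSpace} (U : T -> Prop) : Prop :=
  forall A B : T -> Prop, open A -> open B ->
    (forall p, U p -> A p \/ B p) ->
    (exists p, U p /\ A p) -> (exists p, U p /\ B p) ->
    exists p, U p /\ A p /\ B p.

Definition region (U : plane -> Prop) : Prop :=
  open U /\ connected_set U /\ exists p, U p.

Definition laplacian (F : R -> R -> R) : R -> R -> R := fun x y =>
  Derive_n (fun s => F s y) 2 x + Derive_n (fun s => F x s) 2 y.

(* On an open set [U], [ex_diff_n F 4] at every point says that [F] is C^4. *)
Definition biharmonic_on (U : plane -> Prop) (F : R -> R -> R) : Prop :=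
  forall x y, U (x, y) ->
    ex_diff_n F 4 x y /\ laplacian (laplacian F) x y = 0.

Definition graph_over (U : plane -> Prop) (F : R -> R -> R) : space -> Prop :=
  fun p => let '((x, y), z) := p in U (x, y) /\ z = F x y.

Definition i_Willmore (Phi : space -> Prop) : Prop :=
  exists U F, region U /\ biharmonic_on U F /\ same_set Phi (graph_over U F).

(** * Families of i-M-circles *)

Definition arc_of (A K : space -> Prop) : Prop :=
  exists gamma : R -> space,
    (forall t, 0 <= t <= 1 -> continuous gamma t) /\
    (forall s t, 0 <= s <= 1 -> 0 <= t <= 1 -> gamma s = gamma t -> s = t) /\
    same_set A (image gamma (fun t => 0 <= t <= 1)) /\
    (forall p, A p -> K p).

Definition im_circle_family (t0 t1 : R) (K : R -> space -> Prop) : Prop :=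
  t0 < t1 /\
  (forall t, t0 <= t <= t1 -> im_circle (K t)) /\
  (forall s t, t0 <= s <= t1 -> t0 <= t <= t1 ->
     same_set (K s) (K t) -> s = t).

Definition carries (Phi : space -> Prop) (t0 t1 : R)
    (K : R -> space -> Prop) : Prop :=
  forall t, t0 <= t <= t1 ->
    exists A, arc_of A (K t) /\ forall p, A p -> Phi p.

(** * Hyperbolic pencils of circles (lines allowed) *)

(* [Circle c r] has centre [c] and radius [r]; [Line q n] passes through [q]
   and has normal vector [n]. *)
Inductive gcircle : Type :=
| Circle (c : plane) (r : R)
| Line (q n : plane).

Definition proper (g : gcircle) : Prop :=
  match g with
  | Circle _ r => 0 < r
  | Line _ n => n <> (0, 0)
  end.

Definition on (g : gcircle) (p : plane) : Prop :=
  match g with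
  | Circle c r => sqnorm (sub p c) = r ^ 2
  | Line q n => dot (sub p q) n = 0
  end.

Definition normal_at (g : gcircle) (p : plane) : plane :=
  match g with
  | Circle c _ => sub p c
  | Line _ n => n
  end.

Definition orthogonal (g h : gcircle) : Prop :=
  (exists p, on g p /\ on h p) /\
  forall p, on g p -> on h p -> dot (normal_at g p) (normal_at h p) = 0.

(* [None] is the point at infinity, which lies on the lines only. *)
Definition ext_on (g : gcircle) (P : option plane) : Prop :=
  match P, g with
  | Some p, _ => on g p
  | None, Line _ _ => True
  | None, Circle _ _ => False
  end.

Definition crossing (g h : gcircle) : Prop :=
  exists P Q, P <> Q /\
    same_set (fun X => ext_on g X /\ ext_on h X) (fun X => X = P \/ X = Q).

Definition hyperbolic_pencil (B : gcircle -> Prop) : Prop :=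
  exists g h, proper g /\ proper h /\ crossing g h /\
    same_set B (fun k => proper k /\ orthogonal k g /\ orthogonal k h).

Definition top_view_hyperbolic (t0 t1 : R) (K : R -> space -> Prop) : Prop :=
  exists B, hyperbolic_pencil B /\
    forall t, t0 <= t <= t1 -> exists k, B k /\ same_set (top_view (K t)) (on k).

(** * The surface [z = G(x,y)] *)

Definition G (a1 a2 a3 b1 b2 c1 c2 x y : R) : R :=
  (a1 * (x ^ 2 + y ^ 2) + a2 * x + a3) * ln (x ^ 2 + y ^ 2)
  + (b1 * y + b2 * x) / (x ^ 2 + y ^ 2)
  + (c1 * y + c2 * x) * (x ^ 2 + y ^ 2).

(* The formula makes no sense at the origin (where Rocq's total functions give
   it a meaningless value). The surface has a point over the origin exactly
   when the formula extends continuously there, as it does for instance when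
   only [c1] and [c2] are nonzero. *)
Definition surface_G (a1 a2 a3 b1 b2 c1 c2 : R) : space -> Prop := fun p =>
  let '((x, y), z) := p in
  ((x, y) <> (0, 0) /\ z = G a1 a2 a3 b1 b2 c1 c2 x y) \/
  ((x, y) = (0, 0) /\
   filterlim (fun q : plane => G a1 a2 a3 b1 b2 c1 c2 (fst q) (snd q))
     (locally' ((0, 0) : plane)) (locally z)).

Definition piece_of (P S : space -> Prop) : Prop :=
  exists V, region V /\ same_set P (fun p => S p /\ V (fst p)).

(* Main.v *)
Require Import Defs.
From Stdlib Require Import Classical ClassicalEpsilon Lra Lia List Arith Cantor Ranalysis5.

(** A biharmonic function is analytic along lines: by Goursat's representation its second
    derivatives come from two holomorphic functions, which Cauchy's formula expands in power
    series ([biharmonic_line_analytic]).  Hence biharmonic functions have unique continuation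
    on regions, and identities along a segment follow from infinitely many points.

    A hyperbolic pencil consists of concentric circles, or of the circles of Apollonius of two
    limit points [p] and [q] ([hyperbolic_pencil_cases]).  In the second case an inversion about
    [q] and a translation make the circles concentric about 0; they preserve biharmonicity
    ([biharmonic_inversion]) and i-M-circles.  So assume that the circles are [|(x, y)| = r].
    Over each of them the i-M-circle is the graph of an affine function.

    Nothing makes the family continuous in its parameter, but it is uncountable, while there are
    only countably many sectors with rational data.  So infinitely many arcs cross one sector
    ([infinite_piece_of_countable_cover]).  On each of these arcs, [F (r e)] is interpolated
    from its values in three directions [e].  As both sides are analytic in [r], this holds
    throughout the sector ([affine_on_all_arcs]), so with [q = x^2 + y^2]
    [F = al q + x * be q + y * ga q].  For such functions the biharmonic equation splits into
    ordinary differential equations, whose solutions are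
    - for [al], the combinations of [q ln q], [ln q], [q] and [1];
    - for [be] and [ga], the combinations of [ln q], [1 / q], [q] and [1].
    This is the stated formula up to a term in [y ln q], which a rotation removes, and an
    i-M-sphere ([concentric_family_normal_form], [normal_form_piece]).  Unique continuation
    extends it from the sector to the whole region, except the origin.

    An inversion sends points over its centre to the ideal line, so it may be applied to the
    surface only if its centre lies outside the region.  If one limit point does, it can be used
    as the centre.  If both lie inside, then regularity of [F] at both leaves only an i-M-sphere
    ([both_limit_points_sphere]), which is equivalent to a piece of the plane [z = 0]. *)

(** * Real-analytic functions of one variable *)

Definition analytic_at (f : R -> R) (x : R) : Prop :=
  exists a : nat -> R, Rbar_lt 0 (CV_radius a) /\
    locally 0 (fun h => f (x + h) = PSeries a h).

Lemma locally_R_iff (P : R -> Prop) (x : R) :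
  locally x P <-> exists d, 0 < d /\ forall y, Rabs (y - x) < d -> P y.
Proof.
  split.
  - intros [d Hd]. exists d; split; [apply cond_pos|]. intros y Hy. now apply Hd.
  - intros (d & Hd0 & Hd). exists (mkposreal d Hd0). intros y Hy. now apply Hd.
Qed.

Lemma locally_inside_radius (a : nat -> R) :
  Rbar_lt 0 (CV_radius a) -> locally 0 (fun h => Rbar_lt (Rabs h) (CV_radius a)).
Proof.
  intros H. apply locally_R_iff. destruct (CV_radius a) as [r| |]; simpl in *.
  - exists r; split; auto. intros y Hy. now rewrite Rminus_0_r in Hy.
  - exists 1; split; [lra|easy].
  - easy.
Qed.

Lemma locally_shift (P : R -> Prop) (x : R) :
  locally x P <-> locally 0 (fun h => P (x + h)).
Proof.
  rewrite !locally_R_iff. split; intros (d & Hd & H); exists d; split; auto; intros y Hy.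
  - apply H. now replace (x + y - x) with (y - 0) by ring.
  - replace y with (x + (y - x)) by ring. apply H. now rewrite Rminus_0_r.
Qed.

Lemma analytic_ext_loc (f g : R -> R) (x : R) :
  locally x (fun y => f y = g y) -> analytic_at f x -> analytic_at g x.
Proof.
  intros H (a & Ha & Hf). exists a; split; auto.
  apply locally_shift in H. generalize (filter_and _ _ H Hf). apply filter_imp.
  intros h [H1 H2]. congruence.
Qed.

Lemma analytic_ext (f g : R -> R) (x : R) :
  (forall y, f y = g y) -> analytic_at f x -> analytic_at g x.
Proof. intros H. apply analytic_ext_loc. now apply filter_forall. Qed.

Lemma radius_pos_of_pseries (a : nat -> R) (d : R) (f : R -> R) :
  0 < d -> (forall h, Rabs h < d -> is_pseries a h (f h)) ->
  Rbar_lt 0 (CV_radius a).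
Proof.
  intros Hd H. destruct (Rbar_lt_le_dec 0 (CV_radius a)) as [C|C]; auto.
  exfalso. apply (CV_disk_outside a (d / 2)).
  - apply Rbar_le_lt_trans with 0; auto. simpl. apply Rabs_pos_lt. lra.
  - apply ex_series_lim_0. exists (f (d / 2)). apply is_pseries_R. apply H.
    rewrite Rabs_pos_eq; lra.
Qed.

Lemma analytic_of_pseries (f : R -> R) (x : R) (a : nat -> R) (d : R) :
  0 < d -> (forall h, Rabs h < d -> is_pseries a h (f (x + h))) ->
  analytic_at f x.
Proof.
  intros Hd H. exists a. split.
  - now apply radius_pos_of_pseries with d (fun h => f (x + h)).
  - apply locally_R_iff. exists d; split; auto. intros y Hy.
    rewrite Rminus_0_r in Hy. symmetry. now apply is_pseries_unique, H.
Qed.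

Lemma analytic_pseries (f : R -> R) (x : R) :
  analytic_at f x -> exists a d, 0 < d /\
    forall h, Rabs h < d ->
      Rbar_lt (Rabs h) (CV_radius a) /\ is_pseries a h (f (x + h)).
Proof.
  intros (a & Ha & Hf).
  generalize (filter_and _ _ (locally_inside_radius a Ha) Hf).
  rewrite locally_R_iff. intros (d & Hd & H). exists a, d; split; auto.
  intros h Hh. destruct (H h) as [H1 H2]. { now rewrite Rminus_0_r. }
  split; auto. rewrite H2. apply PSeries_correct. now apply CV_radius_inside.
Qed.

Lemma analytic_plus (f g : R -> R) (x : R) :
  analytic_at f x -> analytic_at g x -> analytic_at (fun y => f y + g y) x.
Proof.
  intros Hf Hg.
  destruct (analytic_pseries _ _ Hf) as (a & d & Hd & Ha).
  destruct (analytic_pseries _ _ Hg) as (b & e & He & Hb).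
  apply analytic_of_pseries with (PS_plus a b) (Rmin d e).
  - now apply Rmin_pos.
  - intros h Hh. apply (is_pseries_plus a b).
    + apply Ha. eapply Rlt_le_trans; [exact Hh|apply Rmin_l].
    + apply Hb. eapply Rlt_le_trans; [exact Hh|apply Rmin_r].
Qed.

Lemma analytic_mult (f g : R -> R) (x : R) :
  analytic_at f x -> analytic_at g x -> analytic_at (fun y => f y * g y) x.
Proof.
  intros Hf Hg.
  destruct (analytic_pseries _ _ Hf) as (a & d & Hd & Ha).
  destruct (analytic_pseries _ _ Hg) as (b & e & He & Hb).
  apply analytic_of_pseries with (PS_mult a b) (Rmin d e).
  - now apply Rmin_pos.
  - intros h Hh.
    assert (H1 : Rabs h < d) by (eapply Rlt_le_trans; [exact Hh|apply Rmin_l]).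
    assert (H2 : Rabs h < e) by (eapply Rlt_le_trans; [exact Hh|apply Rmin_r]).
    apply is_pseries_mult; now apply Ha || apply Hb.
Qed.

Lemma analytic_const (c x : R) : analytic_at (fun _ => c) x.
Proof.
  apply analytic_of_pseries with (fun n => match n with O => c | S _ => 0 end) 1.
  - lra.
  - intros h _. apply is_pseries_R. apply filterlim_ext with (fun _ => c).
    + intros n. induction n as [|n IH].
      * rewrite sum_O. simpl. ring.
      * rewrite sum_Sn, <- IH. unfold plus; simpl. ring.
    + apply filterlim_const.
Qed.

(** The difference from the term-by-term primitive of the power series has derivative 0. *)
Lemma analytic_primitive (f g : R -> R) (x : R) :
  locally x (fun y => is_derive f y (g y)) -> analytic_at g x -> analytic_at f x.
Proof.
  intros Hd Hg. destruct (analytic_pseries _ _ Hg) as (a & d & Hd0 & Ha).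
  apply locally_R_iff in Hd. destruct Hd as (e & He & Hd).
  set (r := Rmin d e).
  assert (Hr : 0 < r) by now apply Rmin_pos.
  assert (Hrd : r <= d) by apply Rmin_l. assert (Hre : r <= e) by apply Rmin_r.
  assert (Hint : forall h, Rabs h < r -> is_RInt (PSeries a) 0 h (f (x + h) - f x)).
  { intros h Hh.
    assert (Hb : forall t, Rmin 0 h <= t <= Rmax 0 h -> Rabs t < r).
    { intros t. apply Rabs_def2 in Hh. unfold Rmin, Rmax.
      destruct (Rle_dec 0 h); intros; apply Rabs_def1; lra. }
    replace (f (x + h) - f x) with (minus (f (x + h)) (f (x + 0)))
      by (rewrite Rplus_0_r; reflexivity).
    apply (is_RInt_derive (fun t => f (x + t)) (PSeries a)).
    - intros t Ht. specialize (Hb t Ht).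
      replace (PSeries a t) with (scal 1 (g (x + t))).
      + apply (is_derive_comp f (fun t => x + t)).
        * apply Hd. replace (x + t - x) with t by ring. lra.
        * auto_derive; auto.
      + rewrite (is_pseries_unique a t (g (x + t))). apply Rmult_1_l.
        apply Ha. lra.
    - intros t Ht. specialize (Hb t Ht).
      apply continuity_pt_filterlim, PSeries_continuity, Ha. lra. }
  apply analytic_ext with (fun y => (f y - f x) + f x). { intros; ring. }
  apply analytic_plus.
  - apply analytic_of_pseries with (PS_Int a) r; auto. intros h Hh.
    rewrite <- (is_RInt_unique _ _ _ _ (Hint h Hh)). apply is_pseries_RInt.
    apply Ha. lra.
  - apply analytic_const.
Qed.

Lemma analytic_id (x : R) : analytic_at (fun y => y) x.
Proof.
  apply analytic_primitive with (fun _ => 1).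
  - apply filter_forall. intros y. auto_derive; auto.
  - apply analytic_const.
Qed.

Lemma analytic_scal (c : R) (f : R -> R) (x : R) :
  analytic_at f x -> analytic_at (fun y => c * f y) x.
Proof. intros H. apply analytic_mult; auto. apply analytic_const. Qed.

Lemma analytic_minus (f g : R -> R) (x : R) :
  analytic_at f x -> analytic_at g x -> analytic_at (fun y => f y - g y) x.
Proof.
  intros Hf Hg. apply analytic_ext with (fun y => f y + -1 * g y).
  - intros; ring.
  - apply analytic_plus; auto. now apply analytic_scal.
Qed.

(** If the first nonzero coefficient of the power series is the [n]-th, then the function
    is [h ^ n] times a power series that does not vanish at 0. *)
Lemma analytic_isolated_zeros (f : R -> R) (x : R) :
  analytic_at f x ->
  exists d, 0 < d /\
    ((forall y, Rabs (y - x) < d -> f y = 0) \/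
     (forall y, Rabs (y - x) < d -> y <> x -> f y <> 0)).
Proof.
  intros (a & Ha & Hf).
  destruct (classic (forall n, a n = 0)) as [Z|NZ].
  - apply locally_R_iff in Hf. destruct Hf as (d & Hd & Hf).
    exists d; split; auto. left. intros y Hy.
    replace y with (x + (y - x)) by ring. rewrite Hf by now rewrite Rminus_0_r.
    rewrite (PSeries_ext a (fun _ => 0)) by auto. apply PSeries_const_0.
  - assert (Hn : exists n, a n <> 0 /\ forall k, (k < n)%nat -> a k = 0).
    { apply not_all_ex_not in NZ. destruct NZ as [m Hm].
      revert Hm. induction m as [m IH] using (well_founded_induction Nat.lt_wf_0). intros Hm.
      destruct (classic (exists k, (k < m)%nat /\ a k <> 0)) as [(k & Hk & Hak)|C].
      - now apply IH with k.
      - exists m. split; auto. intros k Hk. apply NNPP. intros Hak. apply C. eauto. }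
    destruct Hn as (n & Hn & Hlow).
    assert (Hb : Rbar_lt 0 (CV_radius (PS_decr_n a n))).
    { clear -Ha. induction n as [|n IH].
      - rewrite (CV_radius_ext _ a); auto.
      - rewrite (CV_radius_ext _ (PS_decr_1 (PS_decr_n a n))).
        + now rewrite CV_radius_decr_1.
        + intros k. unfold PS_decr_1, PS_decr_n. f_equal. lia. }
    assert (Hc : continuity_pt (PSeries (PS_decr_n a n)) 0).
    { apply PSeries_continuity. now rewrite Rabs_R0. }
    assert (Hc' : locally 0 (fun h => PSeries (PS_decr_n a n) h <> 0)).
    { apply continuity_pt_filterlim in Hc.
      apply (Hc (fun z => z <> 0)). apply locally_R_iff.
      rewrite PSeries_0. unfold PS_decr_n. rewrite Nat.add_0_r.
      exists (Rabs (a n)). split; [now apply Rabs_pos_lt|].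
      intros y Hy E. subst y. rewrite Rminus_0_l, Rabs_Ropp in Hy. lra. }
    generalize (filter_and _ _ Hf Hc'). rewrite locally_R_iff.
    intros (d & Hd & H). exists d; split; auto. right. intros y Hy Hyx.
    destruct (H (y - x)) as [H1 H2]. { now rewrite Rminus_0_r. }
    replace (x + (y - x)) with y in H1 by ring. rewrite H1.
    rewrite PSeries_decr_n_aux with (n := n) by auto.
    apply Rmult_integral_contrapositive_currified; auto. apply pow_nonzero. lra.
Qed.

(** Real induction, used for every passage from germs to intervals below.  The supremum
    of the points reached from [a] is itself reached, and cannot lie before [b]. *)
Lemma interval_gluing (P : R -> R -> Prop) (a b : R) :
  a <= b ->
  (forall c, a <= c <= b -> exists d, 0 < d  /\  forall x y, a <= x -> y <= b -> c - d < x <= c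
      -> c <= y < c + d -> P x y) ->
  (forall x y z, P x y -> P y z -> P x z) ->
  P a b.
Proof.
  intros Hab Hloc Htr.
  destruct (completeness (fun s => a <= s <= b /\ P a s)) as [c [Hub Hlub]].
  - exists b. intros s [Hs _]. lra.
  - exists a. split; [lra|]. destruct (Hloc a) as (d & Hd & H); [lra|].
    apply H; lra.
  - assert (Hac : a <= c).
    { apply Hub. split; [lra|]. destruct (Hloc a) as (d & Hd & H); [lra|].
      apply H; lra. }
    assert (Hcb : c <= b) by (apply Hlub; intros s [Hs _]; lra).
    destruct (Hloc c) as (d & Hd & H); [lra|].
    assert (Hs : exists s, (a <= s <= b /\ P a s) /\ c - d < s).
    { apply NNPP. intros C. assert (c <= c - d); [|lra].
      apply Hlub. intros s Hs. apply Rnot_lt_le. intros Hlt. apply C. eauto. }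
    destruct Hs as (s & [Hs1 Hs2] & Hs3).
    assert (s <= c) by (apply Hub; auto).
    set (y := Rmin b (c + d / 2)).
    assert (Hy : y <= b) by apply Rmin_l.
    assert (Hy2 : y <= c + d / 2) by apply Rmin_r.
    assert (Hcy : c <= y) by (apply Rmin_glb; lra).
    assert (HPy : P a y).
    { apply Htr with s; auto. apply H; lra. }
    assert (y <= c) by (apply Hub; split; auto; lra).
    unfold y, Rmin in *. destruct (Rle_dec b (c + d / 2)); [auto|lra].
Qed.

(** Around each point the function either vanishes or has at most one zero, so a zero
    germ propagates to both sides. *)
Lemma analytic_identity_from_germ (f : R -> R) (a b c : R) :
  a <= c <= b -> (forall x, a <= x <= b -> analytic_at f x) ->
  locally c (fun x => f x = 0) -> forall x, a <= x <= b -> f x = 0.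
Proof.
  intros Hc Han Hz.
  set (Z := fun x => locally x (fun t => f t = 0)).
  set (P := fun x y => (Z x <-> Z y) /\ (Z x -> forall t, x <= t <= y -> f t = 0)).
  assert (Hglue : forall u v, a <= u <= v -> v <= b -> P u v).
  { intros u v Hu Hv. apply interval_gluing; [lra| |].
    - intros w Hw. destruct (analytic_isolated_zeros f w) as (d & Hd & H).
      { apply Han. lra. }
      exists d; split; auto. intros x y Hux Hyv Hx Hy. destruct H as [H|H].
      + assert (HZ : forall t, Rabs (t - w) < d -> Z t).
        { intros t Ht. apply locally_R_iff. exists (d - Rabs (t - w)).
          split; [lra|]. intros s Hs. apply H.
          replace (s - w) with ((s - t) + (t - w)) by ring.
          eapply Rle_lt_trans; [apply Rabs_triang|]. lra. }
        repeat split.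
        * intros _. apply HZ. apply Rabs_def1; lra.
        * intros _. apply HZ. apply Rabs_def1; lra.
        * intros _ t Ht. apply H. apply Rabs_def1; lra.
      + assert (HZ : forall t, Rabs (t - w) < d -> ~ Z t).
        { intros t Ht HZt. apply locally_R_iff in HZt.
          destruct HZt as (e & He & HZt).
          assert (Hs : exists s, s <> w /\ Rabs (s - w) < d /\ Rabs (s - t) < e).
          { apply Rabs_def2 in Ht. destruct (Rle_dec w t) as [L|L].
            - exists (t + Rmin (e / 2) ((d - (t - w)) / 2)).
              assert (0 < Rmin (e / 2) ((d - (t - w)) / 2)) by (apply Rmin_pos; lra).
              assert (H1 := Rmin_l (e / 2) ((d - (t - w)) / 2)).
              assert (H2 := Rmin_r (e / 2) ((d - (t - w)) / 2)).
              split; [lra|]. split; apply Rabs_def1; lra.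
            - exists t. split; [lra|]. split; apply Rabs_def1; lra. }
          destruct Hs as (s & Hs1 & Hs2 & Hs3). apply (H s); auto. }
        assert (Nx : ~ Z x) by (apply HZ, Rabs_def1; lra).
        assert (Ny : ~ Z y) by (apply HZ, Rabs_def1; lra).
        repeat split; tauto.
    - intros x y z [H1 H2] [H3 H4]. split; [tauto|]. intros HZ t Ht.
      destruct (Rle_dec t y); [apply H2|apply H4]; auto; try lra. tauto. }
  intros x Hx. destruct (Rle_dec x c) as [L|L].
  - destruct (Hglue x c) as [H1 H2]; try lra. apply H2; try lra. now apply H1.
  - destruct (Hglue c x) as [H1 H2]; try lra. apply H2; auto; lra.
Qed.

(** If no germ vanishes, every point has a neighbourhood with at most one zero, and
    finitely many of these neighbourhoods cover the interval. *)
Lemma analytic_identity_infinite (f : R -> R) (a b : R) :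
  a <= b -> (forall x, a <= x <= b -> analytic_at f x) ->
  (forall l, exists x, a <= x <= b /\ f x = 0 /\ ~ In x l) ->
  forall x, a <= x <= b -> f x = 0.
Proof.
  intros Hab Han Hinf.
  destruct (classic (exists c, a <= c <= b /\ locally c (fun x => f x = 0)))
    as [(c & Hc & Hz)|N].
  { now apply analytic_identity_from_germ with c. }
  exfalso.
  assert (H : exists l, forall x, a <= x <= b -> f x = 0 -> In x l).
  { apply (interval_gluing (fun u v => exists l,
      forall x, u <= x <= v -> f x = 0 -> In x l)); auto.
    - intros c Hc. destruct (analytic_isolated_zeros f c) as (d & Hd & H); auto.
      exists d; split; auto. intros x y Hax Hyb Hx Hy. destruct H as [H|H].
      + exfalso. apply N. exists c; split; auto. apply locally_R_iff. eauto.
      + exists (c :: nil). intros t Ht Hft. left. apply NNPP. intros C.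
        apply (H t); auto. apply Rabs_def1; lra.
    - intros x y z [l1 H1] [l2 H2]. exists (l1 ++ l2). intros t Ht Hft.
      apply in_or_app. destruct (Rle_dec t y); [left; apply H1|right; apply H2];
      auto; lra. }
  destruct H as [l H]. destruct (Hinf l) as (x & Hx & Hfx & Hl).
  now apply Hl, H.
Qed.

(** * Cauchy's formula *)

(** The partial derivatives are arguments, so that the rules of calculus below compute them. *)
Definition C1 (W : plane -> Prop) (u p q : R -> R -> R) : Prop :=
  forall x y, W (x, y) ->
    is_derive (fun s => u s y) x (p x y) /\
    is_derive (fun s => u x s) y (q x y) /\
    continuity_2d_pt p x y /\ continuity_2d_pt q x y.

Lemma locally_pair_iff (P : plane -> Prop) (x y : R) :
  locally (x, y) P <-> exists d, 0 < d /\
    forall u v, Rabs (u - x) < d -> Rabs (v - y) < d -> P (u, v).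
Proof.
  split.
  - intros [d H]. exists d; split; [apply cond_pos|]. intros u v Hu Hv.
    apply H. split; assumption.
  - intros (d & Hd & H). exists (mkposreal d Hd). intros [u v] [Hu Hv].
    now apply H.
Qed.

Lemma open_pair (W : plane -> Prop) (x y : R) :
  open W -> W (x, y) -> exists d, 0 < d /\
    forall u v, Rabs (u - x) < d -> Rabs (v - y) < d -> W (u, v).
Proof. intros HW Hxy. apply locally_pair_iff. now apply HW. Qed.

Lemma C1_differentiable (W : plane -> Prop) (u p q : R -> R -> R) (x y : R) :
  open W -> C1 W u p q -> W (x, y) -> differentiable_pt_lim u x y (p x y) (q x y).
Proof.
  intros HW Hu Hxy.
  destruct (open_pair W x y HW Hxy) as (d & Hd & Hball).
  destruct (Hu x y Hxy) as (H1 & H2 & H3 & H4).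
  apply filterdiff_differentiable_pt_lim.
  apply (is_derive_filterdiff u x y p (q x y)).
  - apply locally_pair_iff. exists d; split; auto. intros s t Hs Ht.
    apply (Hu s t). now apply Hball.
  - exact H2.
  - now apply continuity_2d_pt_filterlim.
Qed.

Lemma C1_curve (W : plane -> Prop) (u p q : R -> R -> R)
    (c1 c2 : R -> R) (t d1 d2 : R) :
  open W -> C1 W u p q -> W (c1 t, c2 t) ->
  is_derive c1 t d1 -> is_derive c2 t d2 ->
  is_derive (fun s => u (c1 s) (c2 s)) t
    (p (c1 t) (c2 t) * d1 + q (c1 t) (c2 t) * d2).
Proof.
  intros HW Hu Ht H1 H2. apply is_derive_Reals.
  apply derivable_pt_lim_comp_2d; try now apply is_derive_Reals.
  now apply C1_differentiable with W.
Qed.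

Lemma C1_continuous (W : plane -> Prop) (u p q : R -> R -> R) (x y : R) :
  open W -> C1 W u p q -> W (x, y) -> continuity_2d_pt u x y.
Proof.
  intros HW Hu Hxy. apply differentiable_continuity_pt.
  eexists. eexists. apply C1_differentiable with W; eauto.
Qed.

(** [u + i v] is holomorphic with derivative [p - i q]. *)
Definition CR (W : plane -> Prop) (u v p q : R -> R -> R) : Prop :=
  C1 W u p q /\ C1 W v (fun x y => - q x y) p.

Lemma CR_times_minus_i (W : plane -> Prop) (u v p q : R -> R -> R) :
  CR W u v p q -> CR W v (fun x y => - u x y) (fun x y => - q x y) p.
Proof.
  intros [Hu Hv]. split; auto. intros x y Hxy.
  destruct (Hu x y Hxy) as (H1 & H2 & H3 & H4). split; [|split; [|split]].
  - apply (is_derive_opp (fun s => u s y)). exact H1.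
  - apply (is_derive_opp (fun s => u x s)). exact H2.
  - now apply continuity_2d_pt_opp.
  - now apply continuity_2d_pt_opp.
Qed.

(** [|1 - c e^(it)|^2], the denominator of the Cauchy kernel. *)
Definition kernel_den (c t : R) : R := 1 - 2 * c * cos t + c ^ 2.

Lemma kernel_den_lower (c t : R) : (1 - Rabs c) ^ 2 <= kernel_den c t.
Proof.
  unfold kernel_den. assert (c * cos t <= Rabs c).
  { apply Rle_trans with (Rabs (c * cos t)); [apply Rle_abs|].
    rewrite Rabs_mult. rewrite <- (Rmult_1_r (Rabs c)) at 2.
    apply Rmult_le_compat_l; [apply Rabs_pos|].
    apply Rabs_le. apply COS_bound. }
  assert (Rabs c ^ 2 = c ^ 2) by (rewrite <- Rsqr_pow2, <- Rsqr_pow2; symmetry; apply Rsqr_abs).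
  nra.
Qed.

Lemma kernel_den_pos (c t : R) : Rabs c < 1 -> 0 < kernel_den c t.
Proof.
  intros Hc. apply Rlt_le_trans with ((1 - Rabs c) ^ 2); [|apply kernel_den_lower].
  apply pow_lt. lra.
Qed.

(** The real part of [(U + i V) e^(-int) / (1 - c e^(-it))], which is [c^(-n)] times the
    [n]-th tail of the geometric series of [c e^(-it)].  For [n = 0] it is the Cauchy
    kernel applied to [U + i V]. *)
Definition remainder (U V : R -> R) (c : R) (n : nat) (t : R) : R :=
  (U t * (cos (INR n * t) - c * cos (INR n * t - t)) +
   V t * (sin (INR n * t) - c * sin (INR n * t - t))) / kernel_den c t.

Lemma remainder_step (U V : R -> R) (c : R) (n : nat) (t : R) : Rabs c < 1 ->
  U t * cos (INR n * t) + V t * sin (INR n * t) =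
  remainder U V c n t - c * remainder U V c (S n) t.
Proof.
  intros Hc. assert (Hd := kernel_den_pos c t Hc). unfold remainder.
  rewrite S_INR. replace ((INR n + 1) * t) with (INR n * t + t) by ring.
  replace (INR n * t + t - t) with (INR n * t) by ring.
  rewrite cos_plus, cos_minus, sin_plus, sin_minus.
  assert (Hs : sin t ^ 2 = 1 - cos t ^ 2).
  { generalize (sin2_cos2 t). unfold Rsqr. nra. }
  unfold kernel_den in *. field. lra.
Qed.

Lemma remainder_bound (U V : R -> R) (c : R) (n : nat) (t : R) : Rabs c < 1 ->
  Rabs (remainder U V c n t) <= (Rabs (U t) + Rabs (V t)) * (2 / (1 - Rabs c) ^ 2).
Proof.
  intros Hc. assert (Hd := kernel_den_pos c t Hc). unfold remainder, Rdiv.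
  rewrite Rabs_mult. rewrite (Rabs_pos_eq (/ kernel_den c t)).
  2: now apply Rlt_le, Rinv_0_lt_compat.
  rewrite <- Rmult_assoc. apply Rmult_le_compat.
  - apply Rabs_pos.
  - now apply Rlt_le, Rinv_0_lt_compat.
  - assert (Hb : forall a b, -1 <= a <= 1 -> -1 <= b <= 1 -> Rabs (a - c * b) <= 2).
    { intros a b Ha Hb. apply Rabs_def2 in Hc. apply Rabs_le. split; nra. }
    eapply Rle_trans; [apply Rabs_triang|]. rewrite !Rabs_mult, Rmult_plus_distr_r.
    apply Rplus_le_compat; apply Rmult_le_compat_l; try apply Rabs_pos;
      apply Hb; apply COS_bound || apply SIN_bound.
  - apply Rinv_le_contravar; [apply pow_lt; lra|]. apply kernel_den_lower.
Qed.

Lemma ex_RInt_cont (f : R -> R) (a b : R) :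
  (forall t, continuity_pt f t) -> ex_RInt f a b.
Proof.
  intros H. apply (ex_RInt_continuous f). intros t _.
  apply continuity_pt_filterlim, H.
Qed.

Lemma continuity_smooth (f : R -> R) (t : R) : ex_derive f t -> continuity_pt f t.
Proof. intros H. apply continuity_pt_filterlim. now apply (ex_derive_continuous f). Qed.

Lemma remainder_continuity (U V : R -> R) (c : R) (n : nat) : Rabs c < 1 ->
  (forall t, continuity_pt U t) -> (forall t, continuity_pt V t) ->
  forall t, continuity_pt (remainder U V c n) t.
Proof.
  intros Hc HU HV t. unfold remainder.
  apply (continuity_pt_mult _ (fun t => / kernel_den c t)).
  - apply continuity_pt_plus; apply continuity_pt_mult; auto;
      apply continuity_smooth; auto_derive; auto.
  - apply continuity_smooth. unfold kernel_den. auto_derive.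
    generalize (kernel_den_pos c t Hc). unfold kernel_den. lra.
Qed.

(** Write [J n] for the integral of the [n]-th remainder.  The [n]-th coefficient integral is
    [J n - c * J (S n)], so the partial sums telescope, and [J] is bounded. *)
Lemma kernel_series (U V : R -> R) (c : R) : Rabs c < 1 ->
  (forall t, continuity_pt U t) -> (forall t, continuity_pt V t) ->
  is_series (fun n => c ^ n *
      RInt (fun t => U t * cos (INR n * t) + V t * sin (INR n * t)) 0 (2 * PI))
    (RInt (remainder U V c 0) 0 (2 * PI)).
Proof.
  intros Hc HU HV.
  set (J := fun n => RInt (remainder U V c n) 0 (2 * PI)).
  assert (HJ : forall n, ex_RInt (remainder U V c n) 0 (2 * PI)).
  { intros n. apply ex_RInt_cont. now apply remainder_continuity. }
  assert (Hstep : forall n,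
    RInt (fun t => U t * cos (INR n * t) + V t * sin (INR n * t)) 0 (2 * PI)
    = J n - c * J (S n)).
  { intros n. apply is_RInt_unique.
    apply is_RInt_ext with (fun t => minus (remainder U V c n t)
       (scal c (remainder U V c (S n) t))).
    - intros t _. symmetry. now apply remainder_step.
    - apply (is_RInt_minus (remainder U V c n)).
      + now apply (RInt_correct (remainder U V c n)).
      + apply (is_RInt_scal (remainder U V c (S n))).
        now apply (RInt_correct (remainder U V c (S n))). }
  set (B := RInt (fun t => (Rabs (U t) + Rabs (V t)) * (2 / (1 - Rabs c) ^ 2)) 0 (2 * PI)).
  assert (Hpi : 0 <= 2 * PI) by (generalize PI_RGT_0; lra).
  assert (HB : forall n, Rabs (J n) <= B).
  { intros n. unfold J, B. eapply Rle_trans; [apply abs_RInt_le; auto|].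
    apply RInt_le; auto.
    - apply ex_RInt_cont. intros t. apply (continuity_pt_comp _ Rabs).
      + now apply remainder_continuity.
      + apply Rcontinuity_abs.
    - apply ex_RInt_cont. intros t. apply continuity_pt_mult.
      + apply continuity_pt_plus; (apply (continuity_pt_comp _ Rabs);
          [auto|apply Rcontinuity_abs]).
      + apply continuity_pt_const. intros ? ?; reflexivity.
    - intros t _. now apply remainder_bound. }
  assert (Hsum : forall n, sum_n (fun n => c ^ n *
      RInt (fun t => U t * cos (INR n * t) + V t * sin (INR n * t)) 0 (2 * PI)) n
      = J 0%nat - c ^ S n * J (S n)).
  { intros n. induction n as [|n IH].
    - rewrite sum_O, Hstep. simpl. ring.
    - rewrite sum_Sn, IH, Hstep. unfold plus; simpl. ring. }
  change (is_lim_seq (sum_n (fun n => c ^ n *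
      RInt (fun t => U t * cos (INR n * t) + V t * sin (INR n * t)) 0 (2 * PI)))
      (J 0%nat)).
  apply is_lim_seq_ext with (fun n => J 0%nat - c ^ S n * J (S n)).
  { intros n. now rewrite Hsum. }
  replace (Finite (J 0%nat)) with (Finite (J 0%nat - 0)) by (f_equal; ring).
  apply is_lim_seq_minus'; [apply is_lim_seq_const|].
  apply is_lim_seq_abs_0.
  apply is_lim_seq_le_le with (fun _ => 0) (fun n => B * Rabs c ^ S n).
  - intros n. split; [apply Rabs_pos|]. rewrite Rabs_mult, RPow_abs, Rmult_comm.
    apply Rmult_le_compat_r; [apply Rabs_pos|auto].
  - apply is_lim_seq_const.
  - replace (Finite 0) with (Finite (B * 0)) by (f_equal; ring).
    apply (is_lim_seq_scal_l _ B 0). apply -> is_lim_seq_incr_1.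
    apply is_lim_seq_geom. now rewrite Rabs_Rabsolu.
Qed.

Lemma is_derive_combination (f g : R -> R) (x df dg a b k : R) :
  is_derive f x df -> is_derive g x dg ->
  is_derive (fun y => (f y * a + g y * b) * k) x ((df * a + dg * b) * k).
Proof.
  intros Hf Hg. auto_derive.
  - repeat split; eexists; eauto.
  - assert (Ef : Derive (fun y => f y) x = df) by now apply is_derive_unique.
    assert (Eg : Derive (fun y => g y) x = dg) by now apply is_derive_unique.
    rewrite Ef, Eg. ring.
Qed.

Lemma continuity_2d_pt_comp (f g h : R -> R -> R) (x y : R) :
  continuity_2d_pt f (g x y) (h x y) ->
  continuity_2d_pt g x y -> continuity_2d_pt h x y ->
  continuity_2d_pt (fun u v => f (g u v) (h u v)) x y.
Proof.
  intros Hf Hg Hh eps. destruct (Hf eps) as [d Hd].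
  destruct (Hg d) as [d1 Hd1]. destruct (Hh d) as [d2 Hd2].
  exists (mkposreal _ (Rmin_stable_in_posreal d1 d2)). simpl. intros u v Hu Hv.
  apply Hd.
  - apply Hd1; eapply Rlt_le_trans; eauto; apply Rmin_l.
  - apply Hd2; eapply Rlt_le_trans; eauto; apply Rmin_r.
Qed.

Lemma continuity_2d_pt_fst (f : R -> R) (x y : R) :
  ex_derive f x -> continuity_2d_pt (fun u _ => f u) x y.
Proof.
  intros H. apply (continuity_1d_2d_pt_comp f (fun u _ => u)).
  - now apply continuity_smooth.
  - apply continuity_2d_pt_id1.
Qed.

Lemma continuity_2d_pt_snd (f : R -> R) (x y : R) :
  ex_derive f y -> continuity_2d_pt (fun _ v => f v) x y.
Proof.
  intros H. apply (continuity_1d_2d_pt_comp f (fun _ v => v)).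
  - now apply continuity_smooth.
  - apply continuity_2d_pt_id2.
Qed.

Lemma continuity_2d_pt_slice (f : R -> R -> R) (x y : R) :
  continuity_2d_pt f x y -> continuity_pt (fun v => f x v) y.
Proof.
  intros H. apply continuity_pt_filterlim. apply continuity_2d_pt_filterlim in H.
  apply (filterlim_comp _ _ _ (fun v => (x, v))
    (fun z => f (fst z) (snd z)) _ (locally (x, y)) _); auto.
  intros P HP. apply locally_pair_iff in HP. destruct HP as (d & Hd & HP).
  exists (mkposreal d Hd). intros v Hv. apply HP; auto.
  unfold Rminus. now rewrite Rplus_opp_r, Rabs_R0.
Qed.

Definition box (r : R) : plane -> Prop := fun P => Rabs (fst P) < r /\ Rabs (snd P) < r.

Lemma open_box (r : R) : open (box r).
Proof.
  intros [x y] [Hx Hy]. simpl in *. apply locally_pair_iff.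
  exists (Rmin (r - Rabs x) (r - Rabs y)). split; [apply Rmin_pos; lra|].
  intros u v Hu Hv. split; simpl.
  - replace u with ((u - x) + x) by ring.
    eapply Rle_lt_trans; [apply Rabs_triang|].
    generalize (Rmin_l (r - Rabs x) (r - Rabs y)). lra.
  - replace v with ((v - y) + y) by ring.
    eapply Rle_lt_trans; [apply Rabs_triang|].
    generalize (Rmin_r (r - Rabs x) (r - Rabs y)). lra.
Qed.

(** The points [s + lam (rho e^(it) - s)]: as [lam] goes from 0 to 1, the circle of
    radius [rho] about 0 grows out of its interior point [s]. *)
Definition dilx (rho s lam t : R) : R := s + lam * (rho * cos t - s).
Definition dily (rho lam t : R) : R := lam * (rho * sin t).

Lemma dil_in_box (r rho s lam t : R) :
  0 < rho -> rho = r / 2 -> Rabs s < rho -> -1/4 < lam < 5/4 ->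
  box r (dilx rho s lam t, dily rho lam t).
Proof.
  intros H0 Hrho Hs Hlam. generalize (COS_bound t) (SIN_bound t). intros Hc Hsn.
  assert (Hl : Rabs (1 - lam) + Rabs lam < 3 / 2).
  { unfold Rabs. destruct (Rcase_abs (1 - lam)), (Rcase_abs lam); lra. }
  assert (Hl1 := Rabs_pos (1 - lam)). assert (Hl2 := Rabs_pos lam).
  apply Rabs_le in Hc. apply Rabs_le in Hsn. unfold dilx, dily. split; simpl.
  - replace (s + lam * (rho * cos t - s)) with ((1 - lam) * s + lam * (rho * cos t)) by ring.
    eapply Rle_lt_trans; [apply Rabs_triang|].
    rewrite !Rabs_mult, (Rabs_pos_eq rho) by lra.
    assert (Rabs lam * (rho * Rabs (cos t)) <= Rabs lam * rho)
      by (apply Rmult_le_compat_l; [auto|nra]).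
    nra.
  - rewrite !Rabs_mult, (Rabs_pos_eq rho) by lra.
    assert (Rabs lam * (rho * Rabs (sin t)) <= Rabs lam * rho)
      by (apply Rmult_le_compat_l; [auto|nra]).
    nra.
Qed.

Lemma derive_dilx (rho s t lam : R) :
  is_derive (fun l => dilx rho s l t) lam (rho * cos t - s) /\
  is_derive (fun l => dily rho l t) lam (rho * sin t) /\
  is_derive (fun t => dilx rho s lam t) t (- (lam * (rho * sin t))) /\
  is_derive (fun t => dily rho lam t) t (lam * (rho * cos t)).
Proof.
  unfold dilx, dily. split; [|split; [|split]]; auto_derive; auto; ring.
Qed.

Lemma dil_continuity (rho s lam t : R) :
  continuity_2d_pt (fun l t => dilx rho s l t) lam t /\
  continuity_2d_pt (fun l t => dily rho l t) lam t.
Proof.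
  unfold dilx, dily. split.
  - apply continuity_2d_pt_plus; [apply continuity_2d_pt_const|].
    apply continuity_2d_pt_mult; [apply continuity_2d_pt_id1|].
    apply (continuity_2d_pt_snd (fun t => rho * cos t - s)). auto_derive; auto.
  - apply continuity_2d_pt_mult; [apply continuity_2d_pt_id1|].
    apply (continuity_2d_pt_snd (fun t => rho * sin t)). auto_derive; auto.
Qed.

(** The derivative in [lam] is the integral over the circle of [Re (f' (z) rho e^(it))], that
    is, of the [t]-derivative of [Im f / lam], and so vanishes by periodicity.  At [lam = 0]
    the integral is a multiple of [f s]: this is Cauchy's formula. *)
Lemma cauchy_kernel_constant (r rho s : R) (u v p q : R -> R -> R) :
  0 < rho -> rho = r / 2 -> Rabs s < rho -> CR (box r) u v p q ->
  RInt (remainder (fun t => u (dilx rho s 1 t) (dily rho 1 t))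
                  (fun t => v (dilx rho s 1 t) (dily rho 1 t)) (s / rho) 0) 0 (2 * PI) =
  RInt (remainder (fun t => u (dilx rho s 0 t) (dily rho 0 t))
                  (fun t => v (dilx rho s 0 t) (dily rho 0 t)) (s / rho) 0) 0 (2 * PI).
Proof.
  intros Hrho Hr Hs [Hu Hv].
  assert (Hc : Rabs (s / rho) < 1).
  { unfold Rdiv. rewrite Rabs_mult, (Rabs_pos_eq (/ rho)).
    - apply Rmult_lt_reg_r with rho; auto. rewrite Rmult_assoc, Rinv_l; lra.
    - left. now apply Rinv_0_lt_compat. }
  set (c := s / rho) in *.
  assert (Hsc : s = c * rho) by (unfold c; field; lra).
  set (f := fun l => remainder (fun t => u (dilx rho s l t) (dily rho l t))
                  (fun t => v (dilx rho s l t) (dily rho l t)) c 0).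
  set (D := fun l t => rho * (p (dilx rho s l t) (dily rho l t) * cos t +
                              q (dilx rho s l t) (dily rho l t) * sin t)).
  assert (HD : forall l t, -1/4 < l < 5/4 -> is_derive (fun l => f l t) l (D l t)).
  { intros l t Hl. destruct (derive_dilx rho s t l) as (D1 & D2 & _ & _).
    assert (Hb := dil_in_box r rho s l t Hrho Hr Hs Hl).
    assert (Eu := C1_curve _ _ _ _ (fun l => dilx rho s l t)
      (fun l => dily rho l t) _ _ _ (open_box r) Hu Hb D1 D2).
    assert (Ev := C1_curve _ _ _ _ (fun l => dilx rho s l t)
      (fun l => dily rho l t) _ _ _ (open_box r) Hv Hb D1 D2).
    simpl in Eu, Ev. unfold f, remainder, Rdiv.
    assert (Hd := kernel_den_pos c t Hc).
    replace (D l t) with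
      (((- q (dilx rho s l t) (dily rho l t) * (rho * cos t - s) +
         p (dilx rho s l t) (dily rho l t) * (rho * sin t)) *
        (sin (INR 0 * t) - c * sin (INR 0 * t - t)) +
        (p (dilx rho s l t) (dily rho l t) * (rho * cos t - s) +
         q (dilx rho s l t) (dily rho l t) * (rho * sin t)) *
        (cos (INR 0 * t) - c * cos (INR 0 * t - t))) * / kernel_den c t).
    { apply is_derive_ext with (2 := is_derive_combination _ _ _ _ _ _ _ (/ kernel_den c t) Ev Eu).
      intros z. simpl. ring. }
    simpl INR.
    rewrite Rmult_0_l, Rminus_0_l, cos_0, sin_0, cos_neg, sin_neg.
    assert (Hs2 : sin t ^ 2 = 1 - cos t ^ 2).
    { generalize (sin2_cos2 t). unfold Rsqr. nra. }
    apply Rmult_eq_reg_r with (kernel_den c t); [|lra].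
    unfold D. rewrite !Rmult_assoc, Rinv_l, Rmult_1_r by lra.
    generalize (p (dilx rho s l t) (dily rho l t)) (q (dilx rho s l t) (dily rho l t)).
    intros P Q. unfold kernel_den. rewrite Hsc. ring_simplify. rewrite Hs2. ring. }
  assert (HDc : forall l t, -1/4 < l < 5/4 -> continuity_2d_pt D l t).
  { intros l t Hl. assert (Hb := dil_in_box r rho s l t Hrho Hr Hs Hl).
    destruct (dil_continuity rho s l t) as [C1' C2'].
    destruct (Hu _ _ Hb) as (_ & _ & Cp & Cq). unfold D.
    apply (continuity_2d_pt_mult (fun _ _ => rho)); [apply continuity_2d_pt_const|].
    apply continuity_2d_pt_plus; apply continuity_2d_pt_mult.
    - now apply (continuity_2d_pt_comp p).
    - apply (continuity_2d_pt_snd cos). auto_derive; auto.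
    - now apply (continuity_2d_pt_comp q).
    - apply (continuity_2d_pt_snd sin). auto_derive; auto. }
  assert (Hfc : forall l t, -1/4 < l < 5/4 -> continuity_pt (f l) t).
  { intros l t Hl. assert (Hb := dil_in_box r rho s l).
    apply remainder_continuity; auto; intros t'; specialize (Hb t' Hrho Hr Hs Hl);
    destruct (dil_continuity rho s l t') as [C1' C2'];
    apply (continuity_2d_pt_slice (fun l t => _ (dilx rho s l t) (dily rho l t)));
    apply continuity_2d_pt_comp; auto; eapply C1_continuous; eauto; apply open_box. }
  assert (Hnear : forall l, -1/4 < l < 5/4 -> locally l (fun l => -1/4 < l < 5/4)).
  { intros l Hl. apply locally_R_iff. exists (Rmin (l + 1/4) (5/4 - l)).
    split; [apply Rmin_pos; lra|]. intros y Hy.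
    assert (H1 := Rmin_l (l + 1/4) (5/4 - l)). assert (H2 := Rmin_r (l + 1/4) (5/4 - l)).
    apply Rabs_def2 in Hy. lra. }
  assert (Hder : forall l, 0 <= l <= 1 ->
    is_derive (fun l => RInt (f l) 0 (2 * PI)) l (RInt (D l) 0 (2 * PI))).
  { intros l Hl. assert (Hl' : -1/4 < l < 5/4) by lra.
    replace (RInt (D l) 0 (2 * PI)) with
      (RInt (fun t => Derive (fun l => f l t) l) 0 (2 * PI)).
    - apply (is_derive_RInt_param f).
      + generalize (Hnear l Hl'). apply filter_imp. intros l' Hl'' t _.
        exists (D l' t). now apply HD.
      + intros t _. apply continuity_2d_pt_ext_loc with D; [|now apply HDc].
        destruct (Hnear l Hl') as [e He]. exists e. intros l' t' Hl'' _.
        symmetry. apply is_derive_unique, HD, He, Hl''.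
      + generalize (Hnear l Hl'). apply filter_imp. intros l' Hl''.
        apply ex_RInt_cont. intros t. now apply Hfc.
    - apply RInt_ext. intros t _. apply is_derive_unique. now apply HD. }
  assert (Hzero : forall l, 0 < l <= 1 -> RInt (D l) 0 (2 * PI) = 0).
  { intros l Hl. assert (Hl' : -1/4 < l < 5/4) by lra.
    assert (HI : is_RInt (fun t => l * D l t) 0 (2 * PI)
       (minus (v (dilx rho s l (2 * PI)) (dily rho l (2 * PI)))
              (v (dilx rho s l 0) (dily rho l 0)))).
    { apply (is_RInt_derive (fun t => v (dilx rho s l t) (dily rho l t))).
      - intros t _. destruct (derive_dilx rho s t l) as (_ & _ & D1 & D2).
        assert (Hb := dil_in_box r rho s l t Hrho Hr Hs Hl').
        assert (Ev := C1_curve _ _ _ _ (fun t => dilx rho s l t)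
          (fun t => dily rho l t) _ _ _ (open_box r) Hv Hb D1 D2).
        simpl in Ev. unfold D.
        replace (l * _) with
          (- q (dilx rho s l t) (dily rho l t) * - (l * (rho * sin t)) +
           p (dilx rho s l t) (dily rho l t) * (l * (rho * cos t))) by ring.
        exact Ev.
      - intros t _. apply continuity_pt_filterlim.
        apply (continuity_2d_pt_slice (fun x t => l * D x t) l t).
        apply continuity_2d_pt_mult; [apply continuity_2d_pt_const|now apply HDc]. }
    assert (E : dilx rho s l (2 * PI) = dilx rho s l 0 /\
                dily rho l (2 * PI) = dily rho l 0).
    { unfold dilx, dily. now rewrite cos_2PI, sin_2PI, cos_0, sin_0. }
    destruct E as [-> ->] in HI.
    unfold minus, plus, opp in HI; simpl in HI. rewrite Rplus_opp_r in HI.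
    assert (HS : is_RInt (fun t => l * D l t) 0 (2 * PI) (l * RInt (D l) 0 (2 * PI))).
    { apply (is_RInt_scal (D l)), (RInt_correct (D l)), ex_RInt_cont.
      intros t. apply (continuity_2d_pt_slice D l t). now apply HDc. }
    assert (E : l * RInt (D l) 0 (2 * PI) = 0).
    { rewrite <- (is_RInt_unique (fun t => l * D l t) _ _ _ HS).
      apply (is_RInt_unique (fun t => l * D l t)). exact HI. }
    apply Rmult_integral in E. destruct E; lra. }
  destruct (MVT_gen (fun l => RInt (f l) 0 (2 * PI)) 0 1
    (fun l => if Rle_dec l 0 then 0 else RInt (D l) 0 (2 * PI))) as (l & Hl & E).
  - rewrite Rmin_left, Rmax_right by lra. intros l Hl.
    destruct (Rle_dec l 0); [lra|]. apply Hder. lra.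
  - rewrite Rmin_left, Rmax_right by lra. intros l Hl.
    apply continuity_smooth. eexists. now apply Hder.
  - rewrite Rmin_left, Rmax_right in Hl by lra.
    change (RInt (f 1) 0 (2 * PI) = RInt (f 0) 0 (2 * PI)).
    destruct (Rle_dec l 0); [lra|]. rewrite Hzero in E by lra. lra.
Qed.

Lemma RInt_cos_n (n : nat) : RInt (fun t => cos (INR n * t)) 0 (2 * PI) =
  match n with O => 2 * PI | S _ => 0 end.
Proof.
  destruct n as [|n].
  - rewrite (RInt_ext _ (fun _ => 1)).
    + rewrite RInt_const. unfold scal; simpl. unfold mult; simpl. ring.
    + intros t _. simpl. now rewrite Rmult_0_l, cos_0.
  - assert (Hn : INR (S n) <> 0) by now apply not_0_INR.
    apply is_RInt_unique.
    replace 0 with (minus (sin (INR (S n) * (2 * PI)) / INR (S n)) (sin (INR (S n) * 0) / INR (S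
        n))) at 2.
    + apply (is_RInt_derive (fun t => sin (INR (S n) * t) / INR (S n))).
      * intros t _. revert Hn. generalize (INR (S n)). intros k Hk.
        auto_derive; auto. now field.
      * intros t _. apply continuity_pt_filterlim, continuity_smooth.
        auto_derive; auto.
    + rewrite Rmult_0_r, sin_0. replace (INR (S n) * (2 * PI)) with (0 + 2 * INR (S n) * PI) by
        ring.
      rewrite sin_period, sin_0. unfold minus, plus, opp; simpl. lra.
Qed.

Lemma RInt_sin_n (n : nat) : RInt (fun t => sin (INR n * t)) 0 (2 * PI) = 0.
Proof.
  destruct n as [|n].
  - rewrite (RInt_ext _ (fun _ => 0)).
    + rewrite RInt_const. unfold scal; simpl. unfold mult; simpl. ring.
    + intros t _. simpl. now rewrite Rmult_0_l, sin_0.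
  - assert (Hn : INR (S n) <> 0) by now apply not_0_INR.
    apply is_RInt_unique.
    replace 0 with (minus (- cos (INR (S n) * (2 * PI)) / INR (S n)) (- cos (INR (S n) * 0) /
        INR (S n))) at 2.
    + apply (is_RInt_derive (fun t => - cos (INR (S n) * t) / INR (S n))).
      * intros t _. revert Hn. generalize (INR (S n)). intros k Hk.
        auto_derive; auto. now field.
      * intros t _. apply continuity_pt_filterlim, continuity_smooth.
        auto_derive; auto.
    + rewrite Rmult_0_r, cos_0. replace (INR (S n) * (2 * PI)) with (0 + 2 * INR (S n) * PI) by
        ring.
      rewrite cos_period, cos_0. unfold minus, plus, opp; simpl. lra.
Qed.

Lemma kernel_integral_const (a b c : R) : Rabs c < 1 ->
  RInt (remainder (fun _ => a) (fun _ => b) c 0) 0 (2 * PI) = a * (2 * PI).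
Proof.
  intros Hc.
  assert (H := kernel_series (fun _ => a) (fun _ => b) c Hc).
  assert (H1 := is_series_unique _ _ (H (fun t => continuity_smooth _ t (ex_derive_const _ _))
     (fun t => continuity_smooth _ t (ex_derive_const _ _)))).
  rewrite <- H1. apply is_series_unique.
  apply filterlim_ext with (fun _ => a * (2 * PI)); [|apply filterlim_const].
  assert (E : forall n, RInt (fun t => a * cos (INR n * t) + b * sin (INR n * t)) 0 (2 * PI)
     = match n with O => a * (2 * PI) | S _ => 0 end).
  { intros n. transitivity (a * RInt (fun t => cos (INR n * t)) 0 (2 * PI) +
                            b * RInt (fun t => sin (INR n * t)) 0 (2 * PI)).
    - apply is_RInt_unique.
      apply (is_RInt_plus (fun t => scal a (cos (INR n * t)))).
      + apply (is_RInt_scal (fun t => cos (INR n * t))),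
          (RInt_correct (fun t => cos (INR n * t))), ex_RInt_cont.
        intros t. apply continuity_smooth. auto_derive; auto.
      + apply (is_RInt_scal (fun t => sin (INR n * t))),
          (RInt_correct (fun t => sin (INR n * t))), ex_RInt_cont.
        intros t. apply continuity_smooth. auto_derive; auto.
    - rewrite RInt_cos_n, RInt_sin_n. destruct n; simpl; ring. }
  intros n. induction n as [|n IH].
  - rewrite sum_O, E. simpl. apply eq_sym, Rmult_1_l.
  - rewrite sum_Sn, <- IH, E. unfold plus; simpl.
    now rewrite Rmult_0_r, Rplus_0_r.
Qed.

Lemma CR_analytic_center (r : R) (u v p q : R -> R -> R) :
  0 < r -> CR (box r) u v p q -> analytic_at (fun s => u s 0) 0.
Proof.
  intros Hr Huv. set (rho := r / 2). assert (Hrho : 0 < rho) by (unfold rho; lra).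
  set (U := fun t => u (rho * cos t) (rho * sin t)).
  set (V := fun t => v (rho * cos t) (rho * sin t)).
  assert (Hpi := PI_RGT_0).
  apply analytic_of_pseries with (fun n => / (2 * PI) * (/ rho ^ n *
    RInt (fun t => U t * cos (INR n * t) + V t * sin (INR n * t)) 0 (2 * PI))) rho; auto.
  intros s Hs. rewrite Rplus_0_l.
  assert (Hc : Rabs (s / rho) < 1).
  { unfold Rdiv. rewrite Rabs_mult, (Rabs_pos_eq (/ rho)).
    - apply Rmult_lt_reg_r with rho; auto. rewrite Rmult_assoc, Rinv_l; lra.
    - left. now apply Rinv_0_lt_compat. }
  assert (E := cauchy_kernel_constant r rho s u v p q Hrho eq_refl Hs Huv).
  assert (E0 : forall t, dilx rho s 0 t = s /\ dily rho 0 t = 0).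
  { intros t. unfold dilx, dily. split; ring. }
  assert (E1 : forall t, dilx rho s 1 t = rho * cos t /\ dily rho 1 t = rho * sin t).
  { intros t. unfold dilx, dily. split; ring. }
  assert (E' : RInt (remainder U V (s / rho) 0) 0 (2 * PI) =
               RInt (remainder (fun _ => u s 0) (fun _ => v s 0) (s / rho) 0) 0 (2 * PI)).
  { etransitivity; [|etransitivity; [exact E|]]; apply RInt_ext; intros t _;
      unfold remainder, U, V; cbv beta.
    - destruct (E1 t) as [-> ->]. reflexivity.
    - destruct (E0 t) as [-> ->]. reflexivity. }
  clear E. rename E' into E.
  rewrite kernel_integral_const in E by auto.
  assert (HU : forall t, continuity_pt U t /\ continuity_pt V t).
  { intros t. destruct Huv as [Hu Hv].
    assert (Hb : box r (rho * cos t, rho * sin t)).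
    { destruct (E1 t) as [<- <-]. apply dil_in_box; auto. lra. }
    split.
    - apply (continuity_2d_pt_slice (fun _ t => u (rho * cos t) (rho * sin t)) 0 t).
      apply (continuity_2d_pt_comp u).
      + eapply C1_continuous; eauto. apply open_box.
      + apply (continuity_2d_pt_snd (fun t => rho * cos t)). auto_derive; auto.
      + apply (continuity_2d_pt_snd (fun t => rho * sin t)). auto_derive; auto.
    - apply (continuity_2d_pt_slice (fun _ t => v (rho * cos t) (rho * sin t)) 0 t).
      apply (continuity_2d_pt_comp v).
      + eapply C1_continuous; eauto. apply open_box.
      + apply (continuity_2d_pt_snd (fun t => rho * cos t)). auto_derive; auto.
      + apply (continuity_2d_pt_snd (fun t => rho * sin t)). auto_derive; auto. }
  assert (HS := kernel_series U V (s / rho) Hc (fun t => proj1 (HU t)) (fun t => proj2 (HU t))).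
  rewrite E in HS. apply is_pseries_R.
  apply (is_series_scal (/ (2 * PI))) in HS.
  replace (u s 0) with (scal (/ (2 * PI)) (u s 0 * (2 * PI))).
  2:{ unfold scal; simpl. unfold mult; simpl. field. lra. }
  revert HS. apply is_series_ext. intros n.
  unfold scal; simpl. unfold mult; simpl. unfold Rdiv. rewrite Rpow_mult_distr, pow_inv.
  ring.
Qed.

(** Restricting a holomorphic function to the line through [(x0, y0)] in
    direction [(a, b)] amounts to precomposing it with the complex affine map
    [z |-> x0 + i y0 + (a + i b) z], which turns that line into the real axis. *)
Lemma CR_analytic_line (W : plane -> Prop) (u v p q : R -> R -> R) (x0 y0 a b : R) :
  open W -> W (x0, y0) -> CR W u v p q ->
  analytic_at (fun s => u (x0 + s * a) (y0 + s * b)) 0.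
Proof.
  intros HW H0 [Hu Hv].
  destruct (open_pair W x0 y0 HW H0) as (d & Hd & Hball).
  set (M := Rabs a + Rabs b + 1).
  assert (HM : 0 < M) by (unfold M; generalize (Rabs_pos a) (Rabs_pos b); lra).
  set (X := fun x y => x0 + (x * a - y * b)). set (Y := fun x y => y0 + (x * b + y * a)).
  assert (Hb : forall x y, box (d / (2 * M)) (x, y) -> W (X x y, Y x y)).
  { intros x y [Hx Hy]; simpl in *.
    assert (Hk : d / (2 * M) * (2 * M) = d) by (field; lra).
    assert (Ba := Rabs_pos a). assert (Bb := Rabs_pos b).
    assert (Bx := Rabs_pos x). assert (By := Rabs_pos y).
    apply Hball.
    - unfold X. replace (x0 + (x * a - y * b) - x0) with (x * a + - (y * b)) by ring.
      eapply Rle_lt_trans; [apply Rabs_triang|]. rewrite Rabs_Ropp, !Rabs_mult.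
      unfold M in *. nra.
    - unfold Y. replace (y0 + (x * b + y * a) - y0) with (x * b + y * a) by ring.
      eapply Rle_lt_trans; [apply Rabs_triang|]. rewrite !Rabs_mult.
      unfold M in *. nra. }
  assert (HC : forall x y, continuity_2d_pt X x y /\ continuity_2d_pt Y x y).
  { intros x y. split.
    - apply (continuity_2d_pt_plus (fun _ _ => x0) (fun x y => x * a - y * b));
        [apply continuity_2d_pt_const|].
      apply (continuity_2d_pt_minus (fun x _ => x * a) (fun _ y => y * b)).
      + apply (continuity_2d_pt_fst (fun x => x * a)). auto_derive; auto.
      + apply (continuity_2d_pt_snd (fun y => y * b)). auto_derive; auto.
    - apply (continuity_2d_pt_plus (fun _ _ => y0) (fun x y => x * b + y * a));
        [apply continuity_2d_pt_const|].
      apply (continuity_2d_pt_plus (fun x _ => x * b) (fun _ y => y * a)).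
      + apply (continuity_2d_pt_fst (fun x => x * b)). auto_derive; auto.
      + apply (continuity_2d_pt_snd (fun y => y * a)). auto_derive; auto. }
  assert (HD : forall x y, is_derive (fun s => X s y) x a /\ is_derive (fun s => X x s) y (- b) /\
     is_derive (fun s => Y s y) x b /\ is_derive (fun s => Y x s) y a).
  { intros x y. unfold X, Y. split; [|split; [|split]]; auto_derive; auto; ring. }
  apply analytic_ext with (fun s => u (X s 0) (Y s 0)).
  { intros s. unfold X, Y. f_equal; ring. }
  apply (CR_analytic_center (d / (2 * M)) (fun x y => u (X x y) (Y x y))
    (fun x y => v (X x y) (Y x y))
    (fun x y => p (X x y) (Y x y) * a + q (X x y) (Y x y) * b)
    (fun x y => p (X x y) (Y x y) * - b + q (X x y) (Y x y) * a)).
  { apply Rdiv_lt_0_compat; lra. }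
  split; intros x y Hxy; specialize (Hb x y Hxy);
    destruct (HC x y) as [CX CY]; destruct (HD x y) as (D1 & D2 & D3 & D4);
    destruct (Hu _ _ Hb) as (_ & _ & Cp & Cq);
    (assert (Cp' : continuity_2d_pt (fun x y => p (X x y) (Y x y)) x y)
      by now apply (continuity_2d_pt_comp p));
    (assert (Cq' : continuity_2d_pt (fun x y => q (X x y) (Y x y)) x y)
      by now apply (continuity_2d_pt_comp q));
    (assert (C1' : continuity_2d_pt (fun x y => p (X x y) (Y x y) * a + q (X x y) (Y x y) * b) x y)
      by (apply continuity_2d_pt_plus; apply continuity_2d_pt_mult; auto;
          apply continuity_2d_pt_const));
    (assert (C2' : continuity_2d_pt (fun x y => p (X x y) (Y x y) * - b + q (X x y) (Y x y) * a)
        x y)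
      by (apply continuity_2d_pt_plus; apply continuity_2d_pt_mult; auto;
          apply continuity_2d_pt_const)).
  - split; [|split; [|split]]; auto.
    + apply (C1_curve W u p q (fun s => X s y) (fun s => Y s y)); auto.
    + apply (C1_curve W u p q (fun s => X x s) (fun s => Y x s)); auto.
  - split; [|split; [|split]]; auto.
    + replace (- _) with (- q (X x y) (Y x y) * a + p (X x y) (Y x y) * b) by ring.
      apply (C1_curve W v (fun x y => - q x y) p (fun s => X s y) (fun s => Y s y)); auto.
    + replace (_ + _) with (- q (X x y) (Y x y) * - b + p (X x y) (Y x y) * a) by ring.
      apply (C1_curve W v (fun x y => - q x y) p (fun s => X x s) (fun s => Y x s)); auto.
    + now apply continuity_2d_pt_opp.
Qed.

(** * Calculus of smooth functions of two variables *)

Definition Dx (f : R -> R -> R) : R -> R -> R := fun x y => Derive (fun s => f s y) x.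
Definition Dy (f : R -> R -> R) : R -> R -> R := fun x y => Derive (fun s => f x s) y.

(** Pointwise on an open set, [ex_diff_n] says that the function is [n] times continuously
    differentiable there. *)
Definition Ck (n : nat) (U : plane -> Prop) (f : R -> R -> R) : Prop :=
  forall x y, U (x, y) -> ex_diff_n f n x y.

Definition eq_on (U : plane -> Prop) (f g : R -> R -> R) : Prop :=
  forall x y, U (x, y) -> f x y = g x y.

Lemma eq_on_locally (U : plane -> Prop) (f g : R -> R -> R) (x y : R) :
  open U -> U (x, y) -> eq_on U f g -> locally_2d (fun u v => f u v = g u v) x y.
Proof.
  intros HU Hxy H. destruct (open_pair U x y HU Hxy) as (d & Hd & Hb).
  exists (mkposreal d Hd). intros u v Hu Hv. now apply H, Hb.
Qed.

Lemma Ck_ext (n : nat) (U : plane -> Prop) (f g : R -> R -> R) :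
  open U -> eq_on U f g -> Ck n U f -> Ck n U g.
Proof.
  intros HU H Hf x y Hxy. apply ex_diff_n_ext_loc with f; [|now apply Hf].
  now apply eq_on_locally with U.
Qed.

Lemma Ck_derivatives (n : nat) (U : plane -> Prop) (f : R -> R -> R) :
  Ck (S n) U f -> Ck n U (Dx f) /\ Ck n U (Dy f).
Proof. intros H. split; intros x y Hxy; apply (H x y Hxy). Qed.
Arguments Ck_derivatives {n} {U} {f}.

Lemma Ck_pred (n : nat) (U : plane -> Prop) (f : R -> R -> R) :
  Ck (S n) U f -> Ck n U f.
Proof.
  revert f. induction n as [|n IH]; intros f H x y Hxy.
  - split; [|exact I]. apply (H x y Hxy).
  - destruct (Ck_derivatives H) as [H1 H2].
    destruct (H x y Hxy) as (C & E1 & E2 & _).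
    split; [exact C|]. split; [exact E1|]. split; [exact E2|].
    split; [apply (IH _ H1 x y Hxy)|apply (IH _ H2 x y Hxy)].
Qed.
Arguments Ck_pred {n} {U} {f}.

Lemma Ck_C1 (n : nat) (U : plane -> Prop) (f : R -> R -> R) :
  Ck (S n) U f -> C1 U f (Dx f) (Dy f).
Proof.
  intros H x y Hxy. destruct (H x y Hxy) as (C & E1 & E2 & F1 & F2).
  split; [|split; [|split]].
  - now apply Derive_correct.
  - now apply Derive_correct.
  - destruct n; apply F1.
  - destruct n; apply F2.
Qed.
Arguments Ck_C1 {n} {U} {f}.

Lemma C1_eq_derivatives (U : plane -> Prop) (f p q : R -> R -> R) :
  C1 U f p q -> eq_on U (Dx f) p /\ eq_on U (Dy f) q.
Proof.
  intros H. split; intros x y Hxy; apply is_derive_unique; apply (H x y Hxy).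
Qed.
Arguments C1_eq_derivatives {U} {f} {p} {q}.

Lemma eq_on_sym (U : plane -> Prop) (f g : R -> R -> R) : eq_on U f g -> eq_on U g f.
Proof. intros H x y Hxy. symmetry. now apply H. Qed.

Lemma C1_ext (U : plane -> Prop) (f p q f' p' q' : R -> R -> R) :
  open U -> eq_on U f f' -> eq_on U p p' -> eq_on U q q' ->
  C1 U f p q -> C1 U f' p' q'.
Proof.
  intros HU Hf Hp Hq H x y Hxy. destruct (H x y Hxy) as (D1 & D2 & C1' & C2').
  destruct (open_pair U x y HU Hxy) as (d & Hd & Hb).
  assert (Hself : forall z, Rabs (z - z) < d).
  { intros z. unfold Rminus. now rewrite Rplus_opp_r, Rabs_R0. }
  rewrite <- (Hp x y Hxy), <- (Hq x y Hxy). split; [|split; [|split]].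
  - apply is_derive_ext_loc with (2 := D1).
    exists (mkposreal d Hd). intros s Hs. apply Hf, Hb; auto.
  - apply is_derive_ext_loc with (2 := D2).
    exists (mkposreal d Hd). intros s Hs. apply Hf, Hb; auto.
  - apply continuity_2d_pt_ext_loc with p; auto. now apply eq_on_locally with U.
  - apply continuity_2d_pt_ext_loc with q; auto. now apply eq_on_locally with U.
Qed.

Lemma C1_Ck (n : nat) (U : plane -> Prop) (f p q : R -> R -> R) :
  open U -> C1 U f p q -> Ck n U p -> Ck n U q -> Ck (S n) U f.
Proof.
  intros HU H Hp Hq x y Hxy. destruct (C1_eq_derivatives H) as [E1 E2].
  destruct (H x y Hxy) as (D1 & D2 & _ & _).
  split; [now apply C1_continuous with U p q|].
  split; [eexists; exact D1|]. split; [eexists; exact D2|]. split.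
  - apply (Ck_ext n U p (Dx f)); auto. now apply eq_on_sym.
  - apply (Ck_ext n U q (Dy f)); auto. now apply eq_on_sym.
Qed.

Lemma eq_on_Dx (U : plane -> Prop) (f g : R -> R -> R) :
  open U -> eq_on U f g -> eq_on U (Dx f) (Dx g).
Proof.
  intros HU H x y Hxy. destruct (open_pair U x y HU Hxy) as (d & Hd & Hb).
  apply Derive_ext_loc. exists (mkposreal d Hd). intros s Hs. apply H, Hb; auto.
  unfold Rminus. now rewrite Rplus_opp_r, Rabs_R0.
Qed.

Lemma eq_on_Dy (U : plane -> Prop) (f g : R -> R -> R) :
  open U -> eq_on U f g -> eq_on U (Dy f) (Dy g).
Proof.
  intros HU H x y Hxy. destruct (open_pair U x y HU Hxy) as (d & Hd & Hb).
  apply Derive_ext_loc. exists (mkposreal d Hd). intros s Hs. apply H, Hb; auto.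
  unfold Rminus. now rewrite Rplus_opp_r, Rabs_R0.
Qed.

Lemma Ck_Schwarz (U : plane -> Prop) (f : R -> R -> R) :
  open U -> Ck 2 U f -> eq_on U (Dx (Dy f)) (Dy (Dx f)).
Proof.
  intros HU H x y Hxy. destruct (open_pair U x y HU Hxy) as (d & Hd & Hb).
  apply (Schwarz f x y).
  - exists (mkposreal d Hd). intros u v Hu Hv.
    destruct (H u v (Hb u v Hu Hv)) as (_ & E1 & E2 & F1 & F2).
    split; [exact E1|]. split; [exact E2|]. split; [apply F2|apply F1].
  - destruct (H x y Hxy) as (_ & _ & _ & F1 & F2). apply F2.
  - destruct (H x y Hxy) as (_ & _ & _ & F1 & F2). apply F1.
Qed.

Lemma C1_const (U : plane -> Prop) (c : R) :
  C1 U (fun _ _ => c) (fun _ _ => 0) (fun _ _ => 0).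
Proof.
  intros x y _. split; [|split; [|split]]; try apply continuity_2d_pt_const;
    auto_derive; auto.
Qed.

Lemma C1_fst (U : plane -> Prop) : C1 U (fun x _ => x) (fun _ _ => 1) (fun _ _ => 0).
Proof.
  intros x y _. split; [|split; [|split]]; try apply continuity_2d_pt_const;
    auto_derive; auto.
Qed.

Lemma C1_snd (U : plane -> Prop) : C1 U (fun _ y => y) (fun _ _ => 0) (fun _ _ => 1).
Proof.
  intros x y _. split; [|split; [|split]]; try apply continuity_2d_pt_const;
    auto_derive; auto.
Qed.

Lemma C1_plus (U : plane -> Prop) (f p q f' p' q' : R -> R -> R) :
  C1 U f p q -> C1 U f' p' q' ->
  C1 U (fun x y => f x y + f' x y) (fun x y => p x y + p' x y) (fun x y => q x y + q' x y).
Proof.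
  intros H H' x y Hxy. destruct (H x y Hxy) as (D1 & D2 & ? & ?).
  destruct (H' x y Hxy) as (D1' & D2' & ? & ?).
  split; [|split; [|split]]; try now apply continuity_2d_pt_plus.
  - now apply (is_derive_plus (fun s => f s y) (fun s => f' s y)).
  - now apply (is_derive_plus (fun s => f x s) (fun s => f' x s)).
Qed.
Arguments C1_plus {U} {f} {p} {q} {f'} {p'} {q'}.

Lemma is_derive_Rmult (f g : R -> R) (x df dg : R) :
  is_derive f x df -> is_derive g x dg ->
  is_derive (fun y => f y * g y) x (df * g x + f x * dg).
Proof.
  intros Hf Hg. apply (is_derive_mult f g); auto. exact Rmult_comm.
Qed.

Lemma C1_mult (U : plane -> Prop) (f p q f' p' q' : R -> R -> R) :
  open U -> C1 U f p q -> C1 U f' p' q' ->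
  C1 U (fun x y => f x y * f' x y) (fun x y => p x y * f' x y + f x y * p' x y)
    (fun x y => q x y * f' x y + f x y * q' x y).
Proof.
  intros HU H H' x y Hxy. destruct (H x y Hxy) as (D1 & D2 & ? & ?).
  destruct (H' x y Hxy) as (D1' & D2' & ? & ?).
  assert (continuity_2d_pt f x y) by (eapply C1_continuous; eauto).
  assert (continuity_2d_pt f' x y) by (eapply C1_continuous; eauto).
  split; [|split; [|split]];
    try now apply continuity_2d_pt_plus; apply continuity_2d_pt_mult.
  - now apply (is_derive_Rmult (fun s => f s y) (fun s => f' s y)).
  - now apply (is_derive_Rmult (fun s => f x s) (fun s => f' x s)).
Qed.
Arguments C1_mult {U} {f} {p} {q} {f'} {p'} {q'}.

Lemma C1_scal (U : plane -> Prop) (c : R) (f p q : R -> R -> R) :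
  open U -> C1 U f p q ->
  C1 U (fun x y => c * f x y) (fun x y => c * p x y) (fun x y => c * q x y).
Proof.
  intros HU H. assert (H' := C1_mult HU (C1_const U c) H).
  revert H'. apply C1_ext; auto; intros x y _; simpl; ring.
Qed.
Arguments C1_scal {U} c {f p q}.

Lemma C1_comp (U V : plane -> Prop) (f p q g gx gy h hx hy : R -> R -> R) :
  open U -> open V -> (forall x y, V (x, y) -> U (g x y, h x y)) ->
  C1 U f p q -> C1 V g gx gy -> C1 V h hx hy ->
  C1 V (fun x y => f (g x y) (h x y))
    (fun x y => p (g x y) (h x y) * gx x y + q (g x y) (h x y) * hx x y)
    (fun x y => p (g x y) (h x y) * gy x y + q (g x y) (h x y) * hy x y).
Proof.
  intros HU HV Hmap Hf Hg Hh x y Hxy. specialize (Hmap x y Hxy).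
  destruct (Hf _ _ Hmap) as (_ & _ & Cp & Cq).
  assert (Cg : continuity_2d_pt g x y) by (eapply C1_continuous; eauto).
  assert (Ch : continuity_2d_pt h x y) by (eapply C1_continuous; eauto).
  destruct (Hg x y Hxy) as (Dg1 & Dg2 & ? & ?).
  destruct (Hh x y Hxy) as (Dh1 & Dh2 & ? & ?).
  assert (continuity_2d_pt (fun x y => p (g x y) (h x y)) x y)
    by now apply continuity_2d_pt_comp.
  assert (continuity_2d_pt (fun x y => q (g x y) (h x y)) x y)
    by now apply continuity_2d_pt_comp.
  split; [|split; [|split]];
    try now apply continuity_2d_pt_plus; apply continuity_2d_pt_mult.
  - now apply (C1_curve U f p q (fun s => g s y) (fun s => h s y)).
  - now apply (C1_curve U f p q (fun s => g x s) (fun s => h x s)).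
Qed.
Arguments C1_comp {U} {V} {f} {p} {q} {g} {gx} {gy} {h} {hx} {hy}.

Lemma Ck_const (n : nat) (U : plane -> Prop) (c : R) : open U -> Ck n U (fun _ _ => c).
Proof.
  intros HU. revert c. induction n as [|n IH]; intros c.
  - intros x y _. split; [apply continuity_2d_pt_const|exact I].
  - apply C1_Ck with (2 := C1_const U c); auto.
Qed.

Lemma Ck_fst (n : nat) (U : plane -> Prop) : open U -> Ck n U (fun x _ => x).
Proof.
  intros HU. apply Ck_pred. apply C1_Ck with (2 := C1_fst U); auto; now apply Ck_const.
Qed.

Lemma Ck_snd (n : nat) (U : plane -> Prop) : open U -> Ck n U (fun _ y => y).
Proof.
  intros HU. apply Ck_pred. apply C1_Ck with (2 := C1_snd U); auto; now apply Ck_const.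
Qed.

Lemma Ck_plus (n : nat) (U : plane -> Prop) (f g : R -> R -> R) :
  open U -> Ck n U f -> Ck n U g -> Ck n U (fun x y => f x y + g x y).
Proof.
  intros HU. revert f g. induction n as [|n IH]; intros f g Hf Hg.
  - intros x y Hxy. split; [|exact I].
    apply continuity_2d_pt_plus; [apply (Hf x y Hxy)|apply (Hg x y Hxy)].
  - apply C1_Ck with (2 := C1_plus (Ck_C1 Hf) (Ck_C1 Hg)); auto;
    apply IH; now apply Ck_derivatives.
Qed.

Lemma Ck_mult (n : nat) (U : plane -> Prop) (f g : R -> R -> R) :
  open U -> Ck n U f -> Ck n U g -> Ck n U (fun x y => f x y * g x y).
Proof.
  intros HU. revert f g. induction n as [|n IH]; intros f g Hf Hg.
  - intros x y Hxy. split; [|exact I].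
    apply continuity_2d_pt_mult; [apply (Hf x y Hxy)|apply (Hg x y Hxy)].
  - apply C1_Ck with (2 := C1_mult HU (Ck_C1 Hf) (Ck_C1 Hg)); auto;
    apply Ck_plus; auto; apply IH; try (now apply Ck_derivatives); now apply Ck_pred.
Qed.

Lemma Ck_scal (n : nat) (U : plane -> Prop) (c : R) (f : R -> R -> R) :
  open U -> Ck n U f -> Ck n U (fun x y => c * f x y).
Proof. intros HU Hf. apply Ck_mult; auto. now apply Ck_const. Qed.

Lemma Ck_comp (n : nat) (U V : plane -> Prop) (f g h : R -> R -> R) :
  open U -> open V -> (forall x y, V (x, y) -> U (g x y, h x y)) ->
  Ck n U f -> Ck n V g -> Ck n V h -> Ck n V (fun x y => f (g x y) (h x y)).
Proof.
  intros HU HV Hmap. revert f. induction n as [|n IH]; intros f Hf Hg Hh.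
  - intros x y Hxy. split; [|exact I]. apply continuity_2d_pt_comp.
    + apply Hf. now apply Hmap.
    + now apply Hg.
    + now apply Hh.
  - destruct (Ck_derivatives Hf) as [Hf1 Hf2].
    destruct (Ck_derivatives Hg) as [Hg1 Hg2].
    destruct (Ck_derivatives Hh) as [Hh1 Hh2].
    assert (Hg' := Ck_pred Hg). assert (Hh' := Ck_pred Hh).
    apply C1_Ck with (2 := C1_comp HU HV Hmap
      (Ck_C1 Hf) (Ck_C1 Hg) (Ck_C1 Hh)); auto;
    apply Ck_plus; auto; apply Ck_mult; auto.
Qed.

Lemma laplacian_eq (f : R -> R -> R) (x y : R) :
  laplacian f x y = Dx (Dx f) x y + Dy (Dy f) x y.
Proof. reflexivity. Qed.

Lemma Ck_laplacian (n : nat) (U : plane -> Prop) (f : R -> R -> R) :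
  open U -> Ck (S (S n)) U f -> Ck n U (laplacian f).
Proof.
  intros HU Hf. destruct (Ck_derivatives Hf) as [H1 H2].
  apply (Ck_plus n U (Dx (Dx f)) (Dy (Dy f))); auto; now apply Ck_derivatives.
Qed.

Lemma eq_on_laplacian (U : plane -> Prop) (f g : R -> R -> R) :
  open U -> eq_on U f g -> eq_on U (laplacian f) (laplacian g).
Proof.
  intros HU H x y Hxy. rewrite !laplacian_eq. f_equal.
  - apply (eq_on_Dx U); auto. now apply eq_on_Dx.
  - apply (eq_on_Dy U); auto. now apply eq_on_Dy.
Qed.

(** * Biharmonic functions are analytic along lines *)

(** Analyticity along lines is all that unique continuation needs, and by Cauchy's formula
    it reduces to power series of one real variable. *)
Definition line_analytic (U : plane -> Prop) (f : R -> R -> R) : Prop :=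
  forall x y a b, U (x, y) -> analytic_at (fun s => f (x + s * a) (y + s * b)) 0.

Lemma line_locally (U : plane -> Prop) (x y a b : R) :
  open U -> U (x, y) -> locally 0 (fun s => U (x + s * a, y + s * b)).
Proof.
  intros HU Hxy. apply locally_R_iff.
  destruct (open_pair U x y HU Hxy) as (d & Hd & Hb).
  assert (Ha := Rabs_pos a). assert (Hb' := Rabs_pos b).
  assert (Hpos : 0 < d / (Rabs a + Rabs b + 1)) by (apply Rdiv_lt_0_compat; lra).
  exists (d / (Rabs a + Rabs b + 1)). split; auto.
  intros s Hs. rewrite Rminus_0_r in Hs. assert (Hs0 := Rabs_pos s).
  assert (E : d / (Rabs a + Rabs b + 1) * (Rabs a + Rabs b + 1) = d) by (field; lra).
  apply Hb.
  - replace (x + s * a - x) with (s * a) by ring. rewrite Rabs_mult. nra.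
  - replace (y + s * b - y) with (s * b) by ring. rewrite Rabs_mult. nra.
Qed.

Lemma line_analytic_ext (U : plane -> Prop) (f g : R -> R -> R) :
  open U -> eq_on U f g -> line_analytic U f -> line_analytic U g.
Proof.
  intros HU H Hf x y a b Hxy.
  apply analytic_ext_loc with (2 := Hf x y a b Hxy).
  generalize (line_locally U x y a b HU Hxy). apply filter_imp. intros s. apply H.
Qed.

Lemma line_analytic_plus (U : plane -> Prop) (f g : R -> R -> R) :
  line_analytic U f -> line_analytic U g -> line_analytic U (fun x y => f x y + g x y).
Proof.
  intros Hf Hg x y a b Hxy. apply (analytic_plus (fun s => f (x + s * a) (y + s * b))).
  - now apply Hf.
  - now apply Hg.
Qed.
Arguments line_analytic_plus {U} {f} {g}.

Lemma line_analytic_minus (U : plane -> Prop) (f g : R -> R -> R) :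
  line_analytic U f -> line_analytic U g -> line_analytic U (fun x y => f x y - g x y).
Proof.
  intros Hf Hg x y a b Hxy. apply (analytic_minus (fun s => f (x + s * a) (y + s * b))).
  - now apply Hf.
  - now apply Hg.
Qed.
Arguments line_analytic_minus {U} {f} {g}.

Lemma line_analytic_mult (U : plane -> Prop) (f g : R -> R -> R) :
  line_analytic U f -> line_analytic U g -> line_analytic U (fun x y => f x y * g x y).
Proof.
  intros Hf Hg x y a b Hxy. apply (analytic_mult (fun s => f (x + s * a) (y + s * b))).
  - now apply Hf.
  - now apply Hg.
Qed.
Arguments line_analytic_mult {U} {f} {g}.

Lemma line_analytic_const (U : plane -> Prop) (c : R) : line_analytic U (fun _ _ => c).
Proof. intros x y a b _. apply analytic_const. Qed.

Lemma line_analytic_fst (U : plane -> Prop) : line_analytic U (fun x _ => x).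
Proof.
  intros x y a b _. apply (analytic_plus (fun _ => x)); [apply analytic_const|].
  apply analytic_mult; [apply analytic_id|apply analytic_const].
Qed.

Lemma line_analytic_snd (U : plane -> Prop) : line_analytic U (fun _ y => y).
Proof.
  intros x y a b _. apply (analytic_plus (fun _ => y)); [apply analytic_const|].
  apply analytic_mult; [apply analytic_id|apply analytic_const].
Qed.

Lemma line_analytic_C1 (U : plane -> Prop) (f p q : R -> R -> R) :
  open U -> C1 U f p q -> line_analytic U p -> line_analytic U q -> line_analytic U f.
Proof.
  intros HU H Hp Hq x y a b Hxy.
  apply analytic_primitive with
    (fun s => p (x + s * a) (y + s * b) * a + q (x + s * a) (y + s * b) * b).
  - generalize (line_locally U x y a b HU Hxy). apply filter_imp. intros s Hs.
    apply (C1_curve U f p q (fun s => x + s * a) (fun s => y + s * b)); auto;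
      auto_derive; auto; ring.
  - apply analytic_plus; (apply analytic_mult; [|apply analytic_const]).
    + now apply Hp.
    + now apply Hq.
Qed.

Lemma CR_line_analytic (U : plane -> Prop) (u v p q : R -> R -> R) :
  open U -> CR U u v p q -> line_analytic U u /\ line_analytic U v.
Proof.
  intros HU H. split; intros x y a b Hxy.
  - now apply CR_analytic_line with U v p q.
  - apply CR_times_minus_i in H. eapply CR_analytic_line; eauto.
Qed.
Arguments CR_line_analytic {U} {u} {v} {p} {q}.

(** Goursat's representation.  With [L] the Laplacian of [F], both [H = L_x - i L_y] and
    [w - conj z * H], where [w = 2 (F_xx - F_yy) - 4 i F_xy], are holomorphic.  The second
    derivatives of [F] are polynomials in their real and imaginary parts, in [L] and in the
    coordinates. *)
Lemma biharmonic_line_analytic (U : plane -> Prop) (F : R -> R -> R) :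
  open U -> biharmonic_on U F -> line_analytic U F.
Proof.
  intros HU HF.
  assert (H4 : Ck 4 U F) by (intros x y Hxy; now apply HF).
  set (L := laplacian F).
  assert (HL : Ck 2 U L) by now apply Ck_laplacian.
  destruct (Ck_derivatives H4) as [Hx Hy].
  destruct (Ck_derivatives Hx) as [HA HB].
  destruct (Ck_derivatives Hy) as [HB' HD].
  set (A := Dx (Dx F)). set (B := Dy (Dx F)). set (D := Dy (Dy F)).
  fold A in HA. fold B in HB. fold D in HD.
  assert (EB : eq_on U (Dx (Dy F)) B)
    by (apply Ck_Schwarz; auto; now do 2 apply Ck_pred).
  assert (C1x : C1 U (Dx F) A B) by exact (Ck_C1 Hx).
  assert (C1y : C1 U (Dy F) B D).
  { generalize (Ck_C1 Hy). apply C1_ext; auto; intros ? ? _; reflexivity. }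
  assert (C1A : C1 U A (Dx A) (Dy A)) by exact (Ck_C1 HA).
  assert (C1B : C1 U B (Dy A) (Dy B)).
  { generalize (Ck_C1 HB). apply C1_ext; auto; try (intros ? ? _; reflexivity).
    apply (Ck_Schwarz U (Dx F)); auto. now apply Ck_pred. }
  assert (C1D : C1 U D (Dy B) (Dy D)).
  { generalize (Ck_C1 HD). apply C1_ext; auto; try (intros ? ? _; reflexivity).
    intros x y Hxy. transitivity (Dy (Dx (Dy F)) x y).
    - exact (Ck_Schwarz U (Dy F) HU (Ck_pred Hy) x y Hxy).
    - now apply (eq_on_Dy U). }
  assert (C1L : C1 U L (Dx L) (Dy L)) by exact (Ck_C1 HL).
  assert (EL : eq_on U (Dx L) (fun x y => Dx A x y + Dy B x y) /\
               eq_on U (Dy L) (fun x y => Dy A x y + Dy D x y)).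
  { apply C1_eq_derivatives.
    generalize (C1_plus C1A C1D). apply C1_ext; auto;
    intros ? ? _; reflexivity. }
  destruct EL as [ELx ELy].
  destruct (Ck_derivatives HL) as [HLx HLy].
  set (Lxx := Dx (Dx L)). set (Lxy := Dy (Dx L)).
  assert (Eyy : eq_on U (Dy (Dy L)) (fun x y => - Lxx x y)).
  { intros x y Hxy. destruct (HF x y Hxy) as [_ E]. rewrite laplacian_eq in E.
    fold L Lxx in E. lra. }
  assert (C1Lx : C1 U (Dx L) Lxx Lxy) by exact (Ck_C1 HLx).
  assert (C1Ly : C1 U (Dy L) Lxy (fun x y => - Lxx x y)).
  { generalize (Ck_C1 HLy). apply C1_ext; auto; try (intros ? ? _; reflexivity).
    now apply Ck_Schwarz. }
  assert (CR1 : CR U (Dx L) (fun x y => -1 * Dy L x y) Lxx Lxy).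
  { split; auto. generalize (C1_scal (-1) HU C1Ly).
    apply C1_ext; auto; intros ? ? _; ring. }
  assert (CX := C1_fst U). assert (CY := C1_snd U).
  assert (CR2 : CR U
    (fun x y => 2 * (A x y + -1 * D x y) + (-1 * (x * Dx L x y) + y * Dy L x y))
    (fun x y => -4 * B x y + (x * Dy L x y + y * Dx L x y))
    (fun x y => 2 * (Dx A x y - Dy B x y) + (- Dx L x y - x * Lxx x y + y * Lxy x y))
    (fun x y => 2 * (Dy A x y - Dy D x y) + (- (x * Lxy x y) + Dy L x y - y * Lxx x y))).
  { split.
    - generalize (C1_plus
        (C1_scal 2 HU (C1_plus C1A (C1_scal (-1) HU C1D)))
        (C1_plus
          (C1_scal (-1) HU (C1_mult HU CX C1Lx))
          (C1_mult HU CY C1Ly))).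
      apply C1_ext; auto; intros x y Hxy; ring.
    - generalize (C1_plus (C1_scal (-4) HU C1B)
        (C1_plus (C1_mult HU CX C1Ly)
          (C1_mult HU CY C1Lx))).
      apply C1_ext; auto; intros x y Hxy.
      + ring.
      + assert (Ey := ELy x y Hxy). simpl in Ey. rewrite Ey. ring.
      + assert (Ex := ELx x y Hxy). simpl in Ex. rewrite Ex. ring. }
  destruct (CR_line_analytic HU CR1) as [ALx ALy'].
  destruct (CR_line_analytic HU CR2) as [Au Av].
  assert (AX := line_analytic_fst U). assert (AY := line_analytic_snd U).
  assert (ALy : line_analytic U (Dy L)).
  { generalize (line_analytic_mult (line_analytic_const U (-1)) ALy').
    apply line_analytic_ext; auto. intros x y _. ring. }
  assert (AL := line_analytic_C1 _ _ _ _ HU C1L ALx ALy).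
  assert (AxLx := line_analytic_mult AX ALx).
  assert (AyLy := line_analytic_mult AY ALy).
  assert (AxLy := line_analytic_mult AX ALy).
  assert (AyLx := line_analytic_mult AY ALx).
  assert (Adiff := line_analytic_minus (line_analytic_plus Au AxLx) AyLy).
  assert (AA : line_analytic U A).
  { generalize (line_analytic_mult (line_analytic_const U (1 / 4))
      (line_analytic_plus Adiff (line_analytic_plus AL AL))).
    apply line_analytic_ext; auto. intros x y Hxy. simpl.
    change (L x y) with (A x y + D x y). field. }
  assert (AD : line_analytic U D).
  { generalize (line_analytic_minus AL AA).
    apply line_analytic_ext; auto. intros x y Hxy. simpl.
    change (L x y) with (A x y + D x y). ring. }
  assert (AB : line_analytic U B).
  { generalize (line_analytic_mult (line_analytic_const U (-1 / 4))
      (line_analytic_minus (line_analytic_minus Av AxLy) AyLx)).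
    apply line_analytic_ext; auto. intros x y Hxy. simpl. field. }
  apply line_analytic_C1 with (Dx F) (Dy F); auto.
  - exact (Ck_C1 H4).
  - now apply line_analytic_C1 with A B.
  - now apply line_analytic_C1 with B D.
Qed.

(** * Unique continuation *)

Lemma analytic_on_line (U : plane -> Prop) (f : R -> R -> R) (x y a b s : R) :
  line_analytic U f -> U (x + s * a, y + s * b) ->
  analytic_at (fun t => f (x + t * a) (y + t * b)) s.
Proof.
  intros Hf HU. destruct (Hf _ _ a b HU) as (c & Hc & H).
  exists c; split; auto. revert H. apply filter_imp. intros h <-.
  rewrite Rplus_0_l. f_equal; ring.
Qed.

Lemma segment_in_square (x y d u v u' v' s : R) :
  Rabs (u - x) < d -> Rabs (v - y) < d -> Rabs (u' - x) < d -> Rabs (v' - y) < d ->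
  0 <= s <= 1 ->
  Rabs (u + s * (u' - u) - x) < d /\ Rabs (v + s * (v' - v) - y) < d.
Proof.
  intros H1 H2 H3 H4 Hs.
  apply Rabs_def2 in H1. apply Rabs_def2 in H2. apply Rabs_def2 in H3. apply Rabs_def2 in H4.
  assert (Hconv : forall a b, exists c, (a <= c <= b \/ b <= c <= a) /\ a + s * (b - a) = c).
  { intros a b. exists (a + s * (b - a)). split; auto.
    destruct (Rle_dec a b); [left|right]; nra. }
  destruct (Hconv u u') as (c & Hc & ->). destruct (Hconv v v') as (c' & Hc' & ->).
  split; apply Rabs_def1; lra.
Qed.

Lemma zero_along_segment (U : plane -> Prop) (f : R -> R -> R) (x y u v : R) :
  line_analytic U f ->
  (forall s, 0 <= s <= 1 -> U (x + s * (u - x), y + s * (v - y))) ->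
  locally (x, y) (fun p => f (fst p) (snd p) = 0) -> f u v = 0.
Proof.
  intros Hf HU Hz.
  replace (f u v) with (f (x + 1 * (u - x)) (y + 1 * (v - y))) by (f_equal; ring).
  apply (analytic_identity_from_germ (fun s => f (x + s * (u - x)) (y + s * (v - y))) 0 1 0);
    try lra.
  - intros s Hs. apply analytic_on_line with U; auto.
  - apply (line_locally (fun p => locally p (fun p => f (fst p) (snd p) = 0))) with (a := u - x)
      (b := v - y) in Hz as Hl.
    + revert Hl. apply filter_imp. intros s Hs. exact (locally_singleton _ _ Hs).
    + intros p Hp. now apply locally_locally.
Qed.

(** The set of points where the germ of [f] vanishes is closed: if such points accumulate at
    [p], one of them is joined by segments to all points of a square around [p], and [f] is
    analytic along these segments. *)
Lemma unique_continuation (U : plane -> Prop) (f : R -> R -> R) (x0 y0 : R) :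
  open U -> connected_set U -> line_analytic U f -> U (x0, y0) ->
  locally (x0, y0) (fun p => f (fst p) (snd p) = 0) ->
  forall x y, U (x, y) -> f x y = 0.
Proof.
  intros HU Hc Hf H0 Hz x y Hxy.
  set (Z := fun p : plane => locally p (fun p => f (fst p) (snd p) = 0)).
  destruct (classic (Z (x, y))) as [HZ|HN]; [exact (locally_singleton _ _ HZ)|].
  exfalso. destruct (Hc Z (fun p => U p /\ ~ Z p)) as ([u v] & _ & H1 & H2).
  - intros p Hp. now apply locally_locally.
  - intros [u v] [Hu Hnz]. apply locally_pair_iff.
    destruct (open_pair U u v HU Hu) as (d & Hd & Hb).
    exists d; split; auto. intros u' v' Hu' Hv'. split; auto. intros HZ'.
    apply Hnz. apply locally_pair_iff. exists d; split; auto. intros s t Hs Ht.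
    apply zero_along_segment with (U := U) (x := u') (y := v'); auto.
    intros l Hl. destruct (segment_in_square u v d u' v' s t l); auto.
  - intros p Hp. destruct (classic (Z p)); auto.
  - exists (x0, y0); auto.
  - exists (x, y); auto.
  - now apply H2.
Qed.

(** * Connected open sets *)

(** If no point of the path were in both sets, membership in [A] would propagate along the
    path by real induction. *)
Lemma path_connected (g : R -> plane) (A B : plane -> Prop) :
  (forall s, 0 <= s <= 1 -> continuous g s) -> open A -> open B ->
  (forall s, 0 <= s <= 1 -> A (g s) \/ B (g s)) -> A (g 0) -> B (g 1) ->
  exists s, 0 <= s <= 1 /\ A (g s) /\ B (g s).
Proof.
  intros Hg HA HB Hcov H0 H1. apply NNPP. intros N.
  assert (Hex : forall s, 0 <= s <= 1 -> A (g s) -> B (g s) -> False).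
  { intros s Hs Ha Hb. apply N. eauto. }
  apply (Hex 1); [lra| |auto]. revert H0.
  apply (interval_gluing (fun s t => A (g s) -> A (g t)) 0 1); try lra; auto.
  intros c Hc.
  assert (Hnear : forall O, open O -> O (g c) -> exists d, 0 < d /\
    forall s, Rabs (s - c) < d -> O (g s)).
  { intros O HO Hgc. apply locally_R_iff. apply (Hg c Hc). now apply HO. }
  destruct (Hcov c Hc) as [Ha|Hb].
  - destruct (Hnear A HA Ha) as (d & Hd & H). exists d; split; auto.
    intros s t _ _ _ Ht _. apply H. apply Rabs_def1; lra.
  - destruct (Hnear B HB Hb) as (d & Hd & H). exists d; split; auto.
    intros s t Hs0 _ Hs Ht Has. exfalso. apply (Hex s); auto; [lra|].
    apply H. apply Rabs_def1; lra.
Qed.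

Lemma continuous_to_plane (f g : R -> R) (s : R) :
  continuity_pt f s -> continuity_pt g s -> continuous (fun s => (f s, g s) : plane) s.
Proof.
  intros Hf Hg. apply continuity_pt_filterlim in Hf. apply continuity_pt_filterlim in Hg.
  intros P HP. apply locally_pair_iff in HP. destruct HP as (d & Hd & HP).
  assert (H1 : locally s (fun s' => Rabs (f s' - f s) < d)).
  { apply (Hf (fun z => Rabs (z - f s) < d)). apply locally_R_iff. eauto. }
  assert (H2 : locally s (fun s' => Rabs (g s' - g s) < d)).
  { apply (Hg (fun z => Rabs (z - g s) < d)). apply locally_R_iff. eauto. }
  unfold filtermap. generalize (filter_and _ _ H1 H2). apply filter_imp.
  intros t [Ht1 Ht2]. now apply HP.
Qed.

Lemma Rabs_self (x : R) : Rabs (x - x) = 0.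
Proof. unfold Rminus. now rewrite Rplus_opp_r, Rabs_R0. Qed.

Lemma point_eq_or_neq (p q : plane) : p = q \/ p <> q.
Proof. apply classic. Qed.

(** In a square, a point of [A] and a point of [B] are joined by a segment; if it
    passes through the centre, it is moved off it by shifting the first point inside
    [A]. *)
Lemma punctured_square_connected (x y d u v u' v' : R) (A B : plane -> Prop) :
  open A -> open B ->
  (forall s t, Rabs (s - x) < d -> Rabs (t - y) < d -> (s, t) <> (x, y) ->
     A (s, t) \/ B (s, t)) ->
  Rabs (u - x) < d -> Rabs (v - y) < d -> (u, v) <> (x, y) -> A (u, v) ->
  Rabs (u' - x) < d -> Rabs (v' - y) < d -> (u', v') <> (x, y) -> B (u', v') ->
  exists s t, Rabs (s - x) < d /\ Rabs (t - y) < d /\ (s, t) <> (x, y) /\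
    A (s, t) /\ B (s, t).
Proof.
  intros HA HB Hcov Hu Hv Hne Ha Hu' Hv' Hne' Hb.
  assert (Hw : 0 < (u' - x) ^ 2 + (v' - y) ^ 2).
  { destruct (Req_dec u' x) as [->|N].
    - assert (E : v' - y <> 0) by (intros E; apply Hne'; f_equal; lra).
      apply pow2_gt_0 in E. generalize (pow2_ge_0 (x - x)). lra.
    - assert (E : u' - x <> 0) by lra.
      apply pow2_gt_0 in E. generalize (pow2_ge_0 (v' - y)). lra. }
  assert (Hmove : exists u1 v1, Rabs (u1 - x) < d /\ Rabs (v1 - y) < d /\ A (u1, v1) /\
    (u1 - x) * (v' - y) - (v1 - y) * (u' - x) <> 0).
  { destruct (Req_dec ((u - x) * (v' - y) - (v - y) * (u' - x)) 0) as [E|N]; [|eauto 10].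
    assert (Hloc := line_locally A u v (v' - y) (- (u' - x)) HA Ha).
    assert (Hloc2 : locally 0 (fun s =>
      Rabs (u + s * (v' - y) - x) < d /\ Rabs (v + s * - (u' - x) - y) < d)).
    { apply (line_locally (fun p => Rabs (fst p - x) < d /\ Rabs (snd p - y) < d)); auto.
      intros [p q] [Hp Hq]; simpl in *. apply locally_pair_iff.
      exists (Rmin (d - Rabs (p - x)) (d - Rabs (q - y))). split; [apply Rmin_pos; lra|].
      assert (H1 := Rmin_l (d - Rabs (p - x)) (d - Rabs (q - y))).
      assert (H2 := Rmin_r (d - Rabs (p - x)) (d - Rabs (q - y))).
      intros s t Hs Ht; simpl. split.
      - replace (s - x) with ((s - p) + (p - x)) by ring.
        eapply Rle_lt_trans; [apply Rabs_triang|lra].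
      - replace (t - y) with ((t - q) + (q - y)) by ring.
        eapply Rle_lt_trans; [apply Rabs_triang|lra]. }
    generalize (filter_and _ _ Hloc Hloc2). rewrite locally_R_iff.
    intros (e & He & H). destruct (H (e / 2)) as (H1 & H2 & H3).
    { rewrite Rminus_0_r, Rabs_pos_eq; lra. }
    exists (u + e / 2 * (v' - y)), (v + e / 2 * - (u' - x)).
    split; [auto|split; [auto|split; [auto|]]].
    replace (_ - _) with (((u - x) * (v' - y) - (v - y) * (u' - x)) +
      e / 2 * ((u' - x) ^ 2 + (v' - y) ^ 2)) by ring.
    rewrite E. nra. }
  destruct Hmove as (u1 & v1 & Hu1 & Hv1 & Ha1 & Hx).
  assert (Hseg : forall s, 0 <= s <= 1 ->
    Rabs (u1 + s * (u' - u1) - x) < d /\ Rabs (v1 + s * (v' - v1) - y) < d /\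
    (u1 + s * (u' - u1), v1 + s * (v' - v1)) <> (x, y)).
  { intros s Hs. destruct (segment_in_square x y d u1 v1 u' v' s); auto.
    split; [auto|split; [auto|]]. intros E. injection E as E1 E2.
    destruct (Req_dec s 1) as [->|Ns].
    - apply Hne'. f_equal; lra.
    - apply Hx. apply Rmult_eq_reg_l with (1 - s); [|lra].
      rewrite Rmult_0_r. rewrite <- E1, <- E2. ring. }
  destruct (path_connected (fun s => (u1 + s * (u' - u1), v1 + s * (v' - v1))) A B)
    as (s & Hs & H1 & H2); auto.
  - intros s _. apply continuous_to_plane; apply continuity_smooth; auto_derive; auto.
  - intros s Hs. destruct (Hseg s Hs) as (H1 & H2 & H3). auto.
  - now rewrite !Rmult_0_l, !Rplus_0_r.
  - replace (u1 + 1 * (u' - u1)) with u' by ring.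
    now replace (v1 + 1 * (v' - v1)) with v' by ring.
  - destruct (Hseg s Hs) as (H3 & H4 & H5). eauto 10.
Qed.

Lemma open_minus_point (U : plane -> Prop) (p0 : plane) :
  open U -> open (fun p => U p /\ p <> p0).
Proof.
  intros HU [x y] [Hxy Hne]. destruct p0 as [x0 y0].
  destruct (open_pair U x y HU Hxy) as (d & Hd & Hb).
  assert (Hpos : 0 < Rabs (x - x0) + Rabs (y - y0)).
  { assert (H1 := Rabs_pos (x - x0)). assert (H2 := Rabs_pos (y - y0)).
    destruct (Req_dec x x0) as [->|N].
    - assert (E : y - y0 <> 0) by (intros E; apply Hne; f_equal; lra).
      apply Rabs_pos_lt in E. lra.
    - assert (E : x - x0 <> 0) by lra. apply Rabs_pos_lt in E. lra. }
  apply locally_pair_iff.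
  exists (Rmin d ((Rabs (x - x0) + Rabs (y - y0)) / 2)). split; [apply Rmin_pos; lra|].
  assert (H1 := Rmin_l d ((Rabs (x - x0) + Rabs (y - y0)) / 2)).
  assert (H2 := Rmin_r d ((Rabs (x - x0) + Rabs (y - y0)) / 2)).
  intros u v Hu Hv. split; [apply Hb; lra|]. intros E. injection E as -> ->.
  rewrite (Rabs_minus_sym x0) in Hu. rewrite (Rabs_minus_sym y0) in Hv. lra.
Qed.

(** If two open sets separated the rest of [U], the punctured square around the point would
    lie in one of them, and adding the point to that one would separate [U]. *)
Lemma region_minus_point (U : plane -> Prop) (p0 : plane) :
  region U -> region (fun p => U p /\ p <> p0).
Proof.
  intros (HU & Hc & Hne). split; [now apply open_minus_point|].
  destruct (classic (U p0)) as [H0|H0].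
  2:{ assert (E : forall p, U p -> p <> p0) by (intros p Hp ->; contradiction).
      split.
      - intros A B HA HB Hcov (a & [Ha _] & Haa) (b & [Hb _] & Hbb).
        destruct (Hc A B) as (p & Hp & H); eauto 6.
      - destruct Hne as [p Hp]. eauto. }
  destruct p0 as [x y]. destruct (open_pair U x y HU H0) as (d & Hd & Hb).
  assert (Hnear : forall e, 0 < e -> exists u v, Rabs (u - x) < e /\ Rabs (v - y) < e /\
    (u, v) <> (x, y)).
  { intros e He. exists (x + e / 2), y. rewrite Rabs_self. split; [|split; [auto|]].
    - replace (x + e / 2 - x) with (e / 2) by ring. rewrite Rabs_pos_eq; lra.
    - intros E. injection E as E. lra. }
  split.
  2:{ destruct (Hnear d Hd) as (u & v & Hu & Hv & Hn). exists (u, v). auto. }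
  assert (Hhalf : forall A B : plane -> Prop, open A -> open B ->
    (forall p, U p /\ p <> (x, y) -> A p \/ B p) ->
    (exists u v, Rabs (u - x) < d /\ Rabs (v - y) < d /\ (u, v) <> (x, y) /\ A (u, v)) ->
    (exists p, (U p /\ p <> (x, y)) /\ A p) -> (exists p, (U p /\ p <> (x, y)) /\ B p) ->
    exists p, (U p /\ p <> (x, y)) /\ A p /\ B p).
  { intros A B HA HB Hcov (u & v & Hu & Hv & Hn & Ha) (a & _ & _) (b & [HUb Hnb] & HBb).
    destruct (classic (exists u v, Rabs (u - x) < d /\ Rabs (v - y) < d /\
      (u, v) <> (x, y) /\ B (u, v))) as [(u' & v' & Hu' & Hv' & Hn' & Hb')|N].
    - destruct (punctured_square_connected x y d u v u' v' A B)
        as (s & t & Hs & Ht & H1 & H2 & H3); auto. exists (s, t). auto.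
    - destruct (Hc (fun p => A p \/ (Rabs (fst p - x) < d /\ Rabs (snd p - y) < d)) B)
        as (q & Hq & Haq & Hbq); auto.
      + intros [p1 p2] [Hp|[Hp1 Hp2]]; simpl in *.
        * generalize (HA _ Hp). apply filter_imp. auto.
        * apply locally_pair_iff.
          exists (Rmin (d - Rabs (p1 - x)) (d - Rabs (p2 - y))). split; [apply Rmin_pos; lra|].
          assert (H1 := Rmin_l (d - Rabs (p1 - x)) (d - Rabs (p2 - y))).
          assert (H2 := Rmin_r (d - Rabs (p1 - x)) (d - Rabs (p2 - y))).
          intros s t Hs Ht; right; simpl. split.
          -- replace (s - x) with ((s - p1) + (p1 - x)) by ring.
             eapply Rle_lt_trans; [apply Rabs_triang|lra].
          -- replace (t - y) with ((t - p2) + (p2 - y)) by ring.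
             eapply Rle_lt_trans; [apply Rabs_triang|lra].
      + intros p Hp. destruct (point_eq_or_neq p (x, y)) as [->|Hpn].
        * left; right; simpl. now rewrite !Rabs_self.
        * destruct (Hcov p); auto.
      + exists (u, v). auto.
      + exists b. auto.
      + destruct (point_eq_or_neq q (x, y)) as [->|Hqn].
        * exfalso. destruct (open_pair B x y HB Hbq) as (e & He & HeB).
          destruct (Hnear (Rmin d e)) as (s & t & Hs & Ht & Hst); [now apply Rmin_pos|].
          assert (H1 := Rmin_l d e). assert (H2 := Rmin_r d e).
          apply N. exists s, t. split; [lra|split; [lra|split; [auto|]]]. apply HeB; lra.
        * destruct Haq as [Haq|[Hq1 Hq2]]; [exists q; auto|].
          exfalso. apply N. destruct q as [q1 q2]. exists q1, q2. auto. }
  intros A B HA HB Hcov HexA HexB.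
  destruct (Hnear d Hd) as (u & v & Hu & Hv & Hn).
  destruct (Hcov (u, v)) as [H|H]; auto.
  - apply Hhalf; eauto 10.
  - destruct (Hhalf B A) as (p & Hp & H1 & H2); eauto 10.
    intros p Hp. destruct (Hcov p Hp); auto.
Qed.

Lemma connected_image (U V : plane -> Prop) (T : plane -> plane) :
  open U -> connected_set U -> (forall p, U p -> continuous T p) ->
  (forall q, V q <-> exists p, U p /\ T p = q) -> connected_set V.
Proof.
  intros HU Hc HT HV A B HA HB Hcov (a & Ha & Haa) (b & Hb & Hbb).
  assert (Hpre : forall O, open O -> open (fun p => U p /\ O (T p))).
  { intros O HO p [Hp HOp]. apply filter_and; [now apply HU|].
    apply (HT p Hp). now apply HO. }
  apply HV in Ha. destruct Ha as (a' & Ha' & <-). apply HV in Hb. destruct Hb as (b' & Hb' & <-).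
  destruct (Hc (fun p => U p /\ A (T p)) (fun p => U p /\ B (T p)))
    as (p & Hp & [_ H1] & [_ H2]); eauto.
  - intros p Hp. destruct (Hcov (T p)); auto. apply HV. eauto.
  - exists (T p). split; auto. apply HV. eauto.
Qed.

(** * Inversion of biharmonic functions *)

Lemma laplacian_C1 (U : plane -> Prop) (f p q p1 p2 q1 q2 : R -> R -> R) :
  open U -> C1 U f p q -> C1 U p p1 p2 -> C1 U q q1 q2 ->
  eq_on U (laplacian f) (fun x y => p1 x y + q2 x y).
Proof.
  intros HU Hf Hp Hq x y Hxy. rewrite laplacian_eq.
  destruct (C1_eq_derivatives Hf) as [E1 E2].
  rewrite (eq_on_Dx U _ _ HU E1 x y Hxy), (eq_on_Dy U _ _ HU E2 x y Hxy).
  f_equal.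
  - now apply (C1_eq_derivatives Hp).
  - now apply (C1_eq_derivatives Hq).
Qed.
Arguments laplacian_C1 {U} {f} {p} {q} {p1} {p2} {q1} {q2}.

Lemma Ck2_C1 (U : plane -> Prop) (f : R -> R -> R) :
  Ck 2 U f -> C1 U f (Dx f) (Dy f) /\ C1 U (Dx f) (Dx (Dx f)) (Dy (Dx f)) /\
    C1 U (Dy f) (Dx (Dy f)) (Dy (Dy f)).
Proof.
  intros H. destruct (Ck_derivatives H) as [H1 H2].
  split; [exact (Ck_C1 H)|]. split; [exact (Ck_C1 H1)|exact (Ck_C1 H2)].
Qed.
Arguments Ck2_C1 {U} {f}.

Lemma laplacian_plus (U : plane -> Prop) (f g : R -> R -> R) :
  open U -> Ck 2 U f -> Ck 2 U g ->
  eq_on U (laplacian (fun x y => f x y + g x y)) (fun x y => laplacian f x y + laplacian g x y).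
Proof.
  intros HU Hf Hg x y Hxy.
  destruct (Ck2_C1 Hf) as (F0 & F1 & F2). destruct (Ck2_C1 Hg) as (G0 & G1 & G2).
  rewrite (laplacian_C1 HU (C1_plus F0 G0)
    (C1_plus F1 G1) (C1_plus F2 G2) x y Hxy).
  rewrite !laplacian_eq. ring.
Qed.

Lemma laplacian_mult (U : plane -> Prop) (f g : R -> R -> R) :
  open U -> Ck 2 U f -> Ck 2 U g ->
  eq_on U (laplacian (fun x y => f x y * g x y)) (fun x y =>
    laplacian f x y * g x y + f x y * laplacian g x y +
    2 * (Dx f x y * Dx g x y + Dy f x y * Dy g x y)).
Proof.
  intros HU Hf Hg x y Hxy.
  destruct (Ck2_C1 Hf) as (F0 & F1 & F2). destruct (Ck2_C1 Hg) as (G0 & G1 & G2).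
  rewrite (laplacian_C1 HU (C1_mult HU F0 G0)
    (C1_plus (C1_mult HU F1 G0) (C1_mult HU F0 G1))
    (C1_plus (C1_mult HU F2 G0) (C1_mult HU F0 G2))
    x y Hxy).
  rewrite !laplacian_eq. ring.
Qed.

Lemma laplacian_scal (U : plane -> Prop) (c : R) (f : R -> R -> R) :
  open U -> Ck 2 U f ->
  eq_on U (laplacian (fun x y => c * f x y)) (fun x y => c * laplacian f x y).
Proof.
  intros HU Hf x y Hxy. destruct (Ck2_C1 Hf) as (F0 & F1 & F2).
  rewrite (laplacian_C1 HU (C1_scal c HU F0)
    (C1_scal c HU F1) (C1_scal c HU F2) x y Hxy).
  rewrite !laplacian_eq. ring.
Qed.

(** For such a map, conformal or anticonformal, the mixed derivative and the gradient of [f]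
    cancel in the chain rule. *)
Lemma laplacian_conformal (U V : plane -> Prop) (f g h gx gy hx hy gxx gxy gyx gyy
    hxx hxy hyx hyy m : R -> R -> R) :
  open U -> open V -> (forall x y, V (x, y) -> U (g x y, h x y)) -> Ck 2 U f ->
  C1 V g gx gy -> C1 V gx gxx gxy -> C1 V gy gyx gyy ->
  C1 V h hx hy -> C1 V hx hxx hxy -> C1 V hy hyx hyy ->
  (forall x y, V (x, y) -> gxx x y + gyy x y = 0 /\ hxx x y + hyy x y = 0 /\
    gx x y * hx x y + gy x y * hy x y = 0 /\
    gx x y ^ 2 + gy x y ^ 2 = m x y /\ hx x y ^ 2 + hy x y ^ 2 = m x y) ->
  eq_on V (laplacian (fun x y => f (g x y) (h x y)))
    (fun x y => m x y * laplacian f (g x y) (h x y)).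
Proof.
  intros HU HV Hmap Hf Hg Hgx Hgy Hh Hhx Hhy Hm x y Hxy.
  destruct (Ck2_C1 Hf) as (F0 & F1 & F2).
  assert (K1 := C1_comp HU HV Hmap F1 Hg Hh).
  assert (K2 := C1_comp HU HV Hmap F2 Hg Hh).
  rewrite (laplacian_C1 HV (C1_comp HU HV Hmap F0 Hg Hh)
    (C1_plus (C1_mult HV K1 Hgx) (C1_mult HV K2 Hhx))
    (C1_plus (C1_mult HV K1 Hgy) (C1_mult HV K2 Hhy))
    x y Hxy).
  destruct (Hm x y Hxy) as (E1 & E2 & E3 & E4 & E5).
  rewrite laplacian_eq, (Ck_Schwarz U f HU Hf (g x y) (h x y) (Hmap x y Hxy)).
  set (A := Dx (Dx f) (g x y) (h x y)). set (B := Dy (Dx f) (g x y) (h x y)).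
  set (D := Dy (Dy f) (g x y) (h x y)). set (P := Dx f (g x y) (h x y)).
  set (Q := Dy f (g x y) (h x y)).
  transitivity (A * (gx x y ^ 2 + gy x y ^ 2) + D * (hx x y ^ 2 + hy x y ^ 2) +
    2 * B * (gx x y * hx x y + gy x y * hy x y) + P * (gxx x y + gyy x y) +
    Q * (hxx x y + hyy x y)); [ring|].
  rewrite E1, E2, E3, E4, E5. ring.
Qed.

Lemma biharmonic_translation (U : plane -> Prop) (F : R -> R -> R) (v1 v2 : R) :
  open U -> biharmonic_on U F ->
  biharmonic_on (fun p => U (fst p + v1, snd p + v2)) (fun x y => F (x + v1) (y + v2)).
Proof.
  intros HU HF. set (V := fun p : plane => U (fst p + v1, snd p + v2)).
  assert (HV : open V).
  { intros [x y] Hxy. destruct (open_pair U _ _ HU Hxy) as (d & Hd & Hb).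
    apply locally_pair_iff. exists d; split; auto. intros s t Hs Ht. apply Hb; simpl.
    - now replace (s + v1 - (x + v1)) with (s - x) by ring.
    - now replace (t + v2 - (y + v2)) with (t - y) by ring. }
  assert (Hmap : forall x y, V (x, y) -> U (x + v1, y + v2)) by (intros x y Hxy; exact Hxy).
  assert (H4 : Ck 4 U F) by (intros x y Hxy; now apply HF).
  assert (H2 : Ck 2 U F) by now do 2 apply Ck_pred.
  assert (Kx := C1_plus (C1_fst V) (C1_const V v1)).
  assert (Ky := C1_plus (C1_snd V) (C1_const V v2)).
  assert (K1 : C1 V (fun _ _ => 1 + 0) (fun _ _ => 0) (fun _ _ => 0)) by apply C1_const.
  assert (K0 : C1 V (fun _ _ => 0 + 0) (fun _ _ => 0) (fun _ _ => 0)) by apply C1_const.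
  assert (Hlap : forall f, Ck 2 U f -> eq_on V (laplacian (fun x y => f (x + v1) (y + v2)))
    (fun x y => 1 * laplacian f (x + v1) (y + v2))).
  { intros f Hf. apply (laplacian_conformal U V f _ _ _ _ _ _ _ _ _ _ _ _ _ _ (fun _ _ => 1)
      HU HV Hmap Hf Kx K1 K0 Ky K0 K1).
    intros x y _. repeat split; ring. }
  intros x y Hxy. split.
  - apply (Ck_comp 4 U V F (fun x _ => x + v1) (fun _ y => y + v2)); auto.
    + apply Ck_plus; auto; [now apply Ck_fst|now apply Ck_const].
    + apply Ck_plus; auto; [now apply Ck_snd|now apply Ck_const].
  - rewrite (eq_on_laplacian V _ _ HV (Hlap F H2) x y Hxy).
    rewrite (eq_on_laplacian V _ (fun x y => laplacian F (x + v1) (y + v2)) HV); auto.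
    2:{ intros s t _. ring. }
    rewrite (Hlap (laplacian F)); auto; [|now apply Ck_laplacian].
    destruct (HF _ _ (Hmap x y Hxy)) as [_ ->]. ring.
Qed.

Definition invx (x y : R) : R := x / (x ^ 2 + y ^ 2).
Definition invy (x y : R) : R := y / (x ^ 2 + y ^ 2).

Lemma sqnorm_pos (x y : R) : (x, y) <> (0, 0) -> 0 < x ^ 2 + y ^ 2.
Proof.
  intros H. destruct (Req_dec x 0) as [->|N]; [destruct (Req_dec y 0) as [->|N]|]; try easy.
  - apply pow2_gt_0 in N. generalize (pow2_ge_0 0). lra.
  - apply pow2_gt_0 in N. generalize (pow2_ge_0 y). lra.
Qed.

Lemma C1_sqnorm_inv (V : plane -> Prop) : open V ->
  (forall x y, V (x, y) -> (x, y) <> (0, 0)) ->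
  C1 V (fun x y => / (x ^ 2 + y ^ 2))
    (fun x y => -2 * x * (/ (x ^ 2 + y ^ 2) * / (x ^ 2 + y ^ 2)))
    (fun x y => -2 * y * (/ (x ^ 2 + y ^ 2) * / (x ^ 2 + y ^ 2))).
Proof.
  intros HV H0 x y Hxy. assert (Hq := sqnorm_pos x y (H0 x y Hxy)).
  assert (Hi : continuity_2d_pt (fun x y => / (x ^ 2 + y ^ 2)) x y).
  { apply continuity_2d_pt_inv; [|lra]. apply continuity_2d_pt_plus.
    - apply (continuity_2d_pt_fst (fun x => x ^ 2)). auto_derive; auto.
    - apply (continuity_2d_pt_snd (fun y => y ^ 2)). auto_derive; auto. }
  split; [|split; [|split]].
  - auto_derive; [lra|]. field. lra.
  - auto_derive; [lra|]. field. lra.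
  - apply continuity_2d_pt_mult; [|now apply continuity_2d_pt_mult].
    apply (continuity_2d_pt_fst (fun x => -2 * x)). auto_derive; auto.
  - apply continuity_2d_pt_mult; [|now apply continuity_2d_pt_mult].
    apply (continuity_2d_pt_snd (fun y => -2 * y)). auto_derive; auto.
Qed.

Lemma Ck_sqnorm_inv (n : nat) (V : plane -> Prop) : open V ->
  (forall x y, V (x, y) -> (x, y) <> (0, 0)) -> Ck n V (fun x y => / (x ^ 2 + y ^ 2)).
Proof.
  intros HV H0. assert (HC := C1_sqnorm_inv V HV H0).
  induction n as [|n IH].
  - intros x y Hxy. split; [|exact I]. now apply (C1_continuous V _ _ _ x y HV HC).
  - apply C1_Ck with (2 := HC); auto; apply Ck_mult; auto;
      (apply Ck_mult; auto; [now apply Ck_const|now apply Ck_fst || now apply Ck_snd])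
      || now apply Ck_mult.
Qed.

Lemma Ck_sqnorm (n : nat) (V : plane -> Prop) : open V -> Ck n V (fun x y => x ^ 2 + y ^ 2).
Proof.
  intros HV. apply Ck_ext with (fun x y => x * x + y * y); auto.
  - intros x y _. ring.
  - apply Ck_plus; auto; apply Ck_mult; auto; now apply Ck_fst || now apply Ck_snd.
Qed.

Lemma Ck_inversion (n : nat) (V : plane -> Prop) : open V ->
  (forall x y, V (x, y) -> (x, y) <> (0, 0)) -> Ck n V invx /\ Ck n V invy.
Proof.
  intros HV H0. split; apply Ck_mult; auto; try (now apply Ck_fst || now apply Ck_snd);
    now apply Ck_sqnorm_inv.
Qed.

Lemma laplacian_inversion (U V : plane -> Prop) (f : R -> R -> R) :
  open U -> open V -> (forall x y, V (x, y) -> (x, y) <> (0, 0)) ->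
  (forall x y, V (x, y) -> U (invx x y, invy x y)) -> Ck 2 U f ->
  eq_on V (laplacian (fun x y => f (invx x y) (invy x y)))
    (fun x y => / (x ^ 2 + y ^ 2) ^ 2 * laplacian f (invx x y) (invy x y)).
Proof.
  intros HU HV H0 Hmap Hf.
  destruct (Ck_inversion 2 V HV H0) as [Hx Hy].
  destruct (Ck2_C1 Hx) as (X0 & X1 & X2). destruct (Ck2_C1 Hy) as (Y0 & Y1 & Y2).
  apply (laplacian_conformal U V f _ _ _ _ _ _ _ _ _ _ _ _ _ _ _ HU HV Hmap Hf X0 X1 X2 Y0 Y1 Y2).
  assert (Q := fun x y H => sqnorm_pos x y (H0 x y H)).
  assert (E1 : eq_on V (Dx invx) (fun x y => (y ^ 2 - x ^ 2) / (x ^ 2 + y ^ 2) ^ 2)).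
  { intros x y Hxy. specialize (Q x y Hxy). apply is_derive_unique. unfold invx.
    auto_derive; [lra|]. field. lra. }
  assert (E2 : eq_on V (Dy invx) (fun x y => -2 * x * y / (x ^ 2 + y ^ 2) ^ 2)).
  { intros x y Hxy. specialize (Q x y Hxy). apply is_derive_unique. unfold invx.
    auto_derive; [lra|]. field. lra. }
  assert (E3 : eq_on V (Dx invy) (fun x y => -2 * x * y / (x ^ 2 + y ^ 2) ^ 2)).
  { intros x y Hxy. specialize (Q x y Hxy). apply is_derive_unique. unfold invy.
    auto_derive; [lra|]. field. lra. }
  assert (E4 : eq_on V (Dy invy) (fun x y => (x ^ 2 - y ^ 2) / (x ^ 2 + y ^ 2) ^ 2)).
  { intros x y Hxy. specialize (Q x y Hxy). apply is_derive_unique. unfold invy.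
    auto_derive; [lra|]. field. lra. }
  intros x y Hxy. specialize (Q x y Hxy).
  rewrite (eq_on_Dx V _ _ HV E1 x y Hxy), (eq_on_Dy V _ _ HV E2 x y Hxy),
    (eq_on_Dx V _ _ HV E3 x y Hxy), (eq_on_Dy V _ _ HV E4 x y Hxy),
    (E1 x y Hxy), (E2 x y Hxy), (E3 x y Hxy), (E4 x y Hxy).
  assert (Hp : forall k, (x ^ 2 + y ^ 2) ^ k <> 0) by (intros k; apply pow_nonzero; lra).
  split; [|split; [|split; [|split]]].
  - unfold Dx, Dy.
    erewrite (is_derive_unique (fun s => (y ^ 2 - s ^ 2) / (s ^ 2 + y ^ 2) ^ 2)).
    2:{ auto_derive; [apply (Hp 2%nat)|reflexivity]. }
    erewrite (is_derive_unique (fun s => -2 * x * s / (x ^ 2 + s ^ 2) ^ 2)).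
    2:{ auto_derive; [apply (Hp 2%nat)|reflexivity]. }
    field. lra.
  - unfold Dx, Dy.
    erewrite (is_derive_unique (fun s => -2 * s * y / (s ^ 2 + y ^ 2) ^ 2)).
    2:{ auto_derive; [apply (Hp 2%nat)|reflexivity]. }
    erewrite (is_derive_unique (fun s => (x ^ 2 - s ^ 2) / (x ^ 2 + s ^ 2) ^ 2)).
    2:{ auto_derive; [apply (Hp 2%nat)|reflexivity]. }
    field. lra.
  - field. lra.
  - field. lra.
  - field. lra.
Qed.

Lemma laplacian_Dx (U : plane -> Prop) (f : R -> R -> R) : open U -> Ck 3 U f ->
  eq_on U (laplacian (Dx f)) (Dx (laplacian f)) /\
  eq_on U (laplacian (Dy f)) (Dy (laplacian f)).
Proof.
  intros HU Hf. destruct (Ck_derivatives Hf) as [Hx Hy].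
  assert (Hf2 := Ck_pred Hf).
  destruct (Ck2_C1 Hx) as (_ & X1 & X2). destruct (Ck2_C1 Hy) as (_ & Y1 & Y2).
  destruct (C1_eq_derivatives (C1_plus X1 Y2)) as [E1 E2].
  assert (S := Ck_Schwarz U f HU Hf2).
  split; intros x y Hxy; rewrite laplacian_eq.
  - transitivity (Dx (Dx (Dx f)) x y + Dx (Dy (Dy f)) x y); [|symmetry; now apply E1].
    f_equal. rewrite (Ck_Schwarz U (Dy f) HU Hy x y Hxy).
    apply (eq_on_Dy U); auto. intros s t Hst. symmetry.
    exact (eq_on_Dy U _ _ HU S s t Hst) || exact (S s t Hst).
  - transitivity (Dy (Dx (Dx f)) x y + Dy (Dy (Dy f)) x y); [|symmetry; now apply E2].
    f_equal. rewrite <- (Ck_Schwarz U (Dx f) HU Hx x y Hxy).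
    apply (eq_on_Dx U); auto.
Qed.

Lemma laplacian_sqnorm_mult (U : plane -> Prop) (f : R -> R -> R) : open U -> Ck 2 U f ->
  eq_on U (laplacian (fun x y => (x ^ 2 + y ^ 2) * f x y)) (fun x y =>
    4 * f x y + 4 * (x * Dx f x y + y * Dy f x y) + (x ^ 2 + y ^ 2) * laplacian f x y).
Proof.
  intros HU Hf x y Hxy.
  rewrite (laplacian_mult U (fun x y => x ^ 2 + y ^ 2) f HU (Ck_sqnorm 2 U HU) Hf x y Hxy).
  assert (D1 : eq_on U (Dx (fun x y => x ^ 2 + y ^ 2)) (fun x _ => 2 * x)).
  { intros s t _. apply is_derive_unique. auto_derive; auto. ring. }
  assert (D2 : eq_on U (Dy (fun x y => x ^ 2 + y ^ 2)) (fun _ y => 2 * y)).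
  { intros s t _. apply is_derive_unique. auto_derive; auto. ring. }
  rewrite (D1 x y Hxy), (D2 x y Hxy), (laplacian_eq (fun x y => x ^ 2 + y ^ 2)).
  rewrite (eq_on_Dx U _ _ HU D1 x y Hxy), (eq_on_Dy U _ _ HU D2 x y Hxy).
  assert (D3 : Dx (fun x _ => 2 * x) x y = 2).
  { apply is_derive_unique. auto_derive; auto. ring. }
  assert (D4 : Dy (fun _ y => 2 * y) x y = 2).
  { apply is_derive_unique. auto_derive; auto. ring. }
  rewrite D3, D4. ring.
Qed.

Definition euler (f : R -> R -> R) (x y : R) : R := x * Dx f x y + y * Dy f x y.

Lemma laplacian_euler (U : plane -> Prop) (f : R -> R -> R) : open U -> Ck 3 U f ->
  eq_on U (laplacian (euler f)) (fun x y => 2 * laplacian f x y + euler (laplacian f) x y).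
Proof.
  intros HU Hf x y Hxy. destruct (Ck_derivatives Hf) as [Hx Hy].
  destruct (laplacian_Dx U f HU Hf) as [E1 E2].
  unfold euler.
  rewrite (laplacian_plus U (fun x y => x * Dx f x y) (fun x y => y * Dy f x y)); auto;
    try (apply Ck_mult; auto; now apply Ck_fst || now apply Ck_snd).
  rewrite (laplacian_mult U (fun x _ => x) (Dx f) HU (Ck_fst 2 U HU) Hx x y Hxy).
  rewrite (laplacian_mult U (fun _ y => y) (Dy f) HU (Ck_snd 2 U HU) Hy x y Hxy).
  rewrite (E1 x y Hxy), (E2 x y Hxy).
  rewrite (laplacian_C1 HU (C1_fst U) (C1_const U 1) (C1_const U 0) x y Hxy).
  rewrite (laplacian_C1 HU (C1_snd U) (C1_const U 0) (C1_const U 1) x y Hxy).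
  destruct (C1_eq_derivatives (C1_fst U)) as [F1 F2].
  destruct (C1_eq_derivatives (C1_snd U)) as [F3 F4].
  rewrite (F1 x y Hxy), (F2 x y Hxy), (F3 x y Hxy), (F4 x y Hxy).
  rewrite (laplacian_eq f). ring.
Qed.

(** The Laplacian of [|p|^2 F(p / |p|^2)] is [H (p / |p|^2)] with
    [H = 4 F - 4 (x F_x + y F_y) + |p|^2 Lap F], and [Lap H = |p|^2 Lap (Lap F) = 0]. *)
Lemma biharmonic_inversion (U V : plane -> Prop) (F : R -> R -> R) :
  open U -> open V -> (forall x y, V (x, y) -> (x, y) <> (0, 0)) ->
  (forall x y, V (x, y) -> U (invx x y, invy x y)) ->
  biharmonic_on U F ->
  biharmonic_on V (fun x y => (x ^ 2 + y ^ 2) * F (invx x y) (invy x y)).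
Proof.
  intros HU HV H0 Hmap HF.
  assert (H4 : Ck 4 U F) by (intros x y Hxy; now apply HF).
  assert (H3 := Ck_pred H4). assert (H2 := Ck_pred H3).
  set (L := laplacian F). assert (HL : Ck 2 U L) by now apply Ck_laplacian.
  destruct (Ck_inversion 4 V HV H0) as [Hix Hiy].
  set (u := fun x y => F (invx x y) (invy x y)).
  assert (Hu : Ck 4 V u) by now apply (Ck_comp 4 U V F invx invy).
  destruct (Ck_derivatives H3) as [Hx Hy].
  assert (He : Ck 2 U (euler F)).
  { apply Ck_plus; auto; apply Ck_mult; auto; now apply Ck_fst || now apply Ck_snd. }
  set (H := fun x y => (4 * F x y + -4 * euler F x y) + (x ^ 2 + y ^ 2) * L x y).
  assert (HqL : Ck 2 U (fun x y => (x ^ 2 + y ^ 2) * L x y)).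
  { apply Ck_mult; auto. now apply Ck_sqnorm. }
  assert (H4F : Ck 2 U (fun x y => 4 * F x y)) by now apply Ck_scal.
  assert (HeF : Ck 2 U (fun x y => -4 * euler F x y)) by now apply Ck_scal.
  assert (HFe : Ck 2 U (fun x y => 4 * F x y + -4 * euler F x y)) by now apply Ck_plus.
  assert (HH : Ck 2 U H) by now apply Ck_plus.
  assert (LH : eq_on U (laplacian H) (fun _ _ => 0)).
  { intros x y Hxy. unfold H.
    rewrite (laplacian_plus U _ _ HU HFe HqL x y Hxy),
      (laplacian_plus U _ _ HU H4F HeF x y Hxy),
      (laplacian_scal U 4 F HU H2 x y Hxy), (laplacian_scal U (-4) _ HU He x y Hxy),
      (laplacian_euler U F HU H3 x y Hxy), (laplacian_sqnorm_mult U L HU HL x y Hxy).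
    destruct (HF x y Hxy) as [_ E]. fold L in E. rewrite E. fold L. unfold euler. ring. }
  assert (LV : eq_on V (laplacian (fun x y => (x ^ 2 + y ^ 2) * u x y))
    (fun x y => H (invx x y) (invy x y))).
  { intros x y Hxy. assert (Hq := sqnorm_pos x y (H0 x y Hxy)).
    assert (Hu2 : Ck 2 V u) by now do 2 apply Ck_pred.
    rewrite (laplacian_sqnorm_mult V u HV Hu2 x y Hxy).
    unfold u at 4. rewrite (laplacian_inversion U V F HU HV H0 Hmap H2 x y Hxy). fold L.
    assert (CI := C1_sqnorm_inv V HV H0).
    assert (Cx := C1_mult HV (C1_fst V) CI).
    assert (Cy := C1_mult HV (C1_snd V) CI).
    destruct (C1_eq_derivatives
      (C1_comp HU HV Hmap (Ck_C1 H2) Cx Cy)) as [E1 E2].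
    change (Dx u x y) with (Dx (fun x y => F (invx x y) (invy x y)) x y).
    change (Dy u x y) with (Dy (fun x y => F (invx x y) (invy x y)) x y).
    rewrite (E1 x y Hxy), (E2 x y Hxy). unfold H, euler, u.
    change (x * / (x ^ 2 + y ^ 2)) with (invx x y).
    change (y * / (x ^ 2 + y ^ 2)) with (invy x y).
    generalize (Dx F (invx x y) (invy x y)) (Dy F (invx x y) (invy x y))
      (L (invx x y) (invy x y)) (F (invx x y) (invy x y)). intros P Q l w.
    unfold invx, invy. field. lra. }
  intros x y Hxy. split.
  - apply (Ck_mult 4 V (fun x y => x ^ 2 + y ^ 2) u); auto. now apply Ck_sqnorm.
  - transitivity (laplacian (fun x y => H (invx x y) (invy x y)) x y).
    { exact (eq_on_laplacian V _ _ HV LV x y Hxy). }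
    rewrite (laplacian_inversion U V H HU HV H0 Hmap HH x y Hxy).
    rewrite (LH _ _ (Hmap x y Hxy)). ring.
Qed.

(** * The biharmonic equation in polar form *)

Fixpoint smooth (n : nat) (a b : R) (f : R -> R) : Prop :=
  match n with
  | O => True
  | S n => exists f', (forall x, a < x < b -> is_derive f x (f' x)) /\ smooth n a b f'
  end.

Lemma smooth_combination (n : nat) (a b : R) (f g : R -> R) (k l : R) :
  smooth n a b f -> smooth n a b g -> smooth n a b (fun x => k * f x + l * g x).
Proof.
  revert f g. induction n as [|n IH]; intros f g; simpl; auto.
  intros (f' & Hf & Sf) (g' & Hg & Sg). exists (fun x => k * f' x + l * g' x).
  split; [|now apply IH]. intros x Hx.
  apply (is_derive_plus (fun x => k * f x) (fun x => l * g x)).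
  - apply (is_derive_scal f x k), Hf, Hx.
  - apply (is_derive_scal g x l), Hg, Hx.
Qed.

(** The factor [1 / sqrt q ^ k] makes the class closed under differentiation in [q]. *)
Lemma smooth_along_ray (n : nat) (U : plane -> Prop) (G : R -> R -> R)
    (e1 e2 a b : R) (k : nat) :
  open U -> 0 <= a -> (forall q, a < q < b -> U (sqrt q * e1, sqrt q * e2)) ->
  Ck n U G -> smooth n a b (fun q => G (sqrt q * e1) (sqrt q * e2) * / sqrt q ^ k).
Proof.
  intros HU Ha HUq. revert G k. induction n as [|n IH]; intros G k HG; [exact I|].
  destruct (Ck_derivatives HG) as [HGx HGy].
  exists (fun q =>
    1 * (e1 / 2 * (Dx G (sqrt q * e1) (sqrt q * e2) * / sqrt q ^ S k) +
         e2 / 2 * (Dy G (sqrt q * e1) (sqrt q * e2) * / sqrt q ^ S k)) +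
    - INR k / 2 * (G (sqrt q * e1) (sqrt q * e2) * / sqrt q ^ S (S k))).
  split.
  - intros q Hq. assert (Hs : 0 < sqrt q) by (apply sqrt_lt_R0; lra).
    assert (D1 : is_derive (fun q => G (sqrt q * e1) (sqrt q * e2)) q
      (Dx G (sqrt q * e1) (sqrt q * e2) * (e1 * / (2 * sqrt q)) +
       Dy G (sqrt q * e1) (sqrt q * e2) * (e2 * / (2 * sqrt q)))).
    { apply (C1_curve U G (Dx G) (Dy G) (fun q => sqrt q * e1) (fun q => sqrt q * e2)); auto.
      - exact (Ck_C1 HG).
      - auto_derive; [lra|]. field. lra.
      - auto_derive; [lra|]. field. lra. }
    assert (D2 : is_derive (fun q => / sqrt q ^ k) q (- INR k / 2 * / sqrt q ^ S (S k))).
    { auto_derive.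
      - split; [lra|]. split; auto. apply pow_nonzero. lra.
      - destruct k as [|k].
        + simpl. field. lra.
        + simpl pred. rewrite <- !tech_pow_Rmult. field.
          repeat split; try lra; apply pow_nonzero; lra. }
    replace (_ + _) with
     ((Dx G (sqrt q * e1) (sqrt q * e2) * (e1 * / (2 * sqrt q)) +
       Dy G (sqrt q * e1) (sqrt q * e2) * (e2 * / (2 * sqrt q))) * / sqrt q ^ k +
      G (sqrt q * e1) (sqrt q * e2) * (- INR k / 2 * / sqrt q ^ S (S k))).
    + now apply (is_derive_Rmult (fun q => G (sqrt q * e1) (sqrt q * e2)) (fun q => / sqrt q ^ k)).
    + rewrite <- !tech_pow_Rmult. field.
      repeat split; try lra; apply pow_nonzero; lra.
  - apply smooth_combination; [|apply IH; now apply Ck_pred].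
    apply smooth_combination; now apply IH.
Qed.

(** Differentiating a radial form once in [x] gives an expression quadratic in [x] with radial
    coefficients, so this shape covers the first two derivatives. *)
Lemma radial_polynomial_derive (A B C : R -> R) (A1 B1 C1 k x : R) :
  is_derive A (x ^ 2 + k) A1 -> is_derive B (x ^ 2 + k) B1 -> is_derive C (x ^ 2 + k) C1 ->
  is_derive (fun s => A (s ^ 2 + k) + s * B (s ^ 2 + k) + s ^ 2 * C (s ^ 2 + k)) x
    (2 * x * A1 + (B (x ^ 2 + k) + x * (2 * x * B1)) +
     (2 * x * C (x ^ 2 + k) + x ^ 2 * (2 * x * C1))).
Proof.
  intros HA HB HC.
  assert (Hq : is_derive (fun s => s ^ 2 + k) x (2 * x)) by (auto_derive; auto; ring).
  assert (Hc : forall f f1, is_derive f (x ^ 2 + k) f1 ->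
    is_derive (fun s => f (s ^ 2 + k)) x (2 * x * f1)).
  { intros f f1 Hf. now apply (is_derive_comp f (fun s => s ^ 2 + k)). }
  assert (H1 : is_derive (fun s => s * B (s ^ 2 + k)) x (1 * B (x ^ 2 + k) + x * (2 * x * B1))).
  { apply (is_derive_Rmult (fun s => s) (fun s => B (s ^ 2 + k))); auto.
    auto_derive; auto. }
  assert (H2 : is_derive (fun s => s ^ 2 * C (s ^ 2 + k)) x
     (2 * x * C (x ^ 2 + k) + x ^ 2 * (2 * x * C1))).
  { apply (is_derive_Rmult (fun s => s ^ 2) (fun s => C (s ^ 2 + k))); auto.
    auto_derive; auto; ring. }
  rewrite Rmult_1_l in H1.
  apply (is_derive_plus (fun s => A (s ^ 2 + k) + s * B (s ^ 2 + k))); auto.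
  apply (is_derive_plus (fun s => A (s ^ 2 + k))); auto.
Qed.

Definition radial_form (al be ga : R -> R) (x y : R) : R :=
  al (x ^ 2 + y ^ 2) + x * be (x ^ 2 + y ^ 2) + y * ga (x ^ 2 + y ^ 2).

Lemma radial_form_second_derivative (V : plane -> Prop) (a b : R)
    (al be ga al1 be1 ga1 al2 be2 ga2 : R -> R) :
  open V -> (forall x y, V (x, y) -> a < x ^ 2 + y ^ 2 < b) ->
  (forall q, a < q < b -> is_derive al q (al1 q) /\ is_derive al1 q (al2 q)) ->
  (forall q, a < q < b -> is_derive be q (be1 q) /\ is_derive be1 q (be2 q)) ->
  (forall q, a < q < b -> is_derive ga q (ga1 q) /\ is_derive ga1 q (ga2 q)) ->
  forall x y, V (x, y) -> let q := x ^ 2 + y ^ 2 in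
  Dx (Dx (radial_form al be ga)) x y =
    2 * al1 q + 4 * x ^ 2 * al2 q + x * (6 * be1 q + 4 * x ^ 2 * be2 q) +
    y * (2 * ga1 q + 4 * x ^ 2 * ga2 q).
Proof.
  intros HV Hab Hal Hbe Hga.
  assert (Hlin : forall (f g : R -> R) q df dg k, is_derive f q df -> is_derive g q dg ->
    is_derive (fun q => f q + k * g q) q (df + k * dg)).
  { intros f g q df dg k Hf Hg. apply (is_derive_plus f (fun q => k * g q)); auto.
    now apply (is_derive_scal g q k). }
  assert (E1 : eq_on V (Dx (radial_form al be ga)) (fun x y =>
     be (x ^ 2 + y ^ 2) + x * (2 * al1 (x ^ 2 + y ^ 2) + 2 * y * ga1 (x ^ 2 + y ^ 2)) +
     x ^ 2 * (0 + 2 * be1 (x ^ 2 + y ^ 2)))).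
  { intros x y Hxy. specialize (Hab x y Hxy).
    destruct (Hal _ Hab) as [Ha _]. destruct (Hbe _ Hab) as [Hb _].
    destruct (Hga _ Hab) as [Hc _].
    apply is_derive_unique.
    eapply is_derive_ext; [|evar_last; [
      apply (radial_polynomial_derive (fun q => al q + y * ga q) be (fun _ => 0) _ _ _ (y ^ 2) x
       (Hlin _ _ _ _ _ y Ha Hc) Hb (is_derive_const 0 _))|]].
    - intros s. unfold radial_form. simpl. ring.
    - unfold zero; simpl. ring. }
  intros x y Hxy q. rewrite (eq_on_Dx V _ _ HV E1 x y Hxy). unfold q.
  specialize (Hab x y Hxy).
  destruct (Hal _ Hab) as [Ha Ha']. destruct (Hbe _ Hab) as [Hb Hb'].
  destruct (Hga _ Hab) as [Hc Hc'].
  apply is_derive_unique.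
  evar_last; [
    apply (radial_polynomial_derive be (fun q => 2 * al1 q + 2 * y * ga1 q)
      (fun q => 0 + 2 * be1 q) _ _ _ (y ^ 2) x Hb
      (Hlin (fun q => 2 * al1 q) ga1 _ _ _ (2 * y) (is_derive_scal al1 _ 2 _ Ha') Hc')
      (Hlin (fun _ => 0) be1 _ _ _ 2 (is_derive_const 0 _) Hb'))|].
  simpl. unfold zero, scal; simpl. unfold mult; simpl. ring.
Qed.

(** The Laplacian preserves radial forms, so the biharmonic equation becomes a system of
    ordinary differential equations for the coefficients. *)
Lemma radial_form_laplacian (V : plane -> Prop) (a b : R) (F : R -> R -> R)
    (al be ga al1 be1 ga1 al2 be2 ga2 : R -> R) :
  open V -> (forall x y, V (x, y) -> a < x ^ 2 + y ^ 2 < b) ->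
  (forall q, a < q < b -> is_derive al q (al1 q) /\ is_derive al1 q (al2 q)) ->
  (forall q, a < q < b -> is_derive be q (be1 q) /\ is_derive be1 q (be2 q)) ->
  (forall q, a < q < b -> is_derive ga q (ga1 q) /\ is_derive ga1 q (ga2 q)) ->
  eq_on V F (radial_form al be ga) ->
  eq_on V (laplacian F) (radial_form (fun q => 4 * (q * al2 q + al1 q))
    (fun q => 4 * (q * be2 q + 2 * be1 q)) (fun q => 4 * (q * ga2 q + 2 * ga1 q))).
Proof.
  intros HV Hab Hal Hbe Hga HF x y Hxy.
  rewrite (eq_on_laplacian V _ _ HV HF x y Hxy), laplacian_eq.
  rewrite (radial_form_second_derivative V a b al be ga al1 be1 ga1 al2 be2 ga2); auto.
  (* the second derivative in y is the one in x of the form with x and y swapped *)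
  set (V' := fun p : plane => V (snd p, fst p)).
  assert (HV' : open V').
  { intros [u v] Huv. destruct (open_pair V v u HV Huv) as (d & Hd & Hb).
    apply locally_pair_iff. exists d; split; auto. intros s t Hs Ht. now apply Hb. }
  assert (E : Dy (Dy (radial_form al be ga)) x y = Dx (Dx (radial_form al ga be)) y x).
  { assert (Hswap : forall u v, radial_form al be ga u v = radial_form al ga be v u).
    { intros u v. unfold radial_form. rewrite (Rplus_comm (u ^ 2)). ring. }
    unfold Dy, Dx. apply Derive_ext. intros s. apply Derive_ext. intros t.
    apply Hswap. }
  rewrite E.
  rewrite (radial_form_second_derivative V' a b al ga be al1 ga1 be1 al2 ga2 be2); auto.
  - rewrite (Rplus_comm (y ^ 2)). unfold radial_form. ring.
  - intros u v Huv. rewrite Rplus_comm. now apply Hab.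
Qed.

Lemma constant_of_zero_derivative (a b : R) (f : R -> R) :
  (forall x, a < x < b -> is_derive f x 0) -> exists c, forall x, a < x < b -> f x = c.
Proof.
  intros H. exists (f ((a + b) / 2)). intros x Hx.
  destruct (MVT_gen f ((a + b) / 2) x (fun _ => 0)) as (c & Hc & E).
  - intros y Hy. apply H. unfold Rmin, Rmax in Hy.
    destruct (Rle_dec ((a + b) / 2) x); lra.
  - intros y Hy. apply continuity_smooth. exists 0. apply H. unfold Rmin, Rmax in Hy.
    destruct (Rle_dec ((a + b) / 2) x); lra.
  - lra.
Qed.

Lemma is_derive_Rminus (f g : R -> R) (x df dg : R) :
  is_derive f x df -> is_derive g x dg -> is_derive (fun y => f y - g y) x (df - dg).
Proof. intros Hf Hg. now apply (is_derive_minus f g). Qed.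

(** With [l = 4 (q f')'] the equation is [(q l')' = 0]; integrate four times. *)
Lemma radial_ode (a b : R) (f0 f1 f2 f3 f4 : R -> R) :
  0 <= a ->
  (forall q, a < q < b -> is_derive f0 q (f1 q) /\ is_derive f1 q (f2 q) /\
     is_derive f2 q (f3 q) /\ is_derive f3 q (f4 q)) ->
  (forall q, a < q < b ->
     q * (4 * (q * f4 q + 3 * f3 q)) + 4 * (q * f3 q + 2 * f2 q) = 0) ->
  exists c1 c2 c3 c4, forall q, a < q < b ->
    f0 q = c1 * (q * ln q) + c2 * ln q + c3 * q + c4.
Proof.
  intros Ha Hd Ho.
  assert (Hid : forall q : R, is_derive (fun q => q) q 1) by (intros; auto_derive; auto).
  destruct (constant_of_zero_derivative a b (fun q => q * (q * f3 q + 2 * f2 q))) as [c Hc].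
  { intros q Hq. destruct (Hd q Hq) as (D1 & D2 & D3 & D4).
    evar_last.
    - apply (is_derive_Rmult (fun q => q)); [apply Hid|].
      apply (is_derive_plus (fun q => q * f3 q)).
      + apply (is_derive_Rmult (fun q => q)); [apply Hid|exact D4].
      + apply (is_derive_scal f2 q 2). exact D3.
    - specialize (Ho q Hq). unfold plus; simpl. lra. }
  destruct (constant_of_zero_derivative a b (fun q => q * f2 q + f1 q - c * ln q)) as [d Hd'].
  { intros q Hq. destruct (Hd q Hq) as (D1 & D2 & D3 & D4).
    evar_last.
    - apply is_derive_Rminus.
      + apply (is_derive_plus (fun q => q * f2 q)); [|exact D2].
        apply (is_derive_Rmult (fun q => q)); [apply Hid|exact D3].
      + apply (is_derive_scal ln q c). apply is_derive_ln. lra.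
    - specialize (Hc q Hq). simpl in Hc. unfold plus, mult; simpl.
      apply Rmult_eq_reg_l with q; [|lra].
      transitivity (q * (q * f3 q + 2 * f2 q) - c); [field; lra|]. rewrite Hc. ring. }
  destruct (constant_of_zero_derivative a b
    (fun q => q * f1 q - (c * (q * ln q - q) + d * q))) as [e He].
  { intros q Hq. destruct (Hd q Hq) as (D1 & D2 & D3 & D4).
    evar_last.
    - apply is_derive_Rminus.
      + apply (is_derive_Rmult (fun q => q)); [apply Hid|exact D2].
      + instantiate (1 := c * ln q + d). auto_derive; [lra|]. field. lra.
    - specialize (Hd' q Hq). simpl in Hd'. lra. }
  destruct (constant_of_zero_derivative a b
    (fun q => f0 q - (c * (q * ln q - 2 * q) + d * q + e * ln q))) as [f Hf].
  { intros q Hq. destruct (Hd q Hq) as (D1 & D2 & D3 & D4).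
    evar_last.
    - apply is_derive_Rminus; [exact D1|].
      instantiate (1 := c * (ln q - 1) + d + e / q). auto_derive; [lra|]. field. lra.
    - specialize (He q Hq). simpl in He.
      apply Rmult_eq_reg_l with q; [|lra].
      transitivity (q * f1 q - (c * (q * ln q - q) + d * q) - e); [field; lra|].
      rewrite He. ring. }
  exists c, e, (d - 2 * c), f. intros q Hq. specialize (Hf q Hq). simpl in Hf. lra.
Qed.

(** With [q m / 4 = (q^2 f')'] the equation is [(q^2 m')' = 0]; integrate four times. *)
Lemma dipole_ode (a b : R) (f0 f1 f2 f3 f4 : R -> R) :
  0 <= a ->
  (forall q, a < q < b -> is_derive f0 q (f1 q) /\ is_derive f1 q (f2 q) /\
     is_derive f2 q (f3 q) /\ is_derive f3 q (f4 q)) ->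
  (forall q, a < q < b ->
     q * (4 * (q * f4 q + 4 * f3 q)) + 2 * (4 * (q * f3 q + 3 * f2 q)) = 0) ->
  exists c1 c2 c3 c4, forall q, a < q < b ->
    f0 q = c1 * ln q + c2 / q + c3 * q + c4.
Proof.
  intros Ha Hd Ho.
  assert (Hid : forall q : R, is_derive (fun q => q) q 1) by (intros; auto_derive; auto).
  assert (Hsq : forall q : R, is_derive (fun q => q ^ 2) q (2 * q))
    by (intros; auto_derive; auto; ring).
  destruct (constant_of_zero_derivative a b (fun q => q ^ 2 * (q * f3 q + 3 * f2 q))) as [c Hc].
  { intros q Hq. destruct (Hd q Hq) as (D1 & D2 & D3 & D4).
    evar_last.
    - apply (is_derive_Rmult (fun q => q ^ 2)); [apply Hsq|].
      apply (is_derive_plus (fun q => q * f3 q)).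
      + apply (is_derive_Rmult (fun q => q)); [apply Hid|exact D4].
      + apply (is_derive_scal f2 q 3). exact D3.
    - specialize (Ho q Hq). unfold plus; simpl.
      transitivity (q / 4 * (q * (4 * (q * f4 q + 4 * f3 q)) +
        2 * (4 * (q * f3 q + 3 * f2 q)))); [field|rewrite Ho; ring]. }
  destruct (constant_of_zero_derivative a b (fun q => q * f2 q + 2 * f1 q - - c / q)) as [d Hd'].
  { intros q Hq. destruct (Hd q Hq) as (D1 & D2 & D3 & D4).
    evar_last.
    - apply is_derive_Rminus.
      + apply (is_derive_plus (fun q => q * f2 q) (fun q => 2 * f1 q)).
        * apply (is_derive_Rmult (fun q => q)); [apply Hid|exact D3].
        * apply (is_derive_scal f1 q 2). exact D2.
      + instantiate (1 := c / q ^ 2). auto_derive; [lra|]. field. lra.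
    - specialize (Hc q Hq). cbv beta in Hc. unfold plus, mult; simpl plus.
      apply Rmult_eq_reg_l with (q ^ 2); [|apply pow_nonzero; lra].
      transitivity (q ^ 2 * (q * f3 q + 3 * f2 q) - c); [simpl; field; lra|]. rewrite Hc. ring. }
  destruct (constant_of_zero_derivative a b
    (fun q => q ^ 2 * f1 q - (d / 2 * q ^ 2 - c * q))) as [e He].
  { intros q Hq. destruct (Hd q Hq) as (D1 & D2 & D3 & D4).
    evar_last.
    - apply is_derive_Rminus.
      + apply (is_derive_Rmult (fun q => q ^ 2)); [apply Hsq|exact D2].
      + instantiate (1 := d * q - c). auto_derive; auto. field.
    - specialize (Hd' q Hq). cbv beta in Hd'. rewrite <- Hd'. field. lra. }
  destruct (constant_of_zero_derivative a b
    (fun q => f0 q - (d / 2 * q - c * ln q - e / q))) as [f Hf].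
  { intros q Hq. destruct (Hd q Hq) as (D1 & D2 & D3 & D4).
    evar_last.
    - apply is_derive_Rminus; [exact D1|].
      instantiate (1 := d / 2 - c / q + e / q ^ 2). auto_derive; [lra|]. field. lra.
    - specialize (He q Hq). cbv beta in He.
      apply Rmult_eq_reg_l with (q ^ 2); [|apply pow_nonzero; lra].
      rewrite <- He. field. lra. }
  exists (- c), (- e), (d / 2), f. intros q Hq. specialize (Hf q Hq). cbv beta in Hf.
  rewrite <- Hf. field. lra.
Qed.

(** * Infinitely many circles through one sector *)

Lemma interval_not_enumerable (u : nat -> R) (a b : R) :
  a < b -> exists x, a <= x <= b /\ forall n, u n <> x.
Proof.
  intros Hab.
  set (step := fun (z : R) (p : R * R) =>
    if Rle_dec z ((fst p + snd p) / 2)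
    then ((fst p + 3 * snd p) / 4, snd p) else (fst p, (fst p + snd p) / 2)).
  set (I := fix I n := match n with O => (a, b) | S n => step (u n) (I n) end).
  assert (Hlt : forall n, fst (I n) < snd (I n)).
  { induction n as [|n IH]; simpl; auto. unfold step.
    destruct (Rle_dec _ _); simpl; lra. }
  assert (Hstep : forall n, fst (I n) <= fst (I (S n)) /\ snd (I (S n)) <= snd (I n) /\
    ~ fst (I (S n)) <= u n <= snd (I (S n))).
  { intros n. simpl. specialize (Hlt n). unfold step.
    destruct (Rle_dec _ _); simpl; repeat split; lra. }
  assert (Hmono : forall n m, (n <= m)%nat -> fst (I n) <= fst (I m) /\ snd (I m) <= snd (I n)).
  { intros n m H. induction H as [|m H IH]; [lra|]. destruct (Hstep m) as (H1 & H2 & _). lra. }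
  assert (Hcross : forall n m, fst (I n) <= snd (I m)).
  { intros n m. destruct (Nat.le_ge_cases n m) as [L|L]; destruct (Hmono _ _ L);
      generalize (Hlt n) (Hlt m); lra. }
  destruct (completeness (fun x => exists n, x = fst (I n))) as [x [Hub Hlub]].
  - exists b. intros x [n ->]. apply (Hcross n 0%nat).
  - exists a. now exists 0%nat.
  - assert (Hx : forall n, fst (I n) <= x <= snd (I n)).
    { intros n. split; [apply Hub; now exists n|]. apply Hlub. intros y [m ->]. apply Hcross. }
    exists x. split; [exact (Hx 0%nat)|]. intros n E. subst x.
    destruct (Hstep n) as (_ & _ & H). apply H. apply Hx.
Qed.

(** If every piece were finite, the interval could be enumerated. *)
Lemma infinite_piece_of_countable_cover (T : nat -> R -> Prop) (a b : R) :
  a < b -> (forall t, a <= t <= b -> exists n, T n t) ->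
  exists n, forall l, exists t, a <= t <= b /\ T n t /\ ~ In t l.
Proof.
  intros Hab HT. apply NNPP. intros N.
  assert (Hfin : forall n, exists l, forall t, a <= t <= b -> T n t -> In t l).
  { intros n. apply NNPP. intros C. apply N. exists n. intros l.
    apply NNPP. intros C'. apply C. exists l. intros t Ht HTt. apply NNPP. intros C2.
    apply C'. exists t. auto. }
  set (L := fun n => proj1_sig (constructive_indefinite_description _ (Hfin n))).
  assert (HL : forall n t, a <= t <= b -> T n t -> In t (L n)).
  { intros n. unfold L. now destruct (constructive_indefinite_description _ (Hfin n)). }
  destruct (interval_not_enumerable
    (fun k => nth (snd (Cantor.of_nat k)) (L (fst (Cantor.of_nat k))) a) a b Hab)
    as (x & Hx & Hn).
  destruct (HT x Hx) as [n Hnx]. apply (HL n x Hx) in Hnx.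
  apply (In_nth _ _ a) in Hnx. destruct Hnx as (i & _ & Hi).
  apply (Hn (Cantor.to_nat (n, i))). now rewrite Cantor.cancel_of_to.
Qed.

(** Only a neighbourhood of one point of each arc is recorded: the arcs need not depend
    continuously on the parameter of the family. *)
Definition arc_datum (U : plane -> Prop) (F : R -> R -> R) (r w u v : R) : Prop :=
  0 < r /\ exists e1 e2 d, e1 ^ 2 + e2 ^ 2 = 1 /\ 0 < d /\
    forall x y, Rabs (x - r * e1) < d -> Rabs (y - r * e2) < d ->
      U (x, y) /\ (x ^ 2 + y ^ 2 = r ^ 2 -> F x y = w + u * x + v * y).

Definition unit_arc (c1 c2 d e1 e2 : R) : Prop :=
  e1 ^ 2 + e2 ^ 2 = 1 /\ Rabs (e1 - c1) < d /\ Rabs (e2 - c2) < d.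

Definition affine_in_sector (U : plane -> Prop) (F : R -> R -> R)
    (c1 c2 d r1 r2 r w u v : R) : Prop :=
  0 < r1 /\ r1 < r2 /\ (exists e1 e2, unit_arc c1 c2 d e1 e2) /\
  (forall e1 e2 s, unit_arc c1 c2 d e1 e2 -> r1 <= s <= r2 -> U (s * e1, s * e2)) /\
  r1 <= r <= r2 /\
  forall e1 e2, unit_arc c1 c2 d e1 e2 ->
    F (r * e1) (r * e2) = w + u * (r * e1) + v * (r * e2).

(** Natural numbers [N, a1, a2, b] encode a sector with rational data, so that there are
    countably many.  With [N] large, grid points at distance less than [1 / N] are available,
    and the width [2 / N] keeps the given direction inside. *)
Definition rational_sector (U : plane -> Prop) (F : R -> R -> R) (N a1 a2 b : nat) :
    R -> R -> R -> R -> Prop :=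
  affine_in_sector U F (INR a1 / INR N - 1) (INR a2 / INR N - 1) (2 / INR N)
    (INR b / INR N) (INR (S b) / INR N).

Lemma nat_floor (x : R) : 0 <= x -> exists n : nat, INR n <= x < INR (S n).
Proof.
  intros Hx. destruct (nfloor_ex x Hx) as [n Hn]. exists n. now rewrite S_INR.
Qed.

Lemma arc_datum_in_rational_sector (U : plane -> Prop) (F : R -> R -> R) (r w u v : R) :
  arc_datum U F r w u v -> exists N a1 a2 b, rational_sector U F N a1 a2 b r w u v.
Proof.
  intros (Hr & e1 & e2 & d & He & Hd & H).
  destruct (nat_floor (1 / r + (1 + 3 * r) / d)) as [n [_ Hn]].
  { apply Rplus_le_le_0_compat; apply Rlt_le, Rdiv_lt_0_compat; lra. }
  assert (Hinv1 : 0 < 1 / r) by (apply Rdiv_lt_0_compat; lra).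
  assert (Hinv2 : 0 < (1 + 3 * r) / d) by (apply Rdiv_lt_0_compat; lra).
  set (N := INR (S n)) in *.
  assert (HN0 : 0 < N) by lra.
  assert (HNr : 1 < r * N).
  { apply Rle_lt_trans with (r * (1 / r)); [right; field; lra|].
    apply Rmult_lt_compat_l; lra. }
  assert (HNd : (1 + 3 * r) / N < d).
  { apply Rmult_lt_reg_r with N; auto.
    apply Rle_lt_trans with (d * ((1 + 3 * r) / d)); [right; field; lra|].
    apply Rmult_lt_compat_l; lra. }
  assert (Hb1 : -1 <= e1 <= 1) by nra. assert (Hb2 : -1 <= e2 <= 1) by nra.
  assert (Hgrid : forall e, -1 <= e <= 1 -> exists a : nat,
    0 <= e - (INR a / N - 1) /\ e - (INR a / N - 1) < 1 / N).
  { intros e Hbe. destruct (nat_floor ((e + 1) * N)) as [a [H1 H2]]; [nra|].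
    exists a. rewrite S_INR in H2.
    split; (apply Rmult_le_reg_r with N || apply Rmult_lt_reg_r with N); auto.
    - rewrite Rmult_0_l. replace ((e - (INR a / N - 1)) * N) with ((e + 1) * N - INR a)
        by (field; lra). lra.
    - replace ((e - (INR a / N - 1)) * N) with ((e + 1) * N - INR a) by (field; lra).
      replace (1 / N * N) with 1 by (field; lra). lra. }
  destruct (Hgrid e1 Hb1) as (a1 & A1 & A1'). destruct (Hgrid e2 Hb2) as (a2 & A2 & A2').
  destruct (nat_floor (r * N)) as [b [B1 B2]]; [nra|].
  assert (Hb : (1 <= b)%nat).
  { destruct b; [simpl in B2; lra|lia]. }
  apply le_INR in Hb. simpl in Hb.
  assert (H2N : 2 / N = 1 / N + 1 / N) by (field; lra).
  assert (HiN : 0 < 1 / N) by (apply Rdiv_lt_0_compat; lra).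
  assert (Hrr : INR b / N <= r <= INR (S b) / N).
  { split; apply Rmult_le_reg_r with N; auto; unfold Rdiv; rewrite Rmult_assoc, Rinv_l; lra. }
  assert (Hwid : INR (S b) / N = INR b / N + 1 / N) by (rewrite S_INR; field; lra).
  assert (Hsec : forall f1 f2 s, unit_arc (INR a1 / N - 1) (INR a2 / N - 1) (2 / N) f1 f2 ->
    INR b / N <= s <= INR (S b) / N ->
    Rabs (s * f1 - r * e1) < d /\ Rabs (s * f2 - r * e2) < d).
  { assert (Hone : forall f e a s, -1 <= f <= 1 -> 0 <= e - a -> e - a < 1 / N ->
      Rabs (f - a) < 2 / N -> INR b / N <= s <= INR (S b) / N -> Rabs (s * f - r * e) < d).
    { intros f e a s Hf He1 He2 Hfa Hs. apply Rabs_def2 in Hfa.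
      replace (s * f - r * e) with ((s - r) * f + r * (f - e)) by ring.
      eapply Rle_lt_trans; [apply Rabs_triang|]. rewrite !Rabs_mult, (Rabs_pos_eq r) by lra.
      assert (Rabs (s - r) <= 1 / N) by (apply Rabs_le; lra).
      assert (Rabs f <= 1) by (apply Rabs_le; lra).
      assert (Rabs (f - e) <= 3 / N) by (apply Rabs_le; replace (3 / N) with (1 / N + 1 / N + 1
          / N) by (field; lra); lra).
      apply Rle_lt_trans with (1 / N * 1 + r * (3 / N)).
      - apply Rplus_le_compat; [|apply Rmult_le_compat_l; lra].
        apply Rmult_le_compat; auto; apply Rabs_pos.
      - replace (1 / N * 1 + r * (3 / N)) with ((1 + 3 * r) / N) by (field; lra). exact HNd. }
    intros f1 f2 s (Hf & Hf1 & Hf2) Hs.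
    split; eapply Hone; eauto; nra. }
  exists (S n), a1, a2, b. unfold rational_sector. fold N. split; [|split; [|split; [|split;
      [|split]]]].
  - apply Rdiv_lt_0_compat; lra.
  - rewrite Hwid. lra.
  - exists e1, e2. split; auto. split; apply Rabs_def1; lra.
  - intros f1 f2 s Hf Hs. destruct (Hsec f1 f2 s Hf Hs). now apply H.
  - exact Hrr.
  - intros f1 f2 Hf. destruct (Hsec f1 f2 r Hf Hrr) as [H1 H2].
    apply H; auto. destruct Hf as (Hf & _). rewrite !Rpow_mult_distr, <- Rmult_plus_distr_l, Hf.
        ring.
Qed.

(** * Biharmonic functions affine on concentric circles *)

Lemma locally_lt_of_continuity (f : R -> R -> R) (x y k : R) :
  continuity_2d_pt f x y -> f x y < k -> locally (x, y) (fun p => f (fst p) (snd p) < k).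
Proof.
  intros Hf Hk. apply continuity_2d_pt_filterlim in Hf.
  apply (Hf (fun z => z < k)). apply locally_R_iff. exists (k - f x y).
  split; [lra|]. intros z Hz. apply Rabs_def2 in Hz. lra.
Qed.

Lemma locally_Rabs_lt_of_continuity (f : R -> R -> R) (x y c k : R) :
  continuity_2d_pt f x y -> Rabs (f x y - c) < k ->
  locally (x, y) (fun p => Rabs (f (fst p) (snd p) - c) < k).
Proof.
  intros Hf Hk.
  apply (locally_lt_of_continuity (fun x y => Rabs (f x y - c))); auto.
  apply (continuity_1d_2d_pt_comp Rabs (fun x y => f x y - c)).
  - apply Rcontinuity_abs.
  - apply continuity_2d_pt_minus; auto. apply continuity_2d_pt_const.
Qed.

Lemma continuity_2d_pt_sqnorm (x y : R) : continuity_2d_pt (fun x y => x ^ 2 + y ^ 2) x y.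
Proof.
  apply continuity_2d_pt_plus.
  - apply (continuity_2d_pt_fst (fun x => x ^ 2)). auto_derive; auto.
  - apply (continuity_2d_pt_snd (fun y => y ^ 2)). auto_derive; auto.
Qed.

Definition sector (c1 c2 d r1 r2 : R) : plane -> Prop := fun p =>
  r1 ^ 2 < fst p ^ 2 + snd p ^ 2 < r2 ^ 2 /\
  Rabs (fst p / sqrt (fst p ^ 2 + snd p ^ 2) - c1) < d /\
  Rabs (snd p / sqrt (fst p ^ 2 + snd p ^ 2) - c2) < d.

Lemma open_sector (c1 c2 d r1 r2 : R) : open (sector c1 c2 d r1 r2).
Proof.
  intros [x y] ((H1 & H2) & H3 & H4); simpl fst in *; simpl snd in *.
  assert (Hq : 0 < x ^ 2 + y ^ 2) by (generalize (pow2_ge_0 r1); lra).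
  assert (Hc := continuity_2d_pt_sqnorm x y).
  assert (Hs : continuity_2d_pt (fun x y => / sqrt (x ^ 2 + y ^ 2)) x y).
  { apply (continuity_1d_2d_pt_comp (fun q => / sqrt q) (fun x y => x ^ 2 + y ^ 2)); auto.
    apply continuity_smooth. auto_derive. split; auto. split; auto.
    apply Rgt_not_eq, sqrt_lt_R0. lra. }
  repeat apply filter_and.
  - assert (H := locally_lt_of_continuity (fun x y => - (x ^ 2 + y ^ 2)) x y (- r1 ^ 2)
      (continuity_2d_pt_opp _ _ _ Hc)). cbv beta in H.
    assert (H' := H ltac:(lra)). revert H'. apply filter_imp. intros p Hp. cbv beta in *. simpl
        in *. lra.
  - now apply (locally_lt_of_continuity (fun x y => x ^ 2 + y ^ 2)).
  - apply (locally_Rabs_lt_of_continuity (fun x y => x / sqrt (x ^ 2 + y ^ 2))); auto.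
    apply (continuity_2d_pt_mult (fun x _ => x)); auto. apply continuity_2d_pt_id1.
  - apply (locally_Rabs_lt_of_continuity (fun x y => y / sqrt (x ^ 2 + y ^ 2))); auto.
    apply (continuity_2d_pt_mult (fun _ y => y)); auto. apply continuity_2d_pt_id2.
Qed.

Lemma sector_polar (c1 c2 d r1 r2 x y : R) :
  0 < r1 -> 0 < r2 -> sector c1 c2 d r1 r2 (x, y) ->
  exists s e1 e2, s = sqrt (x ^ 2 + y ^ 2) /\ r1 < s < r2 /\ unit_arc c1 c2 d e1 e2 /\
    x = s * e1 /\ y = s * e2.
Proof.
  intros Hr1 Hr2 ((H1 & H2) & H3 & H4); simpl fst in *; simpl snd in *.
  set (s := sqrt (x ^ 2 + y ^ 2)) in *.
  assert (Hq : 0 < x ^ 2 + y ^ 2) by (generalize (pow2_ge_0 r1); lra).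
  assert (Hs : 0 < s) by now apply sqrt_lt_R0.
  assert (Hs2 : s ^ 2 = x ^ 2 + y ^ 2) by (apply pow2_sqrt; lra).
  rewrite <- Hs2 in H1, H2.
  exists s, (x / s), (y / s). split; [reflexivity|].
  split.
  { clear - H1 H2 Hs Hr1 Hr2. clearbody s. split; nra. }
  split; [split|split; field; lra]; auto.
  unfold Rdiv. rewrite !Rpow_mult_distr, <- Rmult_plus_distr_r, <- Hs2.
  rewrite <- Rpow_mult_distr, Rinv_r by lra. ring.
Qed.

Lemma polar_in_sector (c1 c2 d r1 r2 s e1 e2 : R) :
  0 < r1 -> r1 < s < r2 -> unit_arc c1 c2 d e1 e2 ->
  (s * e1) ^ 2 + (s * e2) ^ 2 = s ^ 2 /\ sector c1 c2 d r1 r2 (s * e1, s * e2).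
Proof.
  intros Hr1 Hs (He & H1 & H2).
  assert (E : (s * e1) ^ 2 + (s * e2) ^ 2 = s ^ 2).
  { rewrite !Rpow_mult_distr, <- Rmult_plus_distr_l, He. ring. }
  split; auto. unfold sector; simpl fst; simpl snd.
  rewrite E. rewrite sqrt_pow2 by lra. split; [split; nra|].
  split; [replace (s * e1 / s) with e1 by (field; lra)|replace (s * e2 / s) with e2 by (field;
      lra)]; auto.
Qed.

(** Turning the given point slightly to both sides; an affine function is determined by its
    values at three points of a circle. *)
Lemma three_points_on_arc (c1 c2 d e1 e2 : R) :
  unit_arc c1 c2 d e1 e2 -> exists c s, 0 < s /\ c < 1 /\
    unit_arc c1 c2 d (c * e1 - s * e2) (c * e2 + s * e1) /\
    unit_arc c1 c2 d (c * e1 + s * e2) (c * e2 - s * e1).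
Proof.
  intros (He & H1 & H2).
  assert (Hloc : forall a b k, Rabs (a - k) < d ->
    locally 0 (fun t => Rabs ((cos t * a + sin t * b) - k) < d)).
  { intros a b k Hk.
    assert (C : continuity_pt (fun t => cos t * a + sin t * b) 0).
    { apply continuity_smooth. auto_derive; auto. }
    apply continuity_pt_filterlim in C. rewrite cos_0, sin_0 in C.
    apply (C (fun z => Rabs (z - k) < d)). apply locally_R_iff.
    exists (d - Rabs (a - k)). split; [lra|]. intros z Hz.
    replace (z - k) with ((z - (1 * a + 0 * b)) + (a - k)) by ring.
    eapply Rle_lt_trans; [apply Rabs_triang|]. lra. }
  assert (H := filter_and _ _ (filter_and _ _ (Hloc e1 e2 c1 H1) (Hloc e1 (- e2) c1 H1))
     (filter_and _ _ (Hloc e2 e1 c2 H2) (Hloc e2 (- e1) c2 H2))).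
  apply locally_R_iff in H. destruct H as (h & Hh & H).
  set (t := Rmin (h / 2) 1).
  assert (Ht : 0 < t) by (apply Rmin_pos; lra).
  assert (Ht1 : t <= 1) by apply Rmin_r. assert (Hth : t <= h / 2) by apply Rmin_l.
  assert (Hpi : 3 < PI) by (generalize PI2_3_2; lra).
  destruct (H t) as [[A B] [C D]]. { rewrite Rminus_0_r, Rabs_pos_eq; lra. }
  assert (Hsc : sin t ^ 2 + cos t ^ 2 = 1) by (generalize (sin2_cos2 t); unfold Rsqr; lra).
  assert (Hs : 0 < sin t) by (apply sin_gt_0; lra).
  exists (cos t), (sin t). split; auto. split; [nra|].
  split; (split; [|split]).
  - transitivity ((sin t ^ 2 + cos t ^ 2) * (e1 ^ 2 + e2 ^ 2)); [ring|rewrite Hsc, He; ring].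
  - replace (cos t * e1 - sin t * e2 - c1) with (cos t * e1 + sin t * - e2 - c1) by ring. auto.
  - auto.
  - transitivity ((sin t ^ 2 + cos t ^ 2) * (e1 ^ 2 + e2 ^ 2)); [ring|rewrite Hsc, He; ring].
  - auto.
  - replace (cos t * e2 - sin t * e1 - c2) with (cos t * e2 + sin t * - e1 - c2) by ring. auto.
Qed.

Lemma affine_zero_on_arc (c1 c2 d s w u v : R) :
  0 < s -> (exists e1 e2, unit_arc c1 c2 d e1 e2) ->
  (forall e1 e2, unit_arc c1 c2 d e1 e2 -> w + u * (s * e1) + v * (s * e2) = 0) ->
  w = 0 /\ u = 0 /\ v = 0.
Proof.
  intros Hs (e1 & e2 & He) H.
  destruct (three_points_on_arc c1 c2 d e1 e2 He) as (c & k & Hk & Hc & Hp & Hm).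
  assert (E0 := H _ _ He). assert (Ep := H _ _ Hp). assert (Em := H _ _ Hm).
  destruct He as [He _].
  set (X := s * (u * e1 + v * e2)). set (Y := s * (v * e1 - u * e2)).
  assert (F0 : w + X = 0) by (unfold X; lra).
  assert (Fp : w + c * X + k * Y = 0) by (unfold X, Y; lra).
  assert (Fm : w + c * X - k * Y = 0) by (unfold X, Y; lra).
  assert (Y0 : Y = 0) by (apply Rmult_eq_reg_l with k; lra).
  assert (X0 : X = 0) by (apply Rmult_eq_reg_l with (1 - c); lra).
  assert (Eu : s * u = e1 * X - e2 * Y).
  { unfold X, Y. transitivity (s * u * (e1 ^ 2 + e2 ^ 2)); [rewrite He; ring|ring]. }
  assert (Ev : s * v = e2 * X + e1 * Y).
  { unfold X, Y. transitivity (s * v * (e1 ^ 2 + e2 ^ 2)); [rewrite He; ring|ring]. }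
  rewrite X0, Y0 in *.
  split; [lra|]. split; apply Rmult_eq_reg_l with s; lra.
Qed.

(** The right-hand side interpolates at three points of the arc.  The identity holds on
    infinitely many circles, and both sides are analytic in the radius. *)
Lemma affine_on_all_arcs (U : plane -> Prop) (F : R -> R -> R) (c1 c2 d r1 r2 e1 e2 c k : R) :
  r1 < r2 -> 0 < k -> c < 1 -> line_analytic U F ->
  (forall e1 e2 s, unit_arc c1 c2 d e1 e2 -> r1 <= s <= r2 -> U (s * e1, s * e2)) ->
  (forall l, exists r w u v, r1 <= r <= r2 /\ ~ In r l /\
     forall e1 e2, unit_arc c1 c2 d e1 e2 ->
       F (r * e1) (r * e2) = w + u * (r * e1) + v * (r * e2)) ->
  unit_arc c1 c2 d e1 e2 ->
  unit_arc c1 c2 d (c * e1 - k * e2) (c * e2 + k * e1) ->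
  unit_arc c1 c2 d (c * e1 + k * e2) (c * e2 - k * e1) ->
  forall f1 f2 s, unit_arc c1 c2 d f1 f2 -> r1 <= s <= r2 ->
  let x := f1 * e1 + f2 * e2 in let y := f2 * e1 - f1 * e2 in
  F (s * f1) (s * f2) =
    (1 - (1 - x) / (1 - c)) * F (s * e1) (s * e2) +
    ((1 - x) / (2 * (1 - c)) + y / (2 * k)) *
      F (s * (c * e1 - k * e2)) (s * (c * e2 + k * e1)) +
    ((1 - x) / (2 * (1 - c)) - y / (2 * k)) *
      F (s * (c * e1 + k * e2)) (s * (c * e2 - k * e1)).
Proof.
  intros Hr Hk Hc HF HU Hinf He Hp Hm f1 f2 s Hf Hs x y.
  assert (Han : forall g1 g2, unit_arc c1 c2 d g1 g2 -> forall s, r1 <= s <= r2 ->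
    analytic_at (fun s => F (s * g1) (s * g2)) s).
  { intros g1 g2 Hg t Ht.
    apply analytic_ext with (fun s => F (0 + s * g1) (0 + s * g2)).
    { intros z. now rewrite !Rplus_0_l. }
    apply analytic_on_line with U; auto. rewrite !Rplus_0_l. auto. }
  apply Rminus_diag_uniq.
  apply (analytic_identity_infinite (fun s => F (s * f1) (s * f2) -
   ((1 - (1 - x) / (1 - c)) * F (s * e1) (s * e2) +
    ((1 - x) / (2 * (1 - c)) + y / (2 * k)) *
      F (s * (c * e1 - k * e2)) (s * (c * e2 + k * e1)) +
    ((1 - x) / (2 * (1 - c)) - y / (2 * k)) *
      F (s * (c * e1 + k * e2)) (s * (c * e2 - k * e1)))) r1 r2); auto; try lra.
  - intros t Ht. apply analytic_minus; [now apply Han|].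
    apply analytic_plus; [apply analytic_plus|]; apply analytic_scal.
    + exact (Han _ _ He t Ht).
    + exact (Han _ _ Hp t Ht).
    + exact (Han _ _ Hm t Ht).
  - intros l. destruct (Hinf l) as (r & w & u & v & Hr' & Hl & H).
    exists r. split; auto. split; auto.
    rewrite (H _ _ Hf), (H _ _ He), (H _ _ Hp), (H _ _ Hm).
    destruct He as [He _].
    assert (Ef1 : f1 = x * e1 - y * e2).
    { unfold x, y. transitivity (f1 * (e1 ^ 2 + e2 ^ 2)); [rewrite He; ring|ring]. }
    assert (Ef2 : f2 = x * e2 + y * e1).
    { unfold x, y. transitivity (f2 * (e1 ^ 2 + e2 ^ 2)); [rewrite He; ring|ring]. }
    clearbody x y. rewrite Ef1, Ef2. field. lra.
Qed.

(** [G], plus the term [a2' y ln (x^2 + y^2)] that a rotation removes, plus an i-M-sphere. *)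
Definition normal_form (a1 a2 a2' a3 b1 b2 c1 c2 s0 s1 s2 s3 : R) (x y : R) : R :=
  (a1 * (x ^ 2 + y ^ 2) + a2 * x + a2' * y + a3) * ln (x ^ 2 + y ^ 2)
  + (b1 * y + b2 * x) / (x ^ 2 + y ^ 2)
  + (c1 * y + c2 * x) * (x ^ 2 + y ^ 2)
  + (s0 * (x ^ 2 + y ^ 2) + s1 * x + s2 * y + s3).

Definition has_normal_form (U : plane -> Prop) (F : R -> R -> R) : Prop :=
  exists a1 a2 a2' a3 b1 b2 c1 c2 s0 s1 s2 s3,
    eq_on U F (normal_form a1 a2 a2' a3 b1 b2 c1 c2 s0 s1 s2 s3).

Lemma smooth4 (a b : R) (f : R -> R) : smooth 4 a b f ->
  exists f1 f2 f3 f4, forall q, a < q < b -> is_derive f q (f1 q) /\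
    is_derive f1 q (f2 q) /\ is_derive f2 q (f3 q) /\ is_derive f3 q (f4 q).
Proof.
  intros (f1 & H1 & f2 & H2 & f3 & H3 & f4 & H4 & _). exists f1, f2, f3, f4. auto.
Qed.

Lemma is_derive_plus_scal (f g : R -> R) (k l q df dg : R) :
  is_derive f q df -> is_derive g q dg ->
  is_derive (fun q => k * (q * f q + l * g q)) q (k * (q * df + f q + l * dg)).
Proof.
  intros Hf Hg. apply (is_derive_scal (fun q => q * f q + l * g q) q k).
  apply (is_derive_plus (fun q => q * f q) (fun q => l * g q)).
  - replace (q * df + f q) with (1 * f q + q * df) by ring.
    apply (is_derive_Rmult (fun q => q)); auto. auto_derive; auto.
  - now apply (is_derive_scal g q l).
Qed.

(** Interpolation at three directions puts [F] into radial form, and three points on each arc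
    separate the three equations that the bilaplacian yields for its coefficients. *)
Lemma biharmonic_in_sector (U : plane -> Prop) (F : R -> R -> R) (c1 c2 d r1 r2 : R) :
  open U -> biharmonic_on U F -> 0 < r1 -> r1 < r2 ->
  (exists e1 e2, unit_arc c1 c2 d e1 e2) ->
  (forall e1 e2 s, unit_arc c1 c2 d e1 e2 -> r1 <= s <= r2 -> U (s * e1, s * e2)) ->
  (forall l, exists r w u v, r1 <= r <= r2 /\ ~ In r l /\
     forall e1 e2, unit_arc c1 c2 d e1 e2 ->
       F (r * e1) (r * e2) = w + u * (r * e1) + v * (r * e2)) ->
  has_normal_form (sector c1 c2 d r1 r2) F.
Proof.
  intros HU HF Hr1 Hr2 Hex HUs Hinf.
  assert (Hex' := Hex). destruct Hex' as (e1 & e2 & He).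
  destruct (three_points_on_arc c1 c2 d e1 e2 He) as (c & k & Hk & Hc & Hp & Hm).
  assert (HFl := biharmonic_line_analytic U F HU HF).
  assert (HF4 : Ck 4 U F) by (intros x y Hxy; now apply HF).
  set (V := sector c1 c2 d r1 r2). assert (HV : open V) by apply open_sector.
  assert (HVU : forall x y, V (x, y) -> U (x, y)).
  { intros x y Hxy. destruct (sector_polar c1 c2 d r1 r2 x y) as (s & f1 & f2 & _ & Hs & Hf & ->
      & ->);
      auto; try lra. apply HUs; auto. lra. }
  assert (HVq : forall x y, V (x, y) -> r1 ^ 2 < x ^ 2 + y ^ 2 < r2 ^ 2) by (intros x y Hxy;
      apply Hxy).
  assert (Hsq : forall q, r1 ^ 2 < q < r2 ^ 2 -> r1 < sqrt q < r2).
  { intros q Hq. assert (0 < q) by nra.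
    assert (E := pow2_sqrt q). assert (P := sqrt_pos q). split; nra. }
  (* values at the three points, divided by a power of the radius *)
  set (g := fun (f1 f2 : R) (n : nat) (q : R) => F (sqrt q * f1) (sqrt q * f2) * / sqrt q ^ n).
  assert (Hg : forall f1 f2 n, unit_arc c1 c2 d f1 f2 ->
    smooth 4 (r1 ^ 2) (r2 ^ 2) (g f1 f2 n)).
  { intros f1 f2 n Hf. apply (smooth_along_ray 4 U F f1 f2); auto.
    - nra.
    - intros q Hq. apply HUs; auto. specialize (Hsq q Hq). lra. }
  set (comb := fun k0 kp km n q => 1 * (k0 * g e1 e2 n q +
     kp * g (c * e1 - k * e2) (c * e2 + k * e1) n q) +
     km * g (c * e1 + k * e2) (c * e2 - k * e1) n q).
  assert (Hcomb : forall k0 kp km n, smooth 4 (r1 ^ 2) (r2 ^ 2) (comb k0 kp km n)).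
  { intros. apply (smooth_combination 4 _ _ (fun q => k0 * g e1 e2 n q +
     kp * g (c * e1 - k * e2) (c * e2 + k * e1) n q)); auto.
    apply smooth_combination; auto. }
  set (i := / (2 * (1 - c))). set (j := / (2 * k)).
  (* the coefficients of 1, x and y of the Lagrange interpolation *)
  set (al := comb (1 - 2 * i) i i 0%nat).
  set (be := comb (e1 * (2 * i)) (e1 * - i - e2 * j) (e1 * - i + e2 * j) 1%nat).
  set (ga := comb (e2 * (2 * i)) (e2 * - i + e1 * j) (e2 * - i - e1 * j) 1%nat).
  assert (HFf : eq_on V F (radial_form al be ga)).
  { intros x y Hxy.
    destruct (sector_polar c1 c2 d r1 r2 x y) as (s & f1 & f2 & Es & Hs & Hf & -> & ->);
      auto; try lra.
    assert (Hs' : r1 <= s <= r2) by lra.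
    rewrite (affine_on_all_arcs U F c1 c2 d r1 r2 e1 e2 c k Hr2 Hk Hc HFl HUs Hinf
      He Hp Hm f1 f2 s Hf Hs').
    unfold radial_form, al, be, ga, comb, g. rewrite <- Es.
    unfold i, j. field. lra. }
  destruct (smooth4 _ _ _ (Hcomb (1 - 2 * i) i i 0%nat)) as (al1 & al2 & al3 & al4 & Hal).
  destruct (smooth4 _ _ _ (Hcomb (e1 * (2 * i)) (e1 * - i - e2 * j) (e1 * - i + e2 * j) 1%nat))
    as (be1 & be2 & be3 & be4 & Hbe).
  destruct (smooth4 _ _ _ (Hcomb (e2 * (2 * i)) (e2 * - i + e1 * j) (e2 * - i - e1 * j) 1%nat))
    as (ga1 & ga2 & ga3 & ga4 & Hga).
  fold al in Hal. fold be in Hbe. fold ga in Hga.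
  assert (HL1 : eq_on V (laplacian F) (radial_form (fun q => 4 * (q * al2 q + al1 q))
    (fun q => 4 * (q * be2 q + 2 * be1 q)) (fun q => 4 * (q * ga2 q + 2 * ga1 q)))).
  { apply (radial_form_laplacian V (r1 ^ 2) (r2 ^ 2) F al be ga); auto;
      intros q Hq; split; first [apply (Hal q Hq)|apply (Hbe q Hq)|apply (Hga q Hq)]. }
  assert (HL2 := radial_form_laplacian V (r1 ^ 2) (r2 ^ 2) (laplacian F)
    (fun q => 4 * (q * al2 q + al1 q))
    (fun q => 4 * (q * be2 q + 2 * be1 q)) (fun q => 4 * (q * ga2 q + 2 * ga1 q))
    (fun q => 4 * (q * al3 q + 2 * al2 q))
    (fun q => 4 * (q * be3 q + 3 * be2 q)) (fun q => 4 * (q * ga3 q + 3 * ga2 q))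
    (fun q => 4 * (q * al4 q + 3 * al3 q))
    (fun q => 4 * (q * be4 q + 4 * be3 q)) (fun q => 4 * (q * ga4 q + 4 * ga3 q)) HV HVq).
  assert (Hstep : forall (f g df dg : R -> R) l q, is_derive f q (df q) -> is_derive g q (f q) ->
    is_derive (fun q => 4 * (q * f q + l * g q)) q (4 * (q * df q + (l + 1) * f q))).
  { intros f g' df dg l q Hf Hg'.
    replace (4 * (q * df q + (l + 1) * f q)) with (4 * (q * df q + f q + l * f q)) by ring.
    now apply is_derive_plus_scal. }
  assert (HZ : forall q, r1 ^ 2 < q < r2 ^ 2 ->
    (q * (4 * (q * al4 q + 3 * al3 q)) + 4 * (q * al3 q + 2 * al2 q) = 0) /\
    (q * (4 * (q * be4 q + 4 * be3 q)) + 2 * (4 * (q * be3 q + 3 * be2 q)) = 0) /\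
    (q * (4 * (q * ga4 q + 4 * ga3 q)) + 2 * (4 * (q * ga3 q + 3 * ga2 q)) = 0)).
  { intros q Hq. specialize (Hsq q Hq).
    assert (Hqs : sqrt q ^ 2 = q) by (apply pow2_sqrt; nra).
    apply (affine_zero_on_arc c1 c2 d (sqrt q)); auto; [lra|].
    intros f1 f2 Hf.
    destruct (polar_in_sector c1 c2 d r1 r2 (sqrt q) f1 f2 Hr1 Hsq Hf) as [E HVf].
    destruct (HF _ _ (HVU _ _ HVf)) as [_ H0].
    rewrite HL2 in H0; auto.
    - unfold radial_form in H0. rewrite E, Hqs in H0. cbv beta in H0.
      apply Rmult_eq_reg_l with 4; [|lra]. rewrite Rmult_0_r, <- H0. ring.
    - intros p Hp'. destruct (Hal p Hp') as (D1 & D2 & D3 & D4). split.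
      + apply is_derive_ext with (fun q => 4 * (q * al2 q + 1 * al1 q)); [intros z; now rewrite
          Rmult_1_l|].
        replace (2 * al2 p) with ((1 + 1) * al2 p) by ring. now apply Hstep.
      + replace 3 with (2 + 1) by ring. now apply Hstep.
    - intros p Hp'. destruct (Hbe p Hp') as (D1 & D2 & D3 & D4). split.
      + replace 3 with (2 + 1) by ring. now apply Hstep.
      + replace (4 * (p * be4 p + 4 * be3 p)) with (4 * (p * be4 p + (3 + 1) * be3 p)) by ring.
        now apply Hstep.
    - intros p Hp'. destruct (Hga p Hp') as (D1 & D2 & D3 & D4). split.
      + replace 3 with (2 + 1) by ring. now apply Hstep.
      + replace (4 * (p * ga4 p + 4 * ga3 p)) with (4 * (p * ga4 p + (3 + 1) * ga3 p)) by ring.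
        now apply Hstep. }
  assert (Hr12 : 0 <= r1 ^ 2) by nra.
  destruct (radial_ode (r1 ^ 2) (r2 ^ 2) al al1 al2 al3 al4 Hr12 Hal) as (A1 & A2 & A3 & A4 & HA).
  { intros q Hq. apply (HZ q Hq). }
  destruct (dipole_ode (r1 ^ 2) (r2 ^ 2) be be1 be2 be3 be4 Hr12 Hbe) as (B1 & B2 & B3 & B4 & HB).
  { intros q Hq. apply (HZ q Hq). }
  destruct (dipole_ode (r1 ^ 2) (r2 ^ 2) ga ga1 ga2 ga3 ga4 Hr12 Hga) as (C1 & C2 & C3 & C4 & HC).
  { intros q Hq. apply (HZ q Hq). }
  exists A1, B1, C1, A2, C2, B2, C3, B3, A3, B4, C4, A4.
  intros x y Hxy. rewrite (HFf x y Hxy). unfold radial_form, normal_form.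
  specialize (HVq x y Hxy). rewrite HA, HB, HC by auto. field. lra.
Qed.

Lemma line_analytic_normal_form (U : plane -> Prop) a1 a2 a2' a3 b1 b2 c1 c2 s0 s1 s2 s3 :
  open U -> (forall x y, U (x, y) -> (x, y) <> (0, 0)) ->
  line_analytic U (normal_form a1 a2 a2' a3 b1 b2 c1 c2 s0 s1 s2 s3).
Proof.
  intros HU H0.
  assert (Hq : forall x y, U (x, y) -> 0 < x ^ 2 + y ^ 2)
    by (intros x y Hxy; now apply sqnorm_pos, H0).
  assert (AX := line_analytic_fst U). assert (AY := line_analytic_snd U).
  assert (AC := line_analytic_const U).
  assert (CX := C1_mult HU (C1_fst U) (C1_sqnorm_inv U HU H0)).
  assert (CY := C1_mult HU (C1_snd U) (C1_sqnorm_inv U HU H0)).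
  (* x / q and - y / q are the real and imaginary parts of 1 / z *)
  assert (HCR : CR U (fun x y => x * / (x ^ 2 + y ^ 2)) (fun x y => -1 * (y * / (x ^ 2 + y ^ 2)))
    (fun x y => 1 * / (x ^ 2 + y ^ 2) + x * (-2 * x * (/ (x ^ 2 + y ^ 2) * / (x ^ 2 + y ^ 2))))
    (fun x y => 0 * / (x ^ 2 + y ^ 2) + x * (-2 * y * (/ (x ^ 2 + y ^ 2) * / (x ^ 2 + y ^ 2))))).
  { split; auto. generalize (C1_scal (-1) HU CY).
    apply C1_ext; auto; intros x y Hxy; specialize (Hq x y Hxy); simpl; field; lra. }
  destruct (CR_line_analytic HU HCR) as [ADx ADy].
  assert (Aq : line_analytic U (fun x y => x ^ 2 + y ^ 2)).
  { generalize (line_analytic_plus (line_analytic_mult AX AX) (line_analytic_mult AY AY)).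
    apply line_analytic_ext; auto. intros x y _. ring. }
  assert (Aln : line_analytic U (fun x y => ln (x ^ 2 + y ^ 2))).
  { apply line_analytic_C1 with (fun x y => 2 * (x * / (x ^ 2 + y ^ 2)))
      (fun x y => -2 * (-1 * (y * / (x ^ 2 + y ^ 2)))); auto.
    - intros x y Hxy. specialize (Hq x y Hxy). split; [|split; [|split]].
      + auto_derive; [lra|]. field. lra.
      + auto_derive; [lra|]. field. lra.
      + exact (C1_continuous _ _ _ _ x y HU (C1_scal 2 HU CX) Hxy).
      + exact (C1_continuous _ _ _ _ x y HU (C1_scal (-2) HU (C1_scal (-1) HU CY)) Hxy).
    - now apply (line_analytic_mult (AC 2)).
    - now apply (line_analytic_mult (AC (-2))). }
  assert (Alin : forall u v w, line_analytic U (fun x y => u * x + v * y + w)).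
  { intros u v w. apply (@line_analytic_plus U (fun x y => u * x + v * y)); auto.
    apply line_analytic_plus; now apply line_analytic_mult. }
  assert (T1 := line_analytic_mult (line_analytic_plus
    (line_analytic_mult (AC a1) Aq) (Alin a2 a2' a3)) Aln).
  assert (T2 := line_analytic_plus (line_analytic_mult (AC (- b1)) ADy)
    (line_analytic_mult (AC b2) ADx)).
  assert (T3 := line_analytic_mult (Alin c2 c1 s0) Aq).
  assert (T := line_analytic_plus (line_analytic_plus T1 T2)
    (line_analytic_plus T3 (Alin s1 s2 s3))).
  revert T. apply line_analytic_ext; auto.
  intros x y Hxy. specialize (Hq x y Hxy). unfold normal_form. field. lra.
Qed.

(** Uncountably many members share countably many rational sectors, so infinitely many cross
    one of them.  Members with the same radius there have the same affine function and
    coincide, so infinitely many radii occur.  Unique continuation spreads the formula. *)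
Lemma concentric_family_normal_form (U : plane -> Prop) (F : R -> R -> R) (t0 t1 : R)
    (D : R -> R -> R -> R -> R -> Prop) :
  region U -> ~ U (0, 0) -> biharmonic_on U F -> t0 < t1 ->
  (forall t, t0 <= t <= t1 -> exists r w u v, D t r w u v) ->
  (forall t r w u v, D t r w u v -> arc_datum U F r w u v) ->
  (forall s t r w u v, D s r w u v -> D t r w u v -> s = t) ->
  has_normal_form U F.
Proof.
  intros (HU & Hcon & _) HU0 HF Ht Hex Harc Hinj.
  set (T := fun n t => exists r w u v, D t r w u v /\
    let '(N, m) := Cantor.of_nat n in let '(a1, m) := Cantor.of_nat m in
    let '(a2, b) := Cantor.of_nat m in rational_sector U F N a1 a2 b r w u v).
  destruct (infinite_piece_of_countable_cover T t0 t1 Ht) as [n Hn].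
  { intros t Htt. destruct (Hex t Htt) as (r & w & u & v & HD).
    destruct (arc_datum_in_rational_sector U F r w u v (Harc _ _ _ _ _ HD))
      as (N & a1 & a2 & b & Hs).
    exists (Cantor.to_nat (N, Cantor.to_nat (a1, Cantor.to_nat (a2, b)))), r, w, u, v.
    split; auto. now rewrite !Cantor.cancel_of_to. }
  unfold T in Hn. destruct (Cantor.of_nat n) as [N m]. destruct (Cantor.of_nat m) as [a1 m'].
  destruct (Cantor.of_nat m') as [a2 b]. clear T n m m'.
  unfold rational_sector in Hn.
  revert Hn. generalize (INR a1 / INR N - 1) (INR a2 / INR N - 1) (2 / INR N)
    (INR b / INR N) (INR (S b) / INR N). intros c1 c2 d r1 r2 Hn.
  destruct (Hn nil) as (t & _ & (r & w & u & v & _ & Hr1 & Hr2 & Hne & HUs & _) & _).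
  assert (Hinf : forall l, exists r w u v, r1 <= r <= r2 /\ ~ In r l /\
     forall e1 e2, unit_arc c1 c2 d e1 e2 ->
       F (r * e1) (r * e2) = w + u * (r * e1) + v * (r * e2)).
  { intros l.
    assert (HL : exists L, forall t r w u v, D t r w u v ->
      affine_in_sector U F c1 c2 d r1 r2 r w u v -> In r l -> In t L).
    { clear - Hinj Hne. induction l as [|r0 l [L IH]].
      - exists nil. intros t r w u v _ _ [].
      - destruct (classic (exists s w u v, D s r0 w u v /\
          affine_in_sector U F c1 c2 d r1 r2 r0 w u v)) as [(s & w0 & u0 & v0 & HDs & Hs)|N].
        + exists (s :: L). intros t r w u v HDt Hts [->|Hin]; [left|right; eauto].
          apply (Hinj s t r w u v); auto.
          destruct Hs as (Hr1 & _ & _ & _ & Hr & Hs). destruct Hts as (_ & _ & _ & _ & _ & Hts).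
          destruct (affine_zero_on_arc c1 c2 d r (w0 - w) (u0 - u) (v0 - v)) as (E1 & E2 & E3).
          * lra.
          * exact Hne.
          * intros e1 e2 He. generalize (Hs e1 e2 He) (Hts e1 e2 He). lra.
          * replace w with w0 by lra. replace u with u0 by lra. now replace v with v0 by lra.
        + exists L. intros t r w u v HDt Hts [->|Hin]; [|eauto].
          exfalso. apply N. exists t, w, u, v. auto. }
    destruct HL as [L HL].
    destruct (Hn L) as (s & _ & (rs & ws & us & vs & HDs & Hs) & Hin).
    exists rs, ws, us, vs. split; [apply Hs|]. split; [|apply Hs].
    intros C. apply Hin. eapply HL; eauto. }
  destruct (biharmonic_in_sector U F c1 c2 d r1 r2 HU HF Hr1 Hr2 Hne HUs Hinf)
    as (A1 & A2 & A2' & A3 & B1 & B2 & C1 & C2 & S0 & S1 & S2 & S3 & E).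
  exists A1, A2, A2', A3, B1, B2, C1, C2, S0, S1, S2, S3.
  destruct Hne as (e1 & e2 & He).
  set (s := (r1 + r2) / 2).
  destruct (polar_in_sector c1 c2 d r1 r2 s e1 e2 Hr1) as [_ Hin]; [unfold s; lra|auto|].
  intros x y Hxy. apply Rminus_diag_uniq.
  apply (unique_continuation U (fun x y => F x y -
    normal_form A1 A2 A2' A3 B1 B2 C1 C2 S0 S1 S2 S3 x y) (s * e1) (s * e2)); auto.
  - apply line_analytic_minus; [now apply biharmonic_line_analytic|].
    apply line_analytic_normal_form; auto. intros p q Hpq E0. now rewrite E0 in Hpq.
  - apply HUs; auto. unfold s. lra.
  - generalize (open_sector c1 c2 d r1 r2 _ Hin). apply filter_imp.
    intros [p q] Hpq. simpl. rewrite (E p q Hpq). ring.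
Qed.

(** * Elementary i-M-transformations *)

Definition ext_sphere_eqn (a b c d : R) (P : ext_space) : Prop :=
  match P with
  | inl p => im_sphere_eqn a b c d p
  | inr i => i = a
  end.

Lemma im_transformation_of_inverse (f g : ext_space -> ext_space) :
  (forall P, g (f P) = P) -> (forall P, f (g P) = P) ->
  (forall a b c d, exists a' b' c' d', forall P,
     ext_sphere_eqn a b c d (f P) <-> ext_sphere_eqn a' b' c' d' P) ->
  (forall a b c d, exists a' b' c' d', forall P,
     ext_sphere_eqn a b c d (g P) <-> ext_sphere_eqn a' b' c' d' P) ->
  im_transformation f.
Proof.
  intros Hgf Hfg Hf Hg. split; [|split].
  - intros P Q E. rewrite <- (Hgf P), <- (Hgf Q). now f_equal.
  - intros Q. exists (g Q). apply Hfg.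
  - intros S. split; intros (a & b & c & d & HS).
    + destruct (Hg a b c d) as (a' & b' & c' & d' & H). exists a', b', c', d'.
      intros Q. transitivity (ext_sphere_eqn a b c d (g Q)); [|exact (H Q)]. split.
      * intros (P & HP & <-). rewrite Hgf. exact (proj1 (HS P) HP).
      * intros HQ. exists (g Q). split; [exact (proj2 (HS (g Q)) HQ)|apply Hfg].
    + destruct (Hf a b c d) as (a' & b' & c' & d' & H). exists a', b', c', d'.
      intros P. transitivity (ext_sphere_eqn a b c d (f P)); [|exact (H P)]. split.
      * intros HP. apply (HS (f P)). exists P; auto.
      * intros HP. apply (HS (f P)) in HP. destruct HP as (P' & HP' & E).
        rewrite <- (Hgf P), <- E, Hgf. exact HP'.
Qed.

Lemma im_transformation_comp (f g : ext_space -> ext_space) :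
  im_transformation f -> im_transformation g -> im_transformation (fun P => g (f P)).
Proof.
  intros (If & Sf & Ef) (Ig & Sg & Eg). split; [|split].
  - intros P Q E. now apply If, Ig.
  - intros Q. destruct (Sg Q) as [Q' <-]. destruct (Sf Q') as [P <-]. now exists P.
  - intros S. rewrite Ef, Eg.
    assert (E : same_set (image g (image f S)) (image (fun P => g (f P)) S)).
    { intros Q. split.
      - intros (P' & (P & HP & <-) & <-). exists P; auto.
      - intros (P & HP & <-). exists (f P). split; auto. exists P; auto. }
    split; intros (a & b & c & d & H); exists a, b, c, d; intros Q; rewrite <- (H Q);
      now rewrite (E Q).
Qed.

Lemma im_equivalent_trans (S T W : space -> Prop) :
  im_equivalent S T -> im_equivalent T W -> im_equivalent S W.
Proof.
  intros (f & Hf & Ef) (g & Hg & Eg). exists (fun P => g (f P)).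
  split; [now apply im_transformation_comp|]. intros Q. rewrite (Eg Q). split.
  - intros (P & HP & <-). apply Ef in HP. destruct HP as (P' & HP' & <-). exists P'; auto.
  - intros (P & HP & <-). exists (f P). split; auto. apply Ef. exists P; auto.
Qed.

Lemma im_equivalent_same_set (S S' T : space -> Prop) :
  same_set S S' -> im_equivalent S' T -> im_equivalent S T.
Proof.
  intros E (f & Hf & Ef). exists f. split; auto. intros Q. rewrite (Ef Q).
  split; intros (P & (p & Hp & <-) & <-); exists (inl p); split; auto;
    exists p; split; auto; now apply E.
Qed.

Lemma im_equivalent_graphs (f : ext_space -> ext_space) (T : plane -> plane)
    (U V : plane -> Prop) (F F' : R -> R -> R) :
  im_transformation f ->
  (forall q, V q <-> exists p, U p /\ T p = q) ->
  (forall p, U p -> f (inl (p, F (fst p) (snd p))) =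
     inl (T p, F' (fst (T p)) (snd (T p)))) ->
  im_equivalent (graph_over U F) (graph_over V F').
Proof.
  intros Hf HV Hmap. exists f. split; auto. intros Q. split.
  - intros ([[x y] z] & [Hq ->] & <-). apply HV in Hq. destruct Hq as (p & Hp & E).
    exists (inl (p, F (fst p) (snd p))). split.
    + exists (p, F (fst p) (snd p)). split; auto. destruct p. now split.
    + rewrite Hmap by auto. now rewrite E.
  - intros (P & ([[x y] z] & [Hp ->] & <-) & <-).
    exists (T (x, y), F' (fst (T (x, y))) (snd (T (x, y)))).
    split; [|symmetry; exact (Hmap (x, y) Hp)].
    assert (HT : V (T (x, y))) by (apply HV; eauto).
    destruct (T (x, y)) as [u v]. now split.
Qed.

Lemma finite_point_eq (x y z x' y' z' : R) : x = x' -> y = y' -> z = z' ->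
  (inl ((x, y), z) : ext_space) = inl ((x', y'), z').
Proof. now intros -> -> ->. Qed.

Lemma ideal_point_eq (i i' : R) : i = i' -> (inr i : ext_space) = inr i'.
Proof. now intros ->. Qed.

Definition ext_translation (v1 v2 : R) (P : ext_space) : ext_space :=
  match P with
  | inl ((x, y), z) => inl ((x + v1, y + v2), z)
  | inr i => inr i
  end.

Lemma ext_translation_sphere (v1 v2 a b c d : R) : exists a' b' c' d', forall P,
  ext_sphere_eqn a b c d (ext_translation v1 v2 P) <-> ext_sphere_eqn a' b' c' d' P.
Proof.
  exists a, (b + a * v1), (c + a * v2), (a / 2 * (v1 ^ 2 + v2 ^ 2) + b * v1 + c * v2 + d).
  intros [[[x y] z]|i]; simpl; [|tauto]. split; intros ->; field.
Qed.

Lemma im_transformation_translation (v1 v2 : R) : im_transformation (ext_translation v1 v2).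
Proof.
  apply im_transformation_of_inverse with (ext_translation (- v1) (- v2)).
  - intros [[[x y] z]|i]; simpl; auto. apply finite_point_eq; ring.
  - intros [[[x y] z]|i]; simpl; auto. apply finite_point_eq; ring.
  - intros. apply ext_translation_sphere.
  - intros. apply ext_translation_sphere.
Qed.

Definition ext_rotation (c s : R) (P : ext_space) : ext_space :=
  match P with
  | inl ((x, y), z) => inl ((c * x + s * y, - s * x + c * y), z)
  | inr i => inr i
  end.

Lemma im_transformation_rotation (c s : R) :
  c ^ 2 + s ^ 2 = 1 -> im_transformation (ext_rotation c s).
Proof.
  intros Hcs.
  assert (Hsph : forall c s, c ^ 2 + s ^ 2 = 1 -> forall a' b' c' d', exists a b k d, forall P,
    ext_sphere_eqn a' b' c' d' (ext_rotation c s P) <-> ext_sphere_eqn a b k d P).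
  { clear. intros c s Hcs a b k d. exists a, (b * c - k * s), (b * s + k * c), d.
    intros [[[x y] z]|i]; [|simpl; tauto].
    assert (E : (c * x + s * y) ^ 2 + (- s * x + c * y) ^ 2 = x ^ 2 + y ^ 2).
    { transitivity ((c ^ 2 + s ^ 2) * (x ^ 2 + y ^ 2)); [ring|rewrite Hcs; ring]. }
    unfold ext_rotation, ext_sphere_eqn, im_sphere_eqn. rewrite E.
    split; intros ->; ring. }
  assert (Hinv : forall c s, c ^ 2 + s ^ 2 = 1 -> forall P,
    ext_rotation c (- s) (ext_rotation c s P) = P).
  { clear. intros c s Hcs [[[x y] z]|i]; simpl; auto. apply finite_point_eq; auto.
    - transitivity ((c ^ 2 + s ^ 2) * x); [ring|rewrite Hcs; ring].
    - transitivity ((c ^ 2 + s ^ 2) * y); [ring|rewrite Hcs; ring]. }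
  apply im_transformation_of_inverse with (ext_rotation c (- s)).
  - now apply Hinv.
  - intros P. rewrite <- (Ropp_involutive s) at 1. apply Hinv. rewrite <- Hcs. ring.
  - now apply Hsph.
  - apply Hsph. rewrite <- Hcs. ring.
Qed.

Definition ext_add_sphere (a b c d : R) (P : ext_space) : ext_space :=
  match P with
  | inl ((x, y), z) => inl ((x, y), z + (a / 2 * (x ^ 2 + y ^ 2) + b * x + c * y + d))
  | inr i => inr (i + a)
  end.

Lemma im_transformation_add_sphere (a b c d : R) :
  im_transformation (ext_add_sphere a b c d).
Proof.
  assert (Hsph : forall a b c d a0 b0 c0 d0, exists a' b' c' d', forall P,
    ext_sphere_eqn a0 b0 c0 d0 (ext_add_sphere a b c d P) <-> ext_sphere_eqn a' b' c' d' P).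
  { clear. intros. exists (a0 - a), (b0 - b), (c0 - c), (d0 - d).
    intros [[[x y] z]|i]; simpl; split; intros E; lra. }
  apply im_transformation_of_inverse with (ext_add_sphere (- a) (- b) (- c) (- d)).
  - intros [[[x y] z]|i]; simpl; [apply finite_point_eq|apply ideal_point_eq]; field.
  - intros [[[x y] z]|i]; simpl; [apply finite_point_eq|apply ideal_point_eq]; field.
  - intros. apply Hsph.
  - intros. apply Hsph.
Qed.

(** The i-M-sphere with coefficients [a, b, c, d] becomes the one with [2 d, b, c, a / 2], so
    its point [d] over the origin must go to the ideal point [2 d]. *)
Definition ext_inversion (P : ext_space) : ext_space :=
  match P with
  | inl ((x, y), z) =>
      if excluded_middle_informative ((x, y) = (0, 0)) then inr (2 * z)
      else inl ((invx x y, invy x y), z / (x ^ 2 + y ^ 2))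
  | inr i => inl ((0, 0), i / 2)
  end.

Lemma sqnorm_inv (x y : R) : (x, y) <> (0, 0) ->
  invx x y ^ 2 + invy x y ^ 2 = / (x ^ 2 + y ^ 2).
Proof. intros H. apply sqnorm_pos in H. unfold invx, invy. field. lra. Qed.

Lemma inv_nonzero (x y : R) : (x, y) <> (0, 0) -> (invx x y, invy x y) <> (0, 0).
Proof.
  intros H E. injection E as E1 E2. assert (S := sqnorm_inv x y H).
  rewrite E1, E2 in S. apply sqnorm_pos in H. apply Rinv_0_lt_compat in H. lra.
Qed.

Lemma inv_involutive (x y : R) : (x, y) <> (0, 0) ->
  invx (invx x y) (invy x y) = x /\ invy (invx x y) (invy x y) = y.
Proof.
  intros H. unfold invx at 1, invy at 2. rewrite (sqnorm_inv x y H).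
  apply sqnorm_pos in H. unfold invx, invy. split; field; lra.
Qed.

Lemma im_transformation_inversion : im_transformation ext_inversion.
Proof.
  assert (Hinv : forall P, ext_inversion (ext_inversion P) = P).
  { intros [[[x y] z]|i]; simpl.
    - destruct (excluded_middle_informative ((x, y) = (0, 0))) as [E|N].
      + simpl. injection E as -> ->. apply finite_point_eq; auto. field.
      + simpl. destruct (excluded_middle_informative _) as [E'|_].
        { exfalso. now apply (inv_nonzero x y). }
        destruct (inv_involutive x y N) as [-> ->].
        assert (S := sqnorm_inv x y N). simpl in S. rewrite S.
        apply sqnorm_pos in N. apply finite_point_eq; auto. field. lra.
    - destruct (excluded_middle_informative _) as [_|N]; [|easy]. apply ideal_point_eq. field. }
  assert (Hsph : forall a b c d, exists a' b' c' d', forall P,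
    ext_sphere_eqn a b c d (ext_inversion P) <-> ext_sphere_eqn a' b' c' d' P).
  { intros. exists (2 * d), b, c, (a / 2). intros [[[x y] z]|i].
    - unfold ext_inversion. destruct (excluded_middle_informative ((x, y) = (0, 0))) as [E|N].
      + injection E as -> ->. simpl. split; intros E; lra.
      + unfold ext_sphere_eqn, im_sphere_eqn. rewrite sqnorm_inv by auto.
        apply sqnorm_pos in N. unfold invx, invy. split; intros E.
        * transitivity (z / (x ^ 2 + y ^ 2) * (x ^ 2 + y ^ 2)); [field; lra|].
          rewrite E. field. lra.
        * rewrite E. field. lra.
    - simpl. split; intros E; lra. }
  now apply im_transformation_of_inverse with ext_inversion.
Qed.

(** * Hyperbolic pencils *)

(** The coefficients [(A, b1, b2, c)] of an equation [A |p|^2 + b1 x + b2 y + c = 0]. *)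
Definition equation_of (g : gcircle) : R * R * R * R :=
  match g with
  | Circle c r => (1, -2 * fst c, -2 * snd c, fst c ^ 2 + snd c ^ 2 - r ^ 2)
  | Line q n => (0, fst n, snd n, - (fst q * fst n + snd q * snd n))
  end.

Definition satisfies (e : R * R * R * R) (x y : R) : Prop :=
  let '(A, b1, b2, c) := e in A * (x ^ 2 + y ^ 2) + b1 * x + b2 * y + c = 0.

(** The Lorentzian form on equations of circles, for which orthogonality is perpendicularity. *)
Definition pairing (e f : R * R * R * R) : R :=
  let '(A, b1, b2, c) := e in let '(A', b1', b2', c') := f in
  b1 * b1' + b2 * b2' - 2 * A * c' - 2 * A' * c.

Lemma on_equation (g : gcircle) (x y : R) : on g (x, y) <-> satisfies (equation_of g) x y.
Proof.
  destruct g as [[c1 c2] r|[q1 q2] [n1 n2]]; unfold on, sqnorm, dot, sub; simpl; split; intros; lra.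
Qed.

Lemma orthogonal_pairing (g h : gcircle) :
  orthogonal g h -> pairing (equation_of g) (equation_of h) = 0.
Proof.
  intros [([x y] & Hg & Hh) H]. specialize (H (x, y) Hg Hh).
  apply on_equation in Hg. apply on_equation in Hh.
  destruct g as [[c1 c2] r|[q1 q2] [n1 n2]], h as [[c1' c2'] r'|[q1' q2'] [n1' n2']];
    unfold dot, sub in H; simpl in *; nra.
Qed.

Lemma circle_third_point (c : plane) (r : R) (P Q : plane) :
  0 < r -> ~ forall p, on (Circle c r) p <-> p = P \/ p = Q.
Proof.
  intros Hr H. destruct c as [c1 c2].
  assert (H1 : on (Circle (c1, c2) r) (c1 + r, c2)) by (unfold on, sqnorm, dot, sub; simpl; ring).
  assert (H2 : on (Circle (c1, c2) r) (c1 - r, c2)) by (unfold on, sqnorm, dot, sub; simpl; ring).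
  assert (H3 : on (Circle (c1, c2) r) (c1, c2 + r)) by (unfold on, sqnorm, dot, sub; simpl; ring).
  apply H in H1. apply H in H2. apply H in H3.
  assert (Hpair : forall x y u v : R, (x, y) = (u, v) -> x = u /\ y = v)
    by (intros x y u v E; injection E; auto).
  destruct P as [p1 p2], Q as [q1 q2].
  destruct H1 as [H1|H1], H2 as [H2|H2], H3 as [H3|H3];
    apply Hpair in H1; apply Hpair in H2; apply Hpair in H3; lra.
Qed.

Lemma dist_sq_pos (p1 p2 q1 q2 : R) :
  (p1, p2) <> (q1, q2) -> 0 < (q1 - p1) ^ 2 + (q2 - p2) ^ 2.
Proof.
  intros Hne. assert (H1 := pow2_ge_0 (q1 - p1)). assert (H2 := pow2_ge_0 (q2 - p2)).
  apply Rnot_le_lt. intros C. apply Hne.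
  destruct (Rplus_sqr_eq_0 (q1 - p1) (q2 - p2)) as [E1 E2]; [unfold Rsqr; lra|].
  f_equal; lra.
Qed.

(** These equations form the span of the equation of the circle with the two points as
    antipodes and of the line through them. *)
Lemma equation_through_two_points (A b1 b2 c p1 p2 q1 q2 : R) :
  (p1, p2) <> (q1, q2) ->
  satisfies (A, b1, b2, c) p1 p2 -> satisfies (A, b1, b2, c) q1 q2 ->
  exists s, b1 = - A * (p1 + q1) - s * (q2 - p2) /\ b2 = - A * (p2 + q2) + s * (q1 - p1) /\
    c = A * (p1 * q1 + p2 * q2) + s * (q2 * p1 - q1 * p2).
Proof.
  intros Hne HP HQ. unfold satisfies in *.
  set (D := (q1 - p1) ^ 2 + (q2 - p2) ^ 2).
  assert (HD : D <> 0) by (apply Rgt_not_eq; now apply dist_sq_pos).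
  set (u1 := b1 + A * (p1 + q1)). set (u2 := b2 + A * (p2 + q2)).
  assert (Hu : u1 * (q1 - p1) + u2 * (q2 - p2) = 0) by (unfold u1, u2; nra).
  set (s := (u2 * (q1 - p1) - u1 * (q2 - p2)) / D).
  assert (E1 : u1 = - s * (q2 - p2)).
  { unfold s. apply Rmult_eq_reg_r with D; auto.
    transitivity ((u1 * (q1 - p1) + u2 * (q2 - p2)) * (q1 - p1) -
      (u2 * (q1 - p1) - u1 * (q2 - p2)) * (q2 - p2)); [unfold D; ring|].
    rewrite Hu. field. auto. }
  assert (E2 : u2 = s * (q1 - p1)).
  { unfold s. apply Rmult_eq_reg_r with D; auto.
    transitivity ((u1 * (q1 - p1) + u2 * (q2 - p2)) * (q2 - p2) +
      (u2 * (q1 - p1) - u1 * (q2 - p2)) * (q1 - p1)); [unfold D; ring|].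
    rewrite Hu. field. auto. }
  clearbody s. exists s. unfold u1 in E1. unfold u2 in E2.
  split; [lra|]. split; [lra|].
  assert (b1 = - A * (p1 + q1) - s * (q2 - p2)) by lra.
  assert (b2 = - A * (p2 + q2) + s * (q1 - p1)) by lra. subst b1 b2. nra.
Qed.

(** Orthogonality to the line puts the centre of [k] at [p + t (q - p)]; orthogonality to the
    circle on the diameter [pq] makes the squared radius [t (t - 1) |q - p|^2].  The ratio is then
    [t / (t - 1)].  A line [k] is the perpendicular bisector, with ratio 1. *)
Lemma apollonius (k : gcircle) (p1 p2 q1 q2 : R) :
  (p1, p2) <> (q1, q2) -> proper k ->
  pairing (equation_of k) (1, - (p1 + q1), - (p2 + q2), p1 * q1 + p2 * q2) = 0 ->
  pairing (equation_of k) (0, - (q2 - p2), q1 - p1, q2 * p1 - q1 * p2) = 0 ->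
  exists l, 0 < l /\ forall x y, on k (x, y) <->
    (x - p1) ^ 2 + (y - p2) ^ 2 = l * ((x - q1) ^ 2 + (y - q2) ^ 2).
Proof.
  intros Hne Hk HC HL.
  set (D := (q1 - p1) ^ 2 + (q2 - p2) ^ 2).
  assert (HD : 0 < D) by now apply dist_sq_pos.
  destruct k as [[m1 m2] r|[o1 o2] [n1 n2]]; simpl in Hk, HC, HL.
  - set (t := ((m1 - p1) * (q1 - p1) + (m2 - p2) * (q2 - p2)) / D).
    assert (Hperp : (m1 - p1) * (q2 - p2) - (m2 - p2) * (q1 - p1) = 0) by lra.
    assert (Ht : t * D = (m1 - p1) * (q1 - p1) + (m2 - p2) * (q2 - p2)) by (unfold t; field; lra).
    assert (E1 : m1 = p1 + t * (q1 - p1)).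
    { apply Rmult_eq_reg_r with D; [|lra].
      transitivity (p1 * D + t * D * (q1 - p1)); [|ring]. rewrite Ht.
      transitivity (p1 * D + ((m1 - p1) * (q1 - p1) + (m2 - p2) * (q2 - p2)) * (q1 - p1) +
        ((m1 - p1) * (q2 - p2) - (m2 - p2) * (q1 - p1)) * (q2 - p2)); [unfold D; ring|].
      rewrite Hperp. ring. }
    assert (E2 : m2 = p2 + t * (q2 - p2)).
    { apply Rmult_eq_reg_r with D; [|lra].
      transitivity (p2 * D + t * D * (q2 - p2)); [|ring]. rewrite Ht.
      transitivity (p2 * D + ((m1 - p1) * (q1 - p1) + (m2 - p2) * (q2 - p2)) * (q2 - p2) -
        ((m1 - p1) * (q2 - p2) - (m2 - p2) * (q1 - p1)) * (q1 - p1)); [unfold D; ring|].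
      rewrite Hperp. ring. }
    clearbody t. clear Ht Hperp HL. subst m1 m2.
    assert (Er : r ^ 2 = t * (t - 1) * D) by (unfold D; lra).
    assert (Htt : 0 < t * (t - 1)).
    { assert (0 < r ^ 2) by (apply pow_lt; auto). rewrite Er in H. nra. }
    assert (Ht1 : t - 1 <> 0) by (intros E; rewrite E in Htt; lra).
    assert (Hsq : 0 < (t - 1) ^ 2) by (apply pow2_gt_0; auto).
    exists (t / (t - 1)). split.
    { replace (t / (t - 1)) with (t * (t - 1) / (t - 1) ^ 2) by (field; auto).
      now apply Rdiv_lt_0_compat. }
    intros x y. unfold on, sqnorm, dot, sub; simpl fst; simpl snd. rewrite Er.
    assert (Eq : (x - p1) ^ 2 + (y - p2) ^ 2 - t / (t - 1) * ((x - q1) ^ 2 + (y - q2) ^ 2) =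
      - ((x - (p1 + t * (q1 - p1))) * (x - (p1 + t * (q1 - p1))) +
         (y - (p2 + t * (q2 - p2))) * (y - (p2 + t * (q2 - p2))) - t * (t - 1) * D) / (t - 1)).
    { unfold D. field. auto. }
    split; intros H.
    + apply Rminus_diag_uniq. rewrite Eq, H. field. auto.
    + rewrite H, Rminus_diag in Eq by reflexivity.
      apply Rminus_diag_uniq.
      apply Rmult_eq_reg_r with (- / (t - 1)); [|apply Ropp_neq_0_compat; now apply
          Rinv_neq_0_compat].
      rewrite Rmult_0_l, Eq. field. auto.
  - set (m := (n1 * (q1 - p1) + n2 * (q2 - p2)) / D).
    assert (Hperp : n1 * (q2 - p2) - n2 * (q1 - p1) = 0) by lra.
    assert (Hm : m * D = n1 * (q1 - p1) + n2 * (q2 - p2)) by (unfold m; field; lra).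
    assert (E1 : n1 = m * (q1 - p1)).
    { apply Rmult_eq_reg_r with D; [|lra].
      transitivity (m * D * (q1 - p1)); [|ring]. rewrite Hm.
      transitivity ((n1 * (q1 - p1) + n2 * (q2 - p2)) * (q1 - p1) +
        (n1 * (q2 - p2) - n2 * (q1 - p1)) * (q2 - p2)); [unfold D; ring|].
      rewrite Hperp. ring. }
    assert (E2 : n2 = m * (q2 - p2)).
    { apply Rmult_eq_reg_r with D; [|lra].
      transitivity (m * D * (q2 - p2)); [|ring]. rewrite Hm.
      transitivity ((n1 * (q1 - p1) + n2 * (q2 - p2)) * (q2 - p2) -
        (n1 * (q2 - p2) - n2 * (q1 - p1)) * (q1 - p1)); [unfold D; ring|].
      rewrite Hperp. ring. }
    clearbody m. clear Hm Hperp HL.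
    assert (Hm0 : m <> 0). { intros ->. apply Hk. f_equal; lra. }
    exists 1. split; [lra|]. intros x y. unfold on, dot, sub; simpl.
    assert (Eq : m * ((x - p1) ^ 2 + (y - p2) ^ 2 - ((x - q1) ^ 2 + (y - q2) ^ 2)) =
      2 * ((x - o1) * n1 + (y - o2) * n2)).
    { assert (Eo : 2 * (o1 * n1 + o2 * n2) = n1 * (p1 + q1) + n2 * (p2 + q2)) by lra.
      transitivity (2 * (x * n1 + y * n2) - 2 * (o1 * n1 + o2 * n2)); [|ring].
      rewrite Eo, E1, E2. ring. }
    split; intros H.
    + simpl in *. apply Rminus_diag_uniq. apply Rmult_eq_reg_l with m; auto. rewrite Rmult_1_l.
      simpl in Eq. rewrite Eq, H. ring.
    + rewrite Rmult_1_l in H. simpl in *. rewrite H in Eq. lra.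
Qed.

(** If the base circles cross at infinity, they are lines and the pencil is concentric.
    Otherwise their equations span the equations through [p] and [q], so that members are
    orthogonal to the line and to the circle on the diameter [pq]. *)
Lemma hyperbolic_pencil_cases (B : gcircle -> Prop) : hyperbolic_pencil B ->
  (exists p1 p2, forall k, B k -> exists r, 0 < r /\ forall x y, on k (x, y) <->
     (x - p1) ^ 2 + (y - p2) ^ 2 = r ^ 2) \/
  (exists p1 p2 q1 q2, (p1, p2) <> (q1, q2) /\ forall k, B k -> exists l, 0 < l /\
     forall x y, on k (x, y) <->
     (x - p1) ^ 2 + (y - p2) ^ 2 = l * ((x - q1) ^ 2 + (y - q2) ^ 2)).
Proof.
  intros (g & h & Hg & Hh & (P & Q & HPQ & Hcross) & HB).
  assert (HP := proj2 (Hcross P) (or_introl eq_refl)).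
  assert (HQ := proj2 (Hcross Q) (or_intror eq_refl)).
  assert (Hlines : (exists p, (P = Some p /\ Q = None) \/ (P = None /\ Q = Some p)) ->
    exists p1 p2, forall k, B k -> exists r, 0 < r /\ forall x y, on k (x, y) <->
     (x - p1) ^ 2 + (y - p2) ^ 2 = r ^ 2).
  { intros [[p1 p2] HN]. exists p1, p2.
    assert (Hinf : ext_on g None /\ ext_on h None) by (destruct HN as [[-> ->]|[-> ->]]; auto).
    assert (Hp : on g (p1, p2) /\ on h (p1, p2)) by (destruct HN as [[-> ->]|[-> ->]]; auto).
    assert (Honly : forall p, on g p -> on h p -> p = (p1, p2)).
    { intros p H1 H2. destruct (proj1 (Hcross (Some p)) (conj H1 H2)) as [E|E];
        destruct HN as [[-> ->]|[-> ->]]; congruence. }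
    destruct g as [?|[a1 a2] [n1 n2]]; [easy|]. destruct h as [?|[b1 b2] [m1 m2]]; [easy|].
    intros k Hk. apply HB in Hk. destruct Hk as (Hpk & Hkg & Hkh).
    apply orthogonal_pairing in Hkg. apply orthogonal_pairing in Hkh.
    destruct Hp as [Hp1 Hp2]. unfold on, dot, sub in Hp1, Hp2. simpl in Hp1, Hp2.
    destruct k as [[c1 c2] r|[o1 o2] [w1 w2]]; simpl in Hkg, Hkh, Hpk.
    - assert (E : (c1, c2) = (p1, p2)).
      { apply Honly; unfold on, dot, sub; simpl; lra. }
      injection E as -> ->. exists r. split; auto. intros x y.
      unfold on, sqnorm, dot, sub; simpl. split; intros; lra.
    - exfalso. apply Hpk.
      assert (E : (p1 + w1, p2 + w2) = (p1, p2)).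
      { apply Honly; unfold on, dot, sub; simpl; lra. }
      injection E as E1 E2. f_equal; lra. }
  destruct P as [[p1 p2]|], Q as [[q1 q2]|]; [|left; apply Hlines; eauto..|congruence].
  right. exists p1, p2, q1, q2.
  assert (Hne : (p1, p2) <> (q1, q2)) by congruence. split; auto.
  intros k Hk. apply HB in Hk. destruct Hk as (Hpk & Hkg & Hkh).
  apply orthogonal_pairing in Hkg. apply orthogonal_pairing in Hkh.
  destruct HP as [HPg HPh], HQ as [HQg HQh]. simpl in HPg, HPh, HQg, HQh.
  apply on_equation in HPg. apply on_equation in HPh.
  apply on_equation in HQg. apply on_equation in HQh.
  assert (Hgen : forall o, proper o ->
    satisfies (equation_of o) p1 p2 -> satisfies (equation_of o) q1 q2 ->
    pairing (equation_of k) (equation_of o) = 0 ->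
    exists A s, (A = 1 /\ (exists c r, o = Circle c r) \/
                 A = 0 /\ s <> 0 /\ (exists a n, o = Line a n)) /\
      equation_of o = (A, - A * (p1 + q1) - s * (q2 - p2), - A * (p2 + q2) + s * (q1 - p1),
        A * (p1 * q1 + p2 * q2) + s * (q2 * p1 - q1 * p2)) /\
      A * pairing (equation_of k) (1, - (p1 + q1), - (p2 + q2), p1 * q1 + p2 * q2) +
      s * pairing (equation_of k) (0, - (q2 - p2), q1 - p1, q2 * p1 - q1 * p2) = 0).
  { intros o Ho H1 H2 H3.
    destruct (equation_of o) as [[[A b1] b2] c] eqn:E.
    destruct (equation_through_two_points A b1 b2 c p1 p2 q1 q2 Hne H1 H2) as (s & -> & -> & ->).
    exists A, s. split; [|split; auto].
    - destruct o as [c' r|a n]; simpl in E; injection E as EA E1 E2 E3.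
      + left. eauto.
      + right. split; auto. split; [|eauto]. intros ->. subst A. apply Ho.
        destruct n as [n1 n2]. simpl in *. f_equal; lra.
    - etransitivity; [|exact H3].
      destruct (equation_of k) as [[[A' b1'] b2'] c']. simpl. ring. }
  destruct (Hgen g Hg HPg HQg Hkg) as (A & s & HA & Eg & Rg).
  destruct (Hgen h Hh HPh HQh Hkh) as (A' & s' & HA' & Eh & Rh).
  assert (Hdet : A * s' - A' * s <> 0).
  { destruct HA as [(-> & c & r & Hgc)|(-> & Hs & a & n & Hgl)],
      HA' as [(-> & c' & r' & Hhc)|(-> & Hs' & a' & n' & Hhl)].
    - intros Es. assert (s' = s) by lra. subst s'.
      apply (circle_third_point c r (p1, p2) (q1, q2)); [now rewrite Hgc in Hg|].
      rewrite <- Hgc. intros [x y].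
      assert (Egh : on g (x, y) <-> on h (x, y)) by (rewrite !on_equation, Eg, Eh; tauto).
      split.
      + intros Hxy. destruct (proj1 (Hcross (Some (x, y)))) as [E|E]; simpl; try tauto;
          injection E; intros; subst; auto.
      + intros Hxy. assert (Hc := proj2 (Hcross (Some (x, y)))). simpl in Hc. apply Hc.
        destruct Hxy as [->| ->]; auto.
    - lra.
    - lra.
    - exfalso. subst g h. destruct (proj1 (Hcross None)) as [E|E]; simpl; auto; discriminate. }
  assert (HC : pairing (equation_of k) (1, - (p1 + q1), - (p2 + q2), p1 * q1 + p2 * q2) = 0).
  { apply Rmult_eq_reg_l with (A * s' - A' * s); auto. rewrite Rmult_0_r.
    revert Rg Rh. generalize (pairing (equation_of k) (1, - (p1 + q1), - (p2 + q2), p1 * q1 + p2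
        * q2))
      (pairing (equation_of k) (0, - (q2 - p2), q1 - p1, q2 * p1 - q1 * p2)).
    intros X Y Rg Rh. transitivity (s' * (A * X + s * Y) - s * (A' * X + s' * Y)); [ring|].
    rewrite Rg, Rh. ring. }
  assert (HL : pairing (equation_of k) (0, - (q2 - p2), q1 - p1, q2 * p1 - q1 * p2) = 0).
  { apply Rmult_eq_reg_l with (A * s' - A' * s); auto. rewrite Rmult_0_r.
    revert Rg Rh. generalize (pairing (equation_of k) (1, - (p1 + q1), - (p2 + q2), p1 * q1 + p2
        * q2))
      (pairing (equation_of k) (0, - (q2 - p2), q1 - p1, q2 * p1 - q1 * p2)).
    intros X Y Rg Rh. transitivity (A * (A' * X + s' * Y) - A' * (A * X + s * Y)); [ring|].
    rewrite Rg, Rh. ring. }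
  now apply apollonius.
Qed.

(** * Arcs of circles *)

Lemma path_value (f : R -> R) (a b y : R) :
  a < b -> (forall s, a <= s <= b -> continuity_pt f s) ->
  (f a < y < f b \/ f b < y < f a) -> exists s, a <= s <= b /\ f s = y.
Proof.
  intros Hab Hf [Hy|Hy].
  - destruct (IVT_interv (fun s => f s - y) a b) as [s [Hs E]]; auto; try lra.
    + intros s Hs. apply continuity_pt_minus; [now apply Hf|].
      apply continuity_pt_const. intros ? ?; reflexivity.
    + exists s. split; auto. lra.
  - destruct (IVT_interv (fun s => y - f s) a b) as [s [Hs E]]; auto; try lra.
    + intros s Hs. apply continuity_pt_minus; [|now apply Hf].
      apply continuity_pt_const. intros ? ?; reflexivity.
    + exists s. split; auto. lra.
Qed.

(** An injective path on a circle has a value off the horizontal diameter.  Near it the first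
    coordinate is injective, so by the intermediate value theorem the path runs over all
    points of the circle near some point. *)
Lemma path_on_circle_covers_arc (X Y : R -> R) (r : R) :
  0 < r -> (forall s, 0 <= s <= 1 -> continuity_pt X s /\ continuity_pt Y s) ->
  (forall s t, 0 <= s <= 1 -> 0 <= t <= 1 -> X s = X t -> Y s = Y t -> s = t) ->
  (forall s, 0 <= s <= 1 -> X s ^ 2 + Y s ^ 2 = r ^ 2) ->
  exists s0 d, 0 <= s0 <= 1 /\ 0 < d /\
    forall x y, Rabs (x - X s0) < d -> Rabs (y - Y s0) < d -> x ^ 2 + y ^ 2 = r ^ 2 ->
      exists s, 0 <= s <= 1 /\ x = X s /\ y = Y s.
Proof.
  intros Hr Hc Hinj Hon.
  assert (Hy0 : exists c, 0 < c < 1 /\ Y c <> 0).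
  { apply NNPP. intros N.
    assert (Hz : forall c, 0 < c < 1 -> Y c = 0 /\ (X c = r \/ X c = - r)).
    { intros c Hc'. assert (E : Y c = 0) by (apply NNPP; intros C; apply N; eauto).
      split; auto. assert (H := Hon c ltac:(lra)). rewrite E in H.
      assert (H' : (X c - r) * (X c + r) = 0) by nra.
      apply Rmult_integral in H'. destruct H'; [left|right]; lra. }
    destruct (Hz (1/4)) as [Y1 X1]; [lra|]. destruct (Hz (1/2)) as [Y2 X2]; [lra|].
    destruct (Hz (3/4)) as [Y3 X3]; [lra|].
    assert (D12 : X (1/4) <> X (1/2)).
    { intros E. assert (1/4 = 1/2) by (apply Hinj; try lra; congruence). lra. }
    assert (D13 : X (1/4) <> X (3/4)).
    { intros E. assert (1/4 = 3/4) by (apply Hinj; try lra; congruence). lra. }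
    assert (D23 : X (1/2) <> X (3/4)).
    { intros E. assert (1/2 = 3/4) by (apply Hinj; try lra; congruence). lra. }
    destruct X1 as [X1|X1], X2 as [X2|X2], X3 as [X3|X3]; congruence. }
  destruct Hy0 as (c & Hc1 & Hyc).
  assert (Hnear : locally c (fun s => 0 < Y s * Y c)).
  { destruct (Hc c) as [_ HYc]; [lra|]. apply continuity_pt_filterlim in HYc.
    apply (HYc (fun z => 0 < z * Y c)). apply locally_R_iff.
    exists (Rabs (Y c)). split; [now apply Rabs_pos_lt|]. intros z Hz.
    unfold Rabs in Hz. destruct (Rcase_abs (Y c)), (Rcase_abs (z - Y c)); nra. }
  apply locally_R_iff in Hnear. destruct Hnear as (e & He & Hnear).
  set (h := Rmin (e / 2) (Rmin (c / 2) ((1 - c) / 2))).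
  assert (Hh : 0 < h) by (repeat apply Rmin_pos; lra).
  assert (Hh1 : h <= e / 2) by apply Rmin_l.
  assert (Hh2 : h <= Rmin (c / 2) ((1 - c) / 2)) by apply Rmin_r.
  assert (Hh3 := Rmin_l (c / 2) ((1 - c) / 2)). assert (Hh4 := Rmin_r (c / 2) ((1 - c) / 2)).
  set (a := c - h). set (b := c + h).
  assert (Hab : forall s, a <= s <= b -> 0 <= s <= 1 /\ 0 < Y s * Y c).
  { intros s Hs. unfold a, b in Hs. split; [lra|]. apply Hnear. apply Rabs_def1; lra. }
  (* on this part of the path, the second coordinate follows from the first *)
  assert (Hdet : forall x y s, a <= s <= b -> x ^ 2 + y ^ 2 = r ^ 2 -> 0 < y * Y c ->
    X s = x -> y = Y s).
  { intros x y s Hs Hxy Hy E. destruct (Hab s Hs) as [H1 H2]. assert (H3 := Hon s H1).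
    rewrite E in H3. assert (H4 : (y - Y s) * (y + Y s) = 0) by nra.
    apply Rmult_integral in H4. destruct H4 as [H4|H4]; [lra|].
    exfalso. assert (y = - Y s) by lra. subst y. nra. }
  assert (Hlt : a < b) by (unfold a, b; lra).
  assert (Hx : X a <> X b).
  { intros E. assert (Ha := Hab a ltac:(lra)). assert (Hb := Hab b ltac:(lra)).
    assert (a = b); [|lra]. apply Hinj; try tauto.
    apply (Hdet (X b) (Y a) b); try tauto; try lra. rewrite <- E. now apply Hon. }
  assert (HXc : forall s, a <= s <= b -> continuity_pt X s).
  { intros s Hs. apply Hc. now apply Hab. }
  destruct (path_value X a b ((X a + X b) / 2) Hlt HXc) as (s0 & Hs0 & E0); [lra|].
  destruct (Hab s0 Hs0) as [Hs0' HY0].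
  assert (HYne : Y s0 <> 0) by (intros E; rewrite E in HY0; lra).
  exists s0, (Rmin (Rabs (X b - X a) / 2) (Rabs (Y s0))).
  assert (HXab : 0 < Rabs (X b - X a)) by (apply Rabs_pos_lt; lra).
  split; auto. split; [apply Rmin_pos; [lra|now apply Rabs_pos_lt]|].
  intros x y Hxd Hyd Hxy.
  assert (M1 := Rmin_l (Rabs (X b - X a) / 2) (Rabs (Y s0))).
  assert (M2 := Rmin_r (Rabs (X b - X a) / 2) (Rabs (Y s0))).
  destruct (path_value X a b x Hlt HXc) as (s & Hs & E).
  { rewrite E0 in Hxd. assert (Hxd' : Rabs (x - (X a + X b) / 2) < Rabs (X b - X a) / 2) by lra.
    unfold Rabs in Hxd'. destruct (Rcase_abs (X b - X a)), (Rcase_abs (x - (X a + X b) / 2)); lra. }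
  exists s. split; [now apply Hab|]. split; auto.
  apply (Hdet x y s); auto.
  assert (Hyd' : Rabs (y - Y s0) < Rabs (Y s0)) by lra.
  assert (Hyy : 0 < y * Y s0).
  { unfold Rabs in Hyd'. destruct (Rcase_abs (Y s0)), (Rcase_abs (y - Y s0)); nra. }
  assert (Hprod : 0 < (y * Y c) * (Y s0 ^ 2)).
  { replace ((y * Y c) * Y s0 ^ 2) with ((y * Y s0) * (Y s0 * Y c)) by ring.
    now apply Rmult_lt_0_compat. }
  assert (0 < Y s0 ^ 2) by now apply pow2_gt_0. nra.
Qed.

Lemma path_arc_datum (U : plane -> Prop) (F : R -> R -> R) (X Y : R -> R) (r w u v : R) :
  open U -> 0 < r -> (forall s, 0 <= s <= 1 -> continuity_pt X s /\ continuity_pt Y s) ->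
  (forall s t, 0 <= s <= 1 -> 0 <= t <= 1 -> X s = X t -> Y s = Y t -> s = t) ->
  (forall s, 0 <= s <= 1 -> X s ^ 2 + Y s ^ 2 = r ^ 2 /\ U (X s, Y s) /\
     F (X s) (Y s) = w + u * X s + v * Y s) ->
  arc_datum U F r w u v.
Proof.
  intros HU Hr Hc Hinj H.
  destruct (path_on_circle_covers_arc X Y r Hr Hc Hinj) as (s0 & d & Hs0 & Hd & Hcov).
  { intros s Hs. now apply H. }
  destruct (H s0 Hs0) as (E0 & HU0 & _).
  destruct (open_pair U _ _ HU HU0) as (d' & Hd' & Hball).
  assert (E1 : r * (X s0 / r) = X s0) by (field; lra).
  assert (E2 : r * (Y s0 / r) = Y s0) by (field; lra).
  split; auto. exists (X s0 / r), (Y s0 / r), (Rmin d d'). rewrite E1, E2.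
  split.
  { unfold Rdiv. rewrite !Rpow_mult_distr, <- Rmult_plus_distr_r, E0.
    rewrite <- Rpow_mult_distr, Rinv_r by lra. ring. }
  split; [now apply Rmin_pos|]. intros x y Hx Hy.
  assert (M1 := Rmin_l d d'). assert (M2 := Rmin_r d d').
  split; [apply Hball; lra|]. intros Hxy.
  destruct (Hcov x y) as (s & Hs & -> & ->); auto; try lra. now apply H.
Qed.

(** The map [((x, y), z) |-> ((T1, T2), m z)] is an i-M-transformation in the applications; it
    turns the i-M-circle [K] into the graph of an affine function over a circle about 0. *)
Lemma transported_arc_datum (Phi K : space -> Prop) (U V dom : plane -> Prop)
    (F G T1 T2 m : R -> R -> R) (r w u v : R) :
  (forall x y z, Phi ((x, y), z) -> U (x, y) /\ z = F x y) -> open V -> 0 < r ->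
  (forall x y, dom (x, y) -> continuity_2d_pt T1 x y /\ continuity_2d_pt T2 x y) ->
  (forall x y x' y', dom (x, y) -> dom (x', y') ->
     T1 x y = T1 x' y' -> T2 x y = T2 x' y' -> x = x' /\ y = y') ->
  (forall x y, dom (x, y) -> m x y <> 0) ->
  (forall x y z, K ((x, y), z) -> dom (x, y) /\ T1 x y ^ 2 + T2 x y ^ 2 = r ^ 2 /\
     m x y * z = w + u * T1 x y + v * T2 x y) ->
  (forall x y, U (x, y) -> dom (x, y) -> (T1 x y, T2 x y) <> (0, 0) ->
     V (T1 x y, T2 x y) /\ G (T1 x y) (T2 x y) = m x y * F x y) ->
  (exists A, arc_of A K /\ forall p, A p -> Phi p) ->
  arc_datum V G r w u v.
Proof.
  intros HPhi HV Hr HT Hinj Hm HK HG (A & (g & Hgc & Hginj & HA & HAK) & HAPhi).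
  set (x := fun s => fst (fst (g s))). set (y := fun s => snd (fst (g s))).
  set (z := fun s => snd (g s)).
  assert (Hg : forall s, g s = ((x s, y s), z s)).
  { intros s. unfold x, y, z. now destruct (g s) as [[? ?] ?]. }
  assert (Hin : forall s, 0 <= s <= 1 -> K ((x s, y s), z s) /\ Phi ((x s, y s), z s)).
  { intros s Hs. rewrite <- Hg. assert (A (g s)) by (apply HA; exists s; auto). auto. }
  assert (Hxc : forall s, 0 <= s <= 1 -> continuous (fun s => (x s, y s) : plane) s).
  { intros s Hs. apply (continuous_ext (fun s => fst (g s))).
    - intros t. unfold x, y. now destruct (fst (g t)).
    - apply (continuous_comp g fst); [now apply Hgc|]. destruct (g s). apply continuous_fst. }
  assert (Hcomp : forall f s, 0 <= s <= 1 -> continuity_2d_pt f (x s) (y s) ->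
    continuity_pt (fun s => f (x s) (y s)) s).
  { intros f s Hs Hf. apply continuity_pt_filterlim. apply continuity_2d_pt_filterlim in Hf.
    exact (filterlim_comp _ _ _ (fun s => (x s, y s)) (fun p => f (fst p) (snd p)) _ _ _
      (Hxc s Hs) Hf). }
  apply (path_arc_datum V G (fun s => T1 (x s) (y s)) (fun s => T2 (x s) (y s))); auto.
  - intros s Hs. destruct (Hin s Hs) as [HKs _]. apply HK in HKs. destruct HKs as (Hd & _ & _).
    destruct (HT _ _ Hd) as [C1' C2']. split; now apply Hcomp.
  - intros s t Hs Ht E1 E2. destruct (Hin s Hs) as [HKs _]. destruct (Hin t Ht) as [HKt _].
    apply HK in HKs. apply HK in HKt. destruct HKs as (Hds & _ & Es). destruct HKt as (Hdt & _ &
        Et).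
    destruct (Hinj _ _ _ _ Hds Hdt E1 E2) as [Ex Ey].
    apply Hginj; auto. rewrite (Hg s), (Hg t), Ex, Ey. f_equal.
    apply Rmult_eq_reg_l with (m (x t) (y t)); [|now apply Hm].
    rewrite Et, <- Ex, <- Ey. exact Es.
  - intros s Hs. destruct (Hin s Hs) as [HKs HPs].
    apply HK in HKs. destruct HKs as (Hd & E1 & E2). apply HPhi in HPs. destruct HPs as [HUs Ez].
    destruct (HG _ _ HUs Hd) as [HVs HGs].
    { intros E. injection E as Ea Eb. rewrite Ea, Eb in E1.
      assert (0 < r ^ 2) by now apply pow_lt. lra. }
    split; auto. split; auto. rewrite HGs, <- Ez. exact E2.
Qed.

Lemma circle_over_top_view (K : space -> Prop) (k : gcircle) :
  im_circle K -> same_set (top_view K) (on k) ->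
  exists a b c d, forall x y z, K ((x, y), z) <->
    on k (x, y) /\ z = a / 2 * (x ^ 2 + y ^ 2) + b * x + c * y + d.
Proof.
  intros (S1 & S2 & (a & b & c & d & H1) & _ & _ & HK & _) Htop.
  exists a, b, c, d. intros x y z. split.
  - intros H. split.
    + apply Htop. exists ((x, y), z); auto.
    + apply HK in H. destruct H as [H _]. now apply H1 in H.
  - intros [Hon ->]. apply Htop in Hon. destruct Hon as ([[x' y'] z'] & H & E).
    simpl in E. injection E as -> ->. assert (H' := H). apply HK in H'. destruct H' as [H' _].
    apply H1 in H'. simpl in H'. simpl. rewrite <- H'. exact H.
Qed.

(** The transformed members of the family are labelled by their radius and affine function.
    These determine the member, so distinct members have distinct labels. *)
Lemma chart_normal_form (Phi : space -> Prop) (t0 t1 : R) (K : R -> space -> Prop)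
    (U V dom : plane -> Prop) (F G T1 T2 m : R -> R -> R) :
  (forall x y z, Phi ((x, y), z) -> U (x, y) /\ z = F x y) ->
  im_circle_family t0 t1 K -> carries Phi t0 t1 K ->
  region V -> biharmonic_on V G ->
  (forall x y, dom (x, y) -> continuity_2d_pt T1 x y /\ continuity_2d_pt T2 x y) ->
  (forall x y x' y', dom (x, y) -> dom (x', y') ->
     T1 x y = T1 x' y' -> T2 x y = T2 x' y' -> x = x' /\ y = y') ->
  (forall x y, dom (x, y) -> m x y <> 0) ->
  (forall x y, U (x, y) -> dom (x, y) ->
     V (T1 x y, T2 x y) /\ G (T1 x y) (T2 x y) = m x y * F x y) ->
  (forall t, t0 <= t <= t1 -> exists r w u v, 0 < r /\
     forall x y z, K t ((x, y), z) <-> dom (x, y) /\ T1 x y ^ 2 + T2 x y ^ 2 = r ^ 2 /\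
       m x y * z = w + u * T1 x y + v * T2 x y) ->
  has_normal_form (fun p => V p /\ p <> (0, 0)) G.
Proof.
  intros HPhi (Ht & _ & Hinj) Hcar HV HG HT HTinj Hm HGF Hex.
  assert (HV0 := region_minus_point V (0, 0) HV).
  apply (concentric_family_normal_form _ G t0 t1 (fun t r w u v =>
    t0 <= t <= t1 /\ 0 < r /\
    forall x y z, K t ((x, y), z) <-> dom (x, y) /\ T1 x y ^ 2 + T2 x y ^ 2 = r ^ 2 /\
       m x y * z = w + u * T1 x y + v * T2 x y)); auto.
  - tauto.
  - intros x y [Hxy _]. now apply HG.
  - intros t Htt. destruct (Hex t Htt) as (r & w & u & v & Hr & H). exists r, w, u, v. auto.
  - intros t r w u v (Htt & Hr & HK).
    apply (transported_arc_datum Phi (K t) U _ dom F G T1 T2 m); auto.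
    + apply HV0.
    + intros x y z. apply HK.
    + intros x y HU Hd H0. destruct (HGF x y HU Hd). auto.
  - intros s t r w u v (Hs & _ & HKs) (Htt & _ & HKt). apply Hinj; auto.
    intros [[x y] z]. now rewrite HKs, HKt.
Qed.

(** * Moving the limit points to the origin and to infinity *)

Definition shift_region (v1 v2 : R) (U : plane -> Prop) : plane -> Prop :=
  fun p => U (fst p + v1, snd p + v2).
Definition shift_fun (v1 v2 : R) (F : R -> R -> R) : R -> R -> R :=
  fun x y => F (x + v1) (y + v2).
Definition inv_region (U : plane -> Prop) : plane -> Prop :=
  fun p => p <> (0, 0) /\ U (invx (fst p) (snd p), invy (fst p) (snd p)).
Definition inv_fun (F : R -> R -> R) : R -> R -> R :=
  fun x y => (x ^ 2 + y ^ 2) * F (invx x y) (invy x y).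

Lemma continuous_plane_map (f g : R -> R -> R) (p : plane) :
  continuity_2d_pt f (fst p) (snd p) -> continuity_2d_pt g (fst p) (snd p) ->
  continuous (fun p => (f (fst p) (snd p), g (fst p) (snd p)) : plane) p.
Proof.
  destruct p as [x y]; simpl. intros Hf Hg P HP.
  apply locally_pair_iff in HP. destruct HP as (d & Hd & HP). unfold filtermap.
  assert (H1 := locally_Rabs_lt_of_continuity f x y (f x y) d Hf).
  assert (H2 := locally_Rabs_lt_of_continuity g x y (g x y) d Hg).
  rewrite Rabs_self in H1, H2.
  generalize (filter_and _ _ (H1 Hd) (H2 Hd)). apply filter_imp.
  intros q [Hq1 Hq2]. now apply HP.
Qed.

Lemma open_preimage (W A : plane -> Prop) (f g : R -> R -> R) :
  open W -> open A ->
  (forall x y, W (x, y) -> continuity_2d_pt f x y /\ continuity_2d_pt g x y) ->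
  open (fun p => W p /\ A (f (fst p) (snd p), g (fst p) (snd p))).
Proof.
  intros HW HA Hc [x y] [Hp HAp]. apply filter_and; [now apply HW|].
  destruct (Hc x y Hp) as [Hf Hg].
  apply (continuous_plane_map f g (x, y) Hf Hg). now apply HA.
Qed.

Lemma continuity_2d_shift (v x y : R) :
  continuity_2d_pt (fun x _ => x + v) x y /\ continuity_2d_pt (fun _ y => y + v) x y.
Proof.
  split; apply continuity_2d_pt_plus;
    apply continuity_2d_pt_id1 || apply continuity_2d_pt_id2 || apply continuity_2d_pt_const.
Qed.

Lemma continuity_2d_inv (x y : R) : (x, y) <> (0, 0) ->
  continuity_2d_pt invx x y /\ continuity_2d_pt invy x y.
Proof.
  intros H. assert (Hi : continuity_2d_pt (fun x y => / (x ^ 2 + y ^ 2)) x y).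
  { apply continuity_2d_pt_inv; [apply continuity_2d_pt_sqnorm|].
    apply Rgt_not_eq. now apply sqnorm_pos. }
  split; apply continuity_2d_pt_mult; auto;
    apply continuity_2d_pt_id1 || apply continuity_2d_pt_id2.
Qed.

Lemma open_punctured_plane : open (fun p : plane => p <> (0, 0)).
Proof.
  assert (H := open_minus_point (fun _ => True) (0, 0) open_true).
  apply open_ext with (2 := H). intros p. tauto.
Qed.

Lemma region_shift (v1 v2 : R) (U : plane -> Prop) : region U -> region (shift_region v1 v2 U).
Proof.
  intros (HU & Hc & [[x y] Hxy]). split; [|split].
  - apply open_ext with (fun p => True /\ U (fst p + v1, snd p + v2)); [intros p; unfold
      shift_region; tauto|].
    apply (open_preimage (fun _ => True) U (fun x _ => x + v1) (fun _ y => y + v2)); auto.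
    + apply open_true.
    + intros s t _. split; apply continuity_2d_shift.
  - apply (connected_image U _ (fun p => (fst p + - v1, snd p + - v2))); auto.
    + intros p _. apply (continuous_plane_map (fun x _ => x + - v1) (fun _ y => y + - v2));
        apply continuity_2d_shift.
    + intros [s t]. unfold shift_region; simpl. split.
      * intros H. exists (s + v1, t + v2). split; auto. simpl. f_equal; ring.
      * intros ([s' t'] & H & E). simpl in E. injection E as <- <-.
        now replace (s' + - v1 + v1, t' + - v2 + v2) with (s', t') by (f_equal; ring).
  - exists (x + - v1, y + - v2). unfold shift_region; simpl.
    now replace (x + - v1 + v1, y + - v2 + v2) with (x, y) by (f_equal; ring).
Qed.

Lemma im_equivalent_shift (v1 v2 : R) (U : plane -> Prop) (F : R -> R -> R) :
  im_equivalent (graph_over U F) (graph_over (shift_region v1 v2 U) (shift_fun v1 v2 F)).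
Proof.
  apply (im_equivalent_graphs (ext_translation (- v1) (- v2))
    (fun p => (fst p + - v1, snd p + - v2))).
  - apply im_transformation_translation.
  - intros [s t]. unfold shift_region; simpl. split.
    + intros H. exists (s + v1, t + v2). split; auto. simpl. f_equal; ring.
    + intros ([s' t'] & H & E). simpl in E. injection E as <- <-.
      now replace (s' + - v1 + v1, t' + - v2 + v2) with (s', t') by (f_equal; ring).
  - intros [x y] _. unfold shift_fun. simpl. apply finite_point_eq; auto. f_equal; ring.
Qed.

Lemma region_inv (U : plane -> Prop) : region U -> region (inv_region U).
Proof.
  intros HU. destruct (region_minus_point U (0, 0) HU) as (HU0 & Hc & [[x y] [Hxy Hne]]).
  destruct HU as (HU & _ & _).
  assert (Hcont : forall s t, (s, t) <> (0, 0) ->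
    continuity_2d_pt invx s t /\ continuity_2d_pt invy s t) by apply continuity_2d_inv.
  split; [|split].
  - apply (open_preimage (fun p => p <> (0, 0)) U invx invy); auto. apply open_punctured_plane.
  - apply (connected_image (fun p => U p /\ p <> (0, 0)) _
      (fun p => (invx (fst p) (snd p), invy (fst p) (snd p)))); auto.
    + intros [s t] [_ H]. destruct (Hcont s t H). now apply continuous_plane_map.
    + intros [s t]. unfold inv_region; simpl. split.
      * intros [H1 H2]. exists (invx s t, invy s t).
        split; [split; auto; now apply inv_nonzero|]. simpl.
        destruct (inv_involutive s t H1) as [-> ->]. reflexivity.
      * intros ([s' t'] & [H1 H2] & E). simpl in E. injection E as <- <-.
        split; [now apply inv_nonzero|]. destruct (inv_involutive s' t' H2) as [-> ->]. auto.
  - exists (invx x y, invy x y). split; [now apply inv_nonzero|]. simpl.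
    destruct (inv_involutive x y Hne) as [-> ->]. auto.
Qed.

Lemma biharmonic_inv (U : plane -> Prop) (F : R -> R -> R) :
  region U -> biharmonic_on U F -> biharmonic_on (inv_region U) (inv_fun F).
Proof.
  intros HU HF. apply (biharmonic_inversion U); auto.
  - apply HU.
  - now apply region_inv.
  - intros x y [H _]. exact H.
  - intros x y [_ H]. exact H.
Qed.

Lemma im_equivalent_inv (U : plane -> Prop) (F : R -> R -> R) : ~ U (0, 0) ->
  im_equivalent (graph_over U F) (graph_over (inv_region U) (inv_fun F)).
Proof.
  intros H0.
  assert (Hne : forall x y, U (x, y) -> (x, y) <> (0, 0)) by (intros x y Hxy E; now rewrite E in
      Hxy).
  apply (im_equivalent_graphs ext_inversion
    (fun p => (invx (fst p) (snd p), invy (fst p) (snd p)))).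
  - apply im_transformation_inversion.
  - intros [s t]. unfold inv_region; simpl. split.
    + intros [H1 H2]. exists (invx s t, invy s t). split; auto. simpl.
      destruct (inv_involutive s t H1) as [-> ->]. reflexivity.
    + intros ([s' t'] & H1 & E). simpl in E. injection E as <- <-.
      assert (H2 := Hne _ _ H1). split; [now apply inv_nonzero|].
      destruct (inv_involutive s' t' H2) as [-> ->]. auto.
  - intros [x y] Hxy. assert (H := Hne x y Hxy). unfold ext_inversion, inv_fun.
    cbn [fst snd].
    destruct (excluded_middle_informative ((x, y) = (0, 0))) as [E|_]; [easy|].
    apply finite_point_eq; auto. rewrite sqnorm_inv by auto.
    destruct (inv_involutive x y H) as [-> ->].
    unfold Rdiv. ring.
Qed.

Lemma concentric_normal_form (Phi : space -> Prop) (t0 t1 : R) (K : R -> space -> Prop)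
    (U : plane -> Prop) (F : R -> R -> R) (B : gcircle -> Prop) (p1 p2 : R) :
  same_set Phi (graph_over U F) -> region U -> biharmonic_on U F ->
  im_circle_family t0 t1 K -> carries Phi t0 t1 K ->
  (forall t, t0 <= t <= t1 -> exists k, B k /\ same_set (top_view (K t)) (on k)) ->
  (forall k, B k -> exists r, 0 < r /\ forall x y, on k (x, y) <->
     (x - p1) ^ 2 + (y - p2) ^ 2 = r ^ 2) ->
  has_normal_form (fun p => shift_region p1 p2 U p /\ p <> (0, 0)) (shift_fun p1 p2 F).
Proof.
  intros HPhi HU HF HK Hcar Htop HB.
  apply (chart_normal_form Phi t0 t1 K U (shift_region p1 p2 U) (fun _ => True) F _
    (fun x _ => x + - p1) (fun _ y => y + - p2) (fun _ _ => 1)); auto.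
  - intros x y z H. apply HPhi in H. exact H.
  - now apply region_shift.
  - apply biharmonic_translation; auto. apply HU.
  - intros x y _. split; apply continuity_2d_shift.
  - intros x y x' y' _ _ H1 H2. split; lra.
  - intros x y Hxy _. unfold shift_region, shift_fun; simpl.
    replace (x + - p1 + p1) with x by ring. replace (y + - p2 + p2) with y by ring.
    split; auto. ring.
  - intros t Ht. destruct (Htop t Ht) as (k & HBk & Hk).
    destruct (HB k HBk) as (r & Hr & Hon).
    destruct (circle_over_top_view (K t) k) as (a & b & c & d & HKt); auto.
    { now apply HK. }
    exists r, (a / 2 * (r ^ 2 + p1 ^ 2 + p2 ^ 2) + b * p1 + c * p2 + d),
      (a * p1 + b), (a * p2 + c). split; auto.
    intros x y z. rewrite HKt, Hon.
    split.
    + intros [H ->]. split; auto. split; [exact H|].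
      rewrite <- H. field.
    + intros (_ & H & E). split; [exact H|].
      rewrite Rmult_1_l in E. rewrite E, <- H. field.
Qed.

(** An inversion about [q], followed by the translation that moves the image of [p] to 0. *)
Definition pencil_region (p1 p2 q1 q2 : R) (U : plane -> Prop) : plane -> Prop :=
  shift_region (invx (p1 - q1) (p2 - q2)) (invy (p1 - q1) (p2 - q2))
    (inv_region (shift_region q1 q2 U)).
Definition pencil_fun (p1 p2 q1 q2 : R) (F : R -> R -> R) : R -> R -> R :=
  shift_fun (invx (p1 - q1) (p2 - q2)) (invy (p1 - q1) (p2 - q2))
    (inv_fun (shift_fun q1 q2 F)).
Definition pencil_mapx (p1 p2 q1 q2 x y : R) : R :=
  invx (x - q1) (y - q2) - invx (p1 - q1) (p2 - q2).
Definition pencil_mapy (p1 p2 q1 q2 x y : R) : R :=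
  invy (x - q1) (y - q2) - invy (p1 - q1) (p2 - q2).

Lemma region_pencil (p1 p2 q1 q2 : R) (U : plane -> Prop) :
  region U -> region (pencil_region p1 p2 q1 q2 U).
Proof. intros HU. now apply region_shift, region_inv, region_shift. Qed.

Lemma biharmonic_pencil (p1 p2 q1 q2 : R) (U : plane -> Prop) (F : R -> R -> R) :
  region U -> biharmonic_on U F ->
  biharmonic_on (pencil_region p1 p2 q1 q2 U) (pencil_fun p1 p2 q1 q2 F).
Proof.
  intros HU HF. apply biharmonic_translation; [now apply region_inv, region_shift|].
  apply biharmonic_inv; [now apply region_shift|].
  apply biharmonic_translation; auto. apply HU.
Qed.

Lemma im_equivalent_pencil (p1 p2 q1 q2 : R) (U : plane -> Prop) (F : R -> R -> R) :
  ~ U (q1, q2) -> im_equivalent (graph_over U F)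
    (graph_over (pencil_region p1 p2 q1 q2 U) (pencil_fun p1 p2 q1 q2 F)).
Proof.
  intros Hq. eapply im_equivalent_trans; [apply (im_equivalent_shift q1 q2)|].
  eapply im_equivalent_trans; [apply im_equivalent_inv|apply im_equivalent_shift].
  unfold shift_region; simpl. now rewrite !Rplus_0_l.
Qed.

Lemma minus_nonzero (x y q1 q2 : R) : (x, y) <> (q1, q2) -> (x - q1, y - q2) <> (0, 0).
Proof. intros H E. apply H. injection E as E1 E2. f_equal; lra. Qed.

Lemma pencil_map_value (p1 p2 q1 q2 x y : R) (U : plane -> Prop) (F : R -> R -> R) :
  (x, y) <> (q1, q2) ->
  (pencil_region p1 p2 q1 q2 U (pencil_mapx p1 p2 q1 q2 x y, pencil_mapy p1 p2 q1 q2 x y)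
     <-> U (x, y)) /\
  pencil_fun p1 p2 q1 q2 F (pencil_mapx p1 p2 q1 q2 x y) (pencil_mapy p1 p2 q1 q2 x y) =
    / ((x - q1) ^ 2 + (y - q2) ^ 2) * F x y.
Proof.
  intros H. apply minus_nonzero in H.
  unfold pencil_region, pencil_fun, pencil_mapx, pencil_mapy, shift_region, shift_fun,
    inv_region, inv_fun; cbn [fst snd].
  set (k1 := invx (p1 - q1) (p2 - q2)). set (k2 := invy (p1 - q1) (p2 - q2)).
  replace (invx (x - q1) (y - q2) - k1 + k1) with (invx (x - q1) (y - q2)) by ring.
  replace (invy (x - q1) (y - q2) - k2 + k2) with (invy (x - q1) (y - q2)) by ring.
  rewrite sqnorm_inv by auto. destruct (inv_involutive _ _ H) as [-> ->].
  replace (x - q1 + q1) with x by ring. replace (y - q2 + q2) with y by ring.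
  split; auto. split; [tauto|]. intros HU. split; auto. now apply inv_nonzero.
Qed.

Lemma pencil_map_norm (p1 p2 q1 q2 x y : R) :
  (p1, p2) <> (q1, q2) -> (x, y) <> (q1, q2) ->
  pencil_mapx p1 p2 q1 q2 x y ^ 2 + pencil_mapy p1 p2 q1 q2 x y ^ 2 =
  ((x - p1) ^ 2 + (y - p2) ^ 2) /
  (((x - q1) ^ 2 + (y - q2) ^ 2) * ((p1 - q1) ^ 2 + (p2 - q2) ^ 2)).
Proof.
  intros Hp Hx. apply minus_nonzero, sqnorm_pos in Hp. apply minus_nonzero, sqnorm_pos in Hx.
  unfold pencil_mapx, pencil_mapy, invx, invy. field. lra.
Qed.

(** The circles of Apollonius become concentric circles, on which [1 / |(x, y) - q|^2] is affine
    in the new coordinates, because it is their squared distance from the image of infinity.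
    So the lifts are again given by affine functions. *)
Lemma apollonius_normal_form (Phi : space -> Prop) (t0 t1 : R) (K : R -> space -> Prop)
    (U : plane -> Prop) (F : R -> R -> R) (B : gcircle -> Prop) (p1 p2 q1 q2 : R) :
  same_set Phi (graph_over U F) -> region U -> biharmonic_on U F ->
  im_circle_family t0 t1 K -> carries Phi t0 t1 K ->
  (forall t, t0 <= t <= t1 -> exists k, B k /\ same_set (top_view (K t)) (on k)) ->
  (p1, p2) <> (q1, q2) ->
  (forall k, B k -> exists l, 0 < l /\ forall x y, on k (x, y) <->
     (x - p1) ^ 2 + (y - p2) ^ 2 = l * ((x - q1) ^ 2 + (y - q2) ^ 2)) ->
  has_normal_form (fun p => pencil_region p1 p2 q1 q2 U p /\ p <> (0, 0)) (pencil_fun p1 p2 q1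
      q2 F).
Proof.
  intros HPhi HU HF HK Hcar Htop Hpq HB.
  apply (chart_normal_form Phi t0 t1 K U (pencil_region p1 p2 q1 q2 U)
    (fun p => p <> (q1, q2)) F _
    (pencil_mapx p1 p2 q1 q2) (pencil_mapy p1 p2 q1 q2)
    (fun x y => / ((x - q1) ^ 2 + (y - q2) ^ 2))); auto.
  - intros x y z H. apply HPhi in H. exact H.
  - now apply region_pencil.
  - now apply biharmonic_pencil.
  - intros x y Hxy. apply minus_nonzero in Hxy.
    destruct (continuity_2d_inv _ _ Hxy) as [C1' C2'].
    assert (Hs : forall v, continuity_2d_pt (fun x _ => x - v) x y /\ continuity_2d_pt (fun _ y
        => y - v) x y).
    { intros v. split; apply continuity_2d_pt_minus;
        apply continuity_2d_pt_id1 || apply continuity_2d_pt_id2 || apply continuity_2d_pt_const. }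
    split; apply continuity_2d_pt_minus; try apply continuity_2d_pt_const.
    + apply (continuity_2d_pt_comp invx (fun x _ => x - q1) (fun _ y => y - q2)); auto; apply Hs.
    + apply (continuity_2d_pt_comp invy (fun x _ => x - q1) (fun _ y => y - q2)); auto; apply Hs.
  - intros x y x' y' H H' E1 E2. apply minus_nonzero in H. apply minus_nonzero in H'.
    unfold pencil_mapx, pencil_mapy in E1, E2.
    destruct (inv_involutive _ _ H) as [I1 I2]. destruct (inv_involutive _ _ H') as [I1' I2'].
    assert (F1 : invx (x - q1) (y - q2) = invx (x' - q1) (y' - q2)) by lra.
    assert (F2 : invy (x - q1) (y - q2) = invy (x' - q1) (y' - q2)) by lra.
    rewrite F1, F2 in I1, I2. split; lra.
  - intros x y H. apply minus_nonzero, sqnorm_pos in H. apply Rinv_neq_0_compat. lra.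
  - intros x y HUxy H. destruct (pencil_map_value p1 p2 q1 q2 x y U F H). tauto.
  - intros t Ht. destruct (Htop t Ht) as (k & HBk & Hk).
    destruct (HB k HBk) as (l & Hl & Hon).
    destruct (circle_over_top_view (K t) k) as (a & b & c & d & HKt); auto.
    { now apply HK. }
    assert (HD := sqnorm_pos _ _ (minus_nonzero _ _ _ _ Hpq)).
    set (D := (p1 - q1) ^ 2 + (p2 - q2) ^ 2) in *.
    set (k1 := invx (p1 - q1) (p2 - q2)). set (k2 := invy (p1 - q1) (p2 - q2)).
    set (e := a / 2 * (q1 ^ 2 + q2 ^ 2) + b * q1 + c * q2 + d).
    assert (Hr2 : sqrt (l / D) ^ 2 = l / D) by (apply pow2_sqrt, Rlt_le, Rdiv_lt_0_compat; lra).
    exists (sqrt (l / D)), (a / 2 + (a * q1 + b) * k1 + (a * q2 + c) * k2 +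
      e * (l / D + k1 ^ 2 + k2 ^ 2)), (a * q1 + b + 2 * e * k1), (a * q2 + c + 2 * e * k2).
    split; [apply sqrt_lt_R0, Rdiv_lt_0_compat; lra|].
    intros x y z. rewrite HKt, Hon, Hr2.
    (* the lifting condition, once the top view is known to lie on the circle *)
    assert (Hlift : (x, y) <> (q1, q2) ->
      pencil_mapx p1 p2 q1 q2 x y ^ 2 + pencil_mapy p1 p2 q1 q2 x y ^ 2 = l / D ->
      (z = a / 2 * (x ^ 2 + y ^ 2) + b * x + c * y + d <->
       / ((x - q1) ^ 2 + (y - q2) ^ 2) * z =
         a / 2 + (a * q1 + b) * k1 + (a * q2 + c) * k2 + e * (l / D + k1 ^ 2 + k2 ^ 2) +
         (a * q1 + b + 2 * e * k1) * pencil_mapx p1 p2 q1 q2 x y +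
         (a * q2 + c + 2 * e * k2) * pencil_mapy p1 p2 q1 q2 x y)).
    { intros H Hn. rewrite <- Hn. apply minus_nonzero, sqnorm_pos in H.
      unfold pencil_mapx, pencil_mapy. fold k1 k2. clearbody k1 k2.
      set (n := (x - q1) ^ 2 + (y - q2) ^ 2) in *.
      assert (E : a / 2 + (a * q1 + b) * k1 + (a * q2 + c) * k2 +
        e * ((invx (x - q1) (y - q2) - k1) ^ 2 + (invy (x - q1) (y - q2) - k2) ^ 2 + k1 ^ 2 + k2
            ^ 2) +
        (a * q1 + b + 2 * e * k1) * (invx (x - q1) (y - q2) - k1) +
        (a * q2 + c + 2 * e * k2) * (invy (x - q1) (y - q2) - k2) =
        / n * (a / 2 * (x ^ 2 + y ^ 2) + b * x + c * y + d)).
      { unfold invx, invy, e, n. field. unfold n in H. lra. }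
      rewrite E. split; [now intros ->|]. intros Ez.
      apply Rmult_eq_reg_l with (/ n); auto. apply Rinv_neq_0_compat. lra. }
    assert (Hcirc : (x, y) <> (q1, q2) ->
      ((x - p1) ^ 2 + (y - p2) ^ 2 = l * ((x - q1) ^ 2 + (y - q2) ^ 2) <->
       pencil_mapx p1 p2 q1 q2 x y ^ 2 + pencil_mapy p1 p2 q1 q2 x y ^ 2 = l / D)).
    { intros H. rewrite (pencil_map_norm p1 p2 q1 q2 x y Hpq H). fold D.
      apply minus_nonzero, sqnorm_pos in H. split; intros E.
      - rewrite E. field. lra.
      - apply Rmult_eq_reg_r with (/ (((x - q1) ^ 2 + (y - q2) ^ 2) * D)).
        + transitivity (l / D); [exact E|]. field. lra.
        + apply Rinv_neq_0_compat. nra. }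
    split.
    + intros [H1 H2].
      assert (Hne : (x, y) <> (q1, q2)).
      { intros E. injection E as -> ->. apply Hpq.
        assert (Z : (q1 - p1) ^ 2 + (q2 - p2) ^ 2 = 0) by lra.
        destruct (Rplus_sqr_eq_0 (q1 - p1) (q2 - p2)); [unfold Rsqr; lra|]. f_equal; lra. }
      split; auto. apply Hcirc in H1; auto. split; auto. now apply Hlift.
    + intros (Hne & H1 & H2). split; [now apply Hcirc|]. now apply Hlift.
Qed.

(** * Logarithmic terms are singular *)

(** Coefficient lists, so that the induction below can strip off the constant coefficient. *)
Fixpoint poly_eval (l : list R) (s : R) : R :=
  match l with
  | nil => 0
  | k :: l => k + s * poly_eval l s
  end.

Lemma poly_eval_continuity (l : list R) (s : R) : continuity_pt (poly_eval l) s.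
Proof.
  induction l as [|k l IH]; simpl.
  - apply continuity_pt_const. intros ? ?; reflexivity.
  - apply continuity_pt_plus; [apply continuity_pt_const; intros ? ?; reflexivity|].
    apply continuity_pt_mult; auto. apply continuity_smooth. auto_derive; auto.
Qed.

Lemma nonneg_at_zero (f : R -> R) (d : R) :
  0 < d -> continuity_pt f 0 -> (forall s, 0 < s < d -> 0 <= f s) -> 0 <= f 0.
Proof.
  intros Hd Hf H. apply Rnot_lt_le. intros C.
  apply continuity_pt_filterlim in Hf.
  assert (Hl : locally 0 (fun s => f s < 0)).
  { apply (Hf (fun z => z < 0)). apply locally_R_iff. exists (- f 0).
    split; [lra|]. intros z Hz. apply Rabs_def2 in Hz. lra. }
  apply locally_R_iff in Hl. destruct Hl as (e & He & Hl).
  set (s := Rmin (d / 2) (e / 2)).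
  assert (Hs : 0 < s) by (apply Rmin_pos; lra).
  assert (s <= d / 2) by apply Rmin_l. assert (s <= e / 2) by apply Rmin_r.
  assert (f s < 0) by (apply Hl; rewrite Rminus_0_r, Rabs_pos_eq; lra).
  assert (0 <= f s) by (apply H; lra). lra.
Qed.

Lemma equal_at_zero (f g : R -> R) (d : R) :
  0 < d -> continuity_pt f 0 -> continuity_pt g 0 ->
  (forall s, 0 < s < d -> f s = g s) -> f 0 = g 0.
Proof.
  intros Hd Hf Hg H.
  assert (0 <= f 0 - g 0).
  { apply (nonneg_at_zero (fun s => f s - g s) d); auto.
    - now apply continuity_pt_minus.
    - intros s Hs. rewrite (H s Hs). lra. }
  assert (0 <= g 0 - f 0).
  { apply (nonneg_at_zero (fun s => g s - f s) d); auto.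
    - now apply continuity_pt_minus.
    - intros s Hs. rewrite (H s Hs). lra. }
  lra.
Qed.

Lemma analytic_continuity (f : R -> R) (x : R) : analytic_at f x -> continuity_pt f x.
Proof.
  intros (a & Ha & Hf). apply continuity_pt_filterlim.
  assert (Hc : continuity_pt (PSeries a) 0) by (apply PSeries_continuity; now rewrite Rabs_R0).
  apply continuity_pt_filterlim in Hc.
  assert (E : f x = PSeries a 0).
  { rewrite <- (locally_singleton _ _ Hf). now rewrite Rplus_0_r. }
  rewrite E. intros P HP. apply locally_shift. specialize (Hc P HP). unfold filtermap in *.
  generalize (filter_and _ _ Hf Hc). apply filter_imp. intros h [H1 H2]. now rewrite H1.
Qed.

Lemma analytic_divide (g : R -> R) : analytic_at g 0 -> g 0 = 0 ->
  exists g1 d, analytic_at g1 0 /\ 0 < d /\ forall s, Rabs s < d -> g s = s * g1 s.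
Proof.
  intros (a & Ha & Hg) H0. apply locally_R_iff in Hg. destruct Hg as (d & Hd & Hg).
  exists (PSeries (PS_decr_1 a)), d. split; [|split; auto].
  - exists (PS_decr_1 a). split; [now rewrite CV_radius_decr_1|].
    apply filter_forall. intros h. now rewrite Rplus_0_l.
  - intros s Hs. rewrite <- (Rplus_0_l s) at 1. rewrite Hg by now rewrite Rminus_0_r.
    apply PSeries_decr_1_aux.
    rewrite <- PSeries_0, <- (Hg 0) by now rewrite Rminus_0_r, Rabs_R0.
    now rewrite Rplus_0_l.
Qed.

Lemma ln_lower (v : R) : 0 < v < 1 -> v * - ln v <= 1.
Proof.
  intros Hv. assert (H := exp_ineq1_le (- ln v)). rewrite exp_Ropp, exp_ln in H by lra.
  apply Rle_trans with (v * / v); [|right; field; lra].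
  apply Rmult_le_compat_l; lra.
Qed.

(** The constant coefficient is bounded by the quotient of a bounded function and [ln s], hence
    0; then [g] vanishes at 0, and both sides can be divided by [s]. *)
Lemma analytic_not_logarithmic (l : list R) (g : R -> R) (d : R) :
  0 < d -> analytic_at g 0 -> (forall s, 0 < s < d -> g s = poly_eval l s * ln s) ->
  forall k, In k l -> k = 0.
Proof.
  revert g d. induction l as [|k l IH]; intros g d Hd Hg H; [easy|].
  assert (Hgc := analytic_continuity g 0 Hg).
  assert (Hlc := poly_eval_continuity (k :: l)).
  assert (Habs : forall f s, continuity_pt f s -> continuity_pt (fun s => Rabs (f s)) s).
  { intros f s Hf. apply (continuity_pt_comp f Rabs); auto. apply Rcontinuity_abs. }
  assert (Hk : k = 0).
  { apply NNPP. intros Nk. apply Rabs_pos_lt in Nk.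
    set (N := (Rabs (g 0) + 1) / Rabs k).
    assert (HN : 0 <= N).
    { unfold N. apply Rlt_le, Rdiv_lt_0_compat; auto. generalize (Rabs_pos (g 0)). lra. }
    assert (Hb : 0 <= Rabs (g 0) - N * Rabs (poly_eval (k :: l) 0)).
    { apply (nonneg_at_zero (fun s => Rabs (g s) - N * Rabs (poly_eval (k :: l) s))
        (Rmin d (exp (- N)))).
      - apply Rmin_pos; auto. apply exp_pos.
      - apply continuity_pt_minus; auto.
        apply (continuity_pt_mult (fun _ => N)); [apply continuity_pt_const; intros ? ?;
            reflexivity|].
        apply Habs, Hlc.
      - intros s Hs. assert (M1 := Rmin_l d (exp (- N))). assert (M2 := Rmin_r d (exp (- N))).
        rewrite (H s) by lra. rewrite Rabs_mult.
        assert (Hln : ln s <= - N).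
        { rewrite <- (ln_exp (- N)). apply Rlt_le, ln_increasing; lra. }
        assert (N <= Rabs (ln s)) by (rewrite <- Rabs_Ropp; eapply Rle_trans; [|apply Rle_abs];
            lra).
        generalize (Rabs_pos (poly_eval (k :: l) s)). nra. }
    simpl in Hb. rewrite Rmult_0_l, Rplus_0_r in Hb.
    unfold N in Hb. unfold Rdiv in Hb. rewrite Rmult_assoc, Rinv_l in Hb by lra. lra. }
  subst k.
  assert (Hg0 : g 0 = 0).
  { assert (Hb : 0 <= 2 * Rabs 0 * Rabs (poly_eval l (0 ^ 2)) - Rabs (g (0 ^ 2))).
    { apply (nonneg_at_zero (fun v => 2 * Rabs v * Rabs (poly_eval l (v ^ 2)) - Rabs (g (v ^ 2)))
        (Rmin 1 d)).
      - apply Rmin_pos; lra.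
      - assert (Hsq : continuity_pt (fun v => v ^ 2) 0) by (apply continuity_smooth;
          auto_derive; auto).
        apply continuity_pt_minus.
        + apply continuity_pt_mult.
          * apply continuity_pt_mult; [apply continuity_pt_const; intros ? ?; reflexivity|].
            apply Rcontinuity_abs.
          * apply Habs. apply (continuity_pt_comp (fun v => v ^ 2) (poly_eval l)); auto.
            apply poly_eval_continuity.
        + apply Habs. apply (continuity_pt_comp (fun v => v ^ 2) g); auto.
          replace (0 ^ 2) with 0 by ring. exact Hgc.
      - intros v Hv. assert (M1 := Rmin_l 1 d). assert (M2 := Rmin_r 1 d).
        assert (Hv2 : 0 < v ^ 2 < d) by nra.
        rewrite (H _ Hv2). cbn [poly_eval]. rewrite Rplus_0_l, ln_pow by lra.
        rewrite (Rabs_mult (v ^ 2 * _)), (Rabs_mult (v ^ 2)), (Rabs_mult (INR 2)).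
        rewrite (Rabs_pos_eq v), (Rabs_pos_eq (v ^ 2)) by nra.
        replace (INR 2) with 2 by (simpl; ring). rewrite (Rabs_pos_eq 2) by lra.
        assert (Hln : Rabs (ln v) = - ln v).
        { apply Rabs_left1. rewrite <- ln_1. apply Rlt_le, ln_increasing; lra. }
        rewrite Hln. assert (Hl := ln_lower v ltac:(lra)).
        assert (Hp := Rabs_pos (poly_eval l (v ^ 2))).
        replace (2 * v * Rabs (poly_eval l (v ^ 2)) -
          v ^ 2 * Rabs (poly_eval l (v ^ 2)) * (2 * - ln v)) with
          (2 * v * Rabs (poly_eval l (v ^ 2)) * (1 - v * - ln v)) by ring.
        repeat apply Rmult_le_pos; lra. }
    replace (0 ^ 2) with 0 in Hb by ring. rewrite Rabs_R0 in Hb.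
    assert (Hp := Rabs_pos (g 0)). apply NNPP. intros N. apply Rabs_pos_lt in N. lra. }
  intros j [<-|Hj]; auto.
  destruct (analytic_divide g Hg Hg0) as (g1 & e & Hg1 & He & E).
  apply (IH g1 (Rmin d e)); auto; [now apply Rmin_pos|].
  intros s Hs. assert (M1 := Rmin_l d e). assert (M2 := Rmin_r d e).
  apply Rmult_eq_reg_l with s; [|lra].
  rewrite <- E by (rewrite Rabs_pos_eq; lra). rewrite H by lra. simpl. ring.
Qed.

(** Along a line through 0, multiplying by the parameter [s] leaves a power series on one side
    and, besides a polynomial, a polynomial multiple of [ln s] on the other. *)
Lemma regular_normal_form (U : plane -> Prop) (F : R -> R -> R)
    (a1 a2 a2' a3 b1 b2 c1 c2 s0 s1 s2 s3 : R) :
  open U -> U (0, 0) -> line_analytic U F ->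
  eq_on (fun p => U p /\ p <> (0, 0)) F (normal_form a1 a2 a2' a3 b1 b2 c1 c2 s0 s1 s2 s3) ->
  a1 = 0 /\ a2 = 0 /\ a2' = 0 /\ a3 = 0 /\ b1 = 0 /\ b2 = 0.
Proof.
  intros HU H0 HF HE.
  assert (Hdir : forall e1 e2, e1 ^ 2 + e2 ^ 2 = 1 ->
    a1 = 0 /\ a2 * e1 + a2' * e2 = 0 /\ a3 = 0 /\ b1 * e2 + b2 * e1 = 0).
  { intros e1 e2 He.
    set (f := fun s => F (s * e1) (s * e2)).
    assert (Hf : analytic_at f 0).
    { apply analytic_ext with (fun s => F (0 + s * e1) (0 + s * e2)).
      - intros s. unfold f. now rewrite !Rplus_0_l.
      - now apply HF. }
    assert (HlU := line_locally U 0 0 e1 e2 HU H0). apply locally_R_iff in HlU.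
    destruct HlU as (d & Hd & HlU).
    set (b := b1 * e2 + b2 * e1). set (c := c1 * e2 + c2 * e1).
    set (sl := s1 * e1 + s2 * e2). set (a := a2 * e1 + a2' * e2).
    set (P := poly_eval (b :: s3 :: sl :: s0 :: c :: nil)).
    set (g := fun s => s * f s - P s).
    assert (HP : analytic_at P 0).
    { unfold P. simpl.
      repeat first [apply analytic_plus|apply analytic_mult|apply analytic_const|apply
          analytic_id]. }
    assert (Hg : analytic_at g 0).
    { apply analytic_minus; auto. apply analytic_mult; auto. apply analytic_id. }
    assert (Hgs : forall s, 0 < s < d ->
      g s = poly_eval (0 :: 2 * a3 :: 2 * a :: 2 * a1 :: nil) s * ln s).
    { intros s Hs. unfold g, f.
      assert (En : (s * e1) ^ 2 + (s * e2) ^ 2 = s ^ 2).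
      { rewrite !Rpow_mult_distr, <- Rmult_plus_distr_l, He. ring. }
      rewrite (HE (s * e1) (s * e2)).
      2:{ split.
          - rewrite <- (Rplus_0_l (s * e1)), <- (Rplus_0_l (s * e2)).
            apply HlU. rewrite Rminus_0_r, Rabs_pos_eq; lra.
          - intros E. injection E as E1 E2. rewrite E1, E2 in En.
            assert (0 < s ^ 2) by (apply pow_lt; lra). lra. }
      unfold normal_form. rewrite En. rewrite ln_pow by lra.
      unfold P, a, b, c, sl; simpl. field. lra. }
    assert (Hz := analytic_not_logarithmic _ g d Hd Hg Hgs).
    assert (E1 : 2 * a3 = 0) by (apply Hz; simpl; auto).
    assert (E2 : 2 * a = 0) by (apply Hz; simpl; auto).
    assert (E3 : 2 * a1 = 0) by (apply Hz; simpl; auto).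
    assert (E4 : g 0 = 0).
    { apply (equal_at_zero g (fun _ => 0) d); auto.
      - now apply analytic_continuity.
      - apply continuity_pt_const. intros ? ?; reflexivity.
      - intros s Hs. rewrite (Hgs s Hs). simpl. rewrite E1, E2, E3. ring. }
    unfold g, P in E4. simpl in E4. unfold a in E2.
    unfold a, b in *. repeat split; lra. }
  destruct (Hdir 1 0) as (H1 & H2 & H3 & H4); [ring|].
  destruct (Hdir 0 1) as (_ & H5 & _ & H6); [ring|].
  repeat split; lra.
Qed.

Lemma vector_eq_zero (x y : R) : x ^ 2 + y ^ 2 = 0 -> x = 0 /\ y = 0.
Proof. intros H. apply Rplus_sqr_eq_0. unfold Rsqr. lra. Qed.

(** Inversion about either limit point would send a point of the surface to infinity.  But
    regularity at [p] removes the logarithmic and dipole terms, and regularity at [q] the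
    cubic term, which is unbounded there.  Only an i-M-sphere is left. *)
Lemma both_limit_points_sphere (U : plane -> Prop) (F : R -> R -> R)
    (p1 p2 q1 q2 : R) :
  region U -> biharmonic_on U F -> (p1, p2) <> (q1, q2) -> U (p1, p2) -> U (q1, q2) ->
  has_normal_form (fun p => pencil_region p1 p2 q1 q2 U p /\ p <> (0, 0))
    (pencil_fun p1 p2 q1 q2 F) ->
  exists a b c d, forall x y, U (x, y) -> F x y = a / 2 * (x ^ 2 + y ^ 2) + b * x + c * y + d.
Proof.
  intros HU HF Hpq HUp HUq (a1 & a2 & a2' & a3 & b1 & b2 & c1 & c2 & s0 & s1 & s2 & s3 & HE).
  assert (HUo : open U) by apply HU.
  set (k1 := invx (p1 - q1) (p2 - q2)). set (k2 := invy (p1 - q1) (p2 - q2)).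
  assert (HV := region_pencil p1 p2 q1 q2 U HU).
  destruct (pencil_map_value p1 p2 q1 q2 p1 p2 U F Hpq) as [HV0 _].
  unfold pencil_mapx, pencil_mapy in HV0. rewrite !Rminus_diag in HV0 by reflexivity.
  destruct (regular_normal_form _ _ _ _ _ _ _ _ _ _ _ _ _ _ (proj1 HV) (proj2 HV0 HUp)
    (biharmonic_line_analytic _ _ (proj1 HV) (biharmonic_pencil p1 p2 q1 q2 U F HU HF)) HE)
    as (-> & -> & -> & -> & -> & ->).
  assert (HFT : forall x y, U (x, y) -> (x, y) <> (p1, p2) -> (x, y) <> (q1, q2) ->
    F x y = ((x - q1) ^ 2 + (y - q2) ^ 2) *
      normal_form 0 0 0 0 0 0 c1 c2 s0 s1 s2 s3
        (pencil_mapx p1 p2 q1 q2 x y) (pencil_mapy p1 p2 q1 q2 x y)).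
  { intros x y HUxy Hp Hq. destruct (pencil_map_value p1 p2 q1 q2 x y U F Hq) as [H1 H2].
    rewrite <- HE.
    - rewrite H2. apply minus_nonzero, sqnorm_pos in Hq. field. lra.
    - split; [now apply H1|]. intros E. injection E as E1 E2.
      assert (N := pencil_map_norm p1 p2 q1 q2 x y Hpq Hq). rewrite E1, E2 in N.
      apply minus_nonzero, sqnorm_pos in Hq. apply minus_nonzero, sqnorm_pos in Hp.
      assert (HD := sqnorm_pos _ _ (minus_nonzero _ _ _ _ Hpq)).
      assert (0 < ((x - p1) ^ 2 + (y - p2) ^ 2) /
        (((x - q1) ^ 2 + (y - q2) ^ 2) * ((p1 - q1) ^ 2 + (p2 - q2) ^ 2))); [|lra].
      apply Rdiv_lt_0_compat; auto. now apply Rmult_lt_0_compat. }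
  assert (HFc : forall x y, U (x, y) -> continuity_2d_pt F x y).
  { intros x y Hxy. apply (HF x y Hxy). }
  assert (Hline : forall x y e1 e2, U (x, y) -> continuity_pt (fun s => F (x + s * e1) (y + s *
      e2)) 0).
  { intros x y e1 e2 Hxy. apply analytic_continuity.
    now apply (biharmonic_line_analytic U F HUo HF). }
  (* close to its starting point, a line meets neither limit point again *)
  assert (Hnear : forall x y e1 e2, U (x, y) -> e1 ^ 2 + e2 ^ 2 <> 0 -> exists d, 0 < d /\
    forall s, 0 < s < d -> U (x + s * e1, y + s * e2) /\
      (x + s * e1, y + s * e2) <> (p1, p2) /\ (x + s * e1, y + s * e2) <> (q1, q2)).
  { intros x y e1 e2 Hxy He.
    assert (Hmiss : forall a b, exists d, 0 < d /\ forall s, 0 < s < d ->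
      (x + s * e1, y + s * e2) <> (a, b)).
    { intros a b. destruct (classic (exists s, 0 < s /\ (x + s * e1, y + s * e2) = (a, b)))
        as [(s & Hs & E)|N].
      - exists s. split; auto. intros t Ht E'. rewrite <- E in E'. injection E' as E1 E2.
        apply He. assert (Z1 : (t - s) * e1 = 0) by lra. assert (Z2 : (t - s) * e2 = 0) by lra.
        apply Rmult_integral in Z1. apply Rmult_integral in Z2.
        destruct Z1 as [|Z1]; [lra|]. destruct Z2 as [|Z2]; [lra|]. rewrite Z1, Z2. ring.
      - exists 1. split; [lra|]. intros t Ht E. apply N. exists t. split; auto. lra. }
    destruct (Hmiss p1 p2) as (d1 & Hd1 & M1). destruct (Hmiss q1 q2) as (d2 & Hd2 & M2).
    assert (Hl := line_locally U x y e1 e2 HUo Hxy). apply locally_R_iff in Hl.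
    destruct Hl as (d3 & Hd3 & M3).
    exists (Rmin d1 (Rmin d2 d3)). split; [repeat apply Rmin_pos; auto|].
    intros s Hs. assert (A := Rmin_l d1 (Rmin d2 d3)). assert (B := Rmin_r d1 (Rmin d2 d3)).
    assert (C := Rmin_l d2 d3). assert (D := Rmin_r d2 d3).
    split; [apply M3; rewrite Rminus_0_r, Rabs_pos_eq; lra|]. split; [apply M1|apply M2]; lra. }
  assert (Hc : c1 = 0 /\ c2 = 0).
  { apply NNPP. intros N.
    set (C := c2 ^ 2 + c1 ^ 2).
    assert (HC : 0 < C).
    { unfold C. apply Rnot_le_lt. intros L. apply N.
      assert (A := pow2_ge_0 c1). assert (B := pow2_ge_0 c2).
      destruct (vector_eq_zero c2 c1); [lra|]. auto. }
    destruct (Hnear q1 q2 c2 c1 HUq) as (d & Hd & Hs); [unfold C in HC; lra|].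
    assert (E : 0 * F (q1 + 0 * c2) (q2 + 0 * c1) =
      C * ((c1 * (c1 / C - 0 * k2) + c2 * (c2 / C - 0 * k1)) *
           ((c2 / C - 0 * k1) ^ 2 + (c1 / C - 0 * k2) ^ 2) +
           0 * (s0 * ((c2 / C - 0 * k1) ^ 2 + (c1 / C - 0 * k2) ^ 2)) +
           0 ^ 2 * (s1 * (c2 / C - 0 * k1) + s2 * (c1 / C - 0 * k2)) + 0 ^ 3 * s3)).
    { apply (equal_at_zero (fun s => s * F (q1 + s * c2) (q2 + s * c1))
        (fun s => C * ((c1 * (c1 / C - s * k2) + c2 * (c2 / C - s * k1)) *
           ((c2 / C - s * k1) ^ 2 + (c1 / C - s * k2) ^ 2) +
           s * (s0 * ((c2 / C - s * k1) ^ 2 + (c1 / C - s * k2) ^ 2)) +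
           s ^ 2 * (s1 * (c2 / C - s * k1) + s2 * (c1 / C - s * k2)) + s ^ 3 * s3)) d); auto.
      - apply continuity_pt_mult; [|now apply Hline]. apply continuity_smooth. auto_derive; auto.
      - apply continuity_smooth. auto_derive; auto.
      - intros s Hsd. destruct (Hs s Hsd) as (A1 & A2 & A3).
        rewrite (HFT _ _ A1 A2 A3). unfold normal_form, pencil_mapx, pencil_mapy. fold k1 k2.
        replace (q1 + s * c2 - q1) with (s * c2) by ring.
        replace (q2 + s * c1 - q2) with (s * c1) by ring.
        assert (En : (s * c2) ^ 2 + (s * c1) ^ 2 = s ^ 2 * C) by (unfold C; ring).
        unfold invx, invy. rewrite En. unfold Rdiv at 1 2.
        replace (s * c2 * / (s ^ 2 * C)) with (/ s * (c2 / C)) by (field; lra).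
        replace (s * c1 * / (s ^ 2 * C)) with (/ s * (c1 / C)) by (field; lra).
        replace (s * c2 / (s ^ 2 * C)) with (/ s * (c2 / C)) by (field; lra).
        replace (s * c1 / (s ^ 2 * C)) with (/ s * (c1 / C)) by (field; lra).
        generalize (c2 / C) (c1 / C) (ln ((/ s * (c2 / C) - k1) ^ 2 + (/ s * (c1 / C) - k2) ^ 2)).
        intros u v w.
        unfold Rdiv. rewrite !Rmult_0_l, !Rplus_0_l, !Rmult_0_l, Rplus_0_l.
        field. lra. }
    rewrite Rmult_0_l in E.
    assert (E' : C * ((c1 * (c1 / C) + c2 * (c2 / C)) * ((c2 / C) ^ 2 + (c1 / C) ^ 2)) = 0).
    { rewrite E. ring. }
    assert (E'' : C * ((c1 * (c1 / C) + c2 * (c2 / C)) * ((c2 / C) ^ 2 + (c1 / C) ^ 2)) = 1).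
    { assert (X1 : c1 * (c1 / C) + c2 * (c2 / C) = 1).
      { transitivity ((c2 ^ 2 + c1 ^ 2) / C); [field; lra|fold C; field; lra]. }
      assert (X2 : (c2 / C) ^ 2 + (c1 / C) ^ 2 = / C).
      { transitivity ((c2 ^ 2 + c1 ^ 2) / C ^ 2); [field; lra|fold C; field; lra]. }
      rewrite X1, X2. field. lra. }
    lra. }
  destruct Hc as [-> ->].
  set (D := (p1 - q1) ^ 2 + (p2 - q2) ^ 2).
  assert (HD : 0 < D) by (apply sqnorm_pos; now apply minus_nonzero).
  (* the remaining i-M-sphere, transformed back *)
  set (S := fun x y => s0 * (((x - p1) ^ 2 + (y - p2) ^ 2) / D) +
    s1 * ((x - q1) - ((x - q1) ^ 2 + (y - q2) ^ 2) * k1) +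
    s2 * ((y - q2) - ((x - q1) ^ 2 + (y - q2) ^ 2) * k2) +
    s3 * ((x - q1) ^ 2 + (y - q2) ^ 2)).
  assert (HS : forall x y, U (x, y) -> (x, y) <> (p1, p2) -> (x, y) <> (q1, q2) -> F x y = S x y).
  { intros x y HUxy Hp Hq. rewrite (HFT x y HUxy Hp Hq). unfold normal_form.
    rewrite (pencil_map_norm p1 p2 q1 q2 x y Hpq Hq). fold D. unfold S.
    unfold pencil_mapx, pencil_mapy. fold k1 k2.
    apply minus_nonzero, sqnorm_pos in Hq.
    apply minus_nonzero, sqnorm_pos in Hp.
    unfold invx, invy. unfold Rdiv at 1. rewrite !Rmult_0_l, !Rplus_0_l, !Rmult_0_l, !Rplus_0_l.
    field. lra. }
  assert (HSall : forall x y, U (x, y) -> F x y = S x y).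
  { intros x y HUxy. destruct (Hnear x y 1 0 HUxy) as (d & Hd & Hs); [lra|].
    assert (E : F (x + 0 * 1) (y + 0 * 0) = S (x + 0 * 1) (y + 0 * 0)).
    { apply (equal_at_zero (fun s => F (x + s * 1) (y + s * 0)) (fun s => S (x + s * 1) (y + s *
        0)) d); auto.
      - apply continuity_smooth. unfold S. auto_derive; auto.
      - intros s Hsd. destruct (Hs s Hsd) as (A1 & A2 & A3). now apply HS. }
    now rewrite !Rmult_0_l, !Rplus_0_r in E. }
  exists (2 * (s0 / D - s1 * k1 - s2 * k2 + s3)),
    (-2 * s0 * p1 / D + s1 + 2 * (s1 * k1 + s2 * k2 - s3) * q1),
    (-2 * s0 * p2 / D + s2 + 2 * (s1 * k1 + s2 * k2 - s3) * q2),
    (s0 * (p1 ^ 2 + p2 ^ 2) / D - s1 * q1 - s2 * q2 -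
      (s1 * k1 + s2 * k2 - s3) * (q1 ^ 2 + q2 ^ 2)).
  intros x y Hxy. rewrite (HSall x y Hxy). unfold S. clearbody k1 k2. field. lra.
Qed.

(** * Pieces of the normal surfaces *)

Lemma limit_at_origin_unique (g : plane -> R) (z z' : R) :
  filterlim g (locally' ((0, 0) : plane)) (locally z) ->
  filterlim g (locally' ((0, 0) : plane)) (locally z') -> z = z'.
Proof.
  intros H H'. apply NNPP. intros N.
  assert (He : 0 < Rabs (z - z') / 2) by (apply Rdiv_lt_0_compat; [apply Rabs_pos_lt|]; lra).
  assert (B : forall y, locally y (fun t => Rabs (t - y) < Rabs (z - z') / 2)).
  { intros y. apply locally_R_iff. eauto. }
  assert (K := H _ (B z)). assert (K' := H' _ (B z')). unfold filtermap, locally', within in K, K'.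
  assert (KK := filter_and _ _ K K'). apply (locally_pair_iff _ 0 0) in KK.
  destruct KK as (d & Hd & KK). destruct (KK (d / 2) 0) as [K1 K2].
  - rewrite Rminus_0_r, Rabs_pos_eq; lra.
  - now rewrite Rabs_self.
  - assert (Hn : (d / 2, 0) <> (0, 0)) by (intros E; injection E as E; lra).
    specialize (K1 Hn). specialize (K2 Hn).
    assert (T := Rabs_triang (z - g (d / 2, 0)) (g (d / 2, 0) - z')).
    replace (z - g (d / 2, 0) + (g (d / 2, 0) - z')) with (z - z') in T by ring.
    rewrite (Rabs_minus_sym z (g _)) in T. lra.
Qed.

Lemma limit_at_origin_of_continuity (W : plane -> Prop) (f g : R -> R -> R) :
  open W -> W (0, 0) -> continuity_2d_pt f 0 0 ->
  (forall x y, W (x, y) -> (x, y) <> (0, 0) -> f x y = g x y) ->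
  filterlim (fun q : plane => g (fst q) (snd q)) (locally' ((0, 0) : plane)) (locally (f 0 0)).
Proof.
  intros HW H0 Hf Hfg. apply continuity_2d_pt_filterlim in Hf.
  intros P HP. specialize (Hf P HP). unfold filtermap, locally', within in *.
  generalize (filter_and _ _ (HW _ H0) Hf). apply filter_imp.
  intros [x y] [H1 H2] Hn. simpl in *. now rewrite <- Hfg.
Qed.

Lemma direction_of_vector (a b : R) : exists r c s, c ^ 2 + s ^ 2 = 1 /\ a = r * c /\ b = r * s.
Proof.
  destruct (Req_dec (a ^ 2 + b ^ 2) 0) as [E|N].
  - destruct (vector_eq_zero a b E) as [-> ->]. exists 0, 1, 0. repeat split; ring.
  - assert (Hp : 0 < a ^ 2 + b ^ 2) by (generalize (pow2_ge_0 a) (pow2_ge_0 b); lra).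
    set (r := sqrt (a ^ 2 + b ^ 2)). assert (Hr : 0 < r) by now apply sqrt_lt_R0.
    assert (Hr2 : r ^ 2 = a ^ 2 + b ^ 2) by (apply pow2_sqrt; lra).
    clearbody r. exists r, (a / r), (b / r). repeat split; try (field; lra).
    transitivity ((a ^ 2 + b ^ 2) / r ^ 2); [field; lra|]. rewrite <- Hr2. field. lra.
Qed.

(** A rotation makes the coefficient of [y ln (x^2 + y^2)] vanish, and subtracting an i-M-sphere
    removes the regular part.  Over the origin, continuity of [F] provides the limit that
    defines the point of the surface. *)
Lemma normal_form_piece (U : plane -> Prop) (F : R -> R -> R) :
  region U -> (forall x y, U (x, y) -> continuity_2d_pt F x y) ->
  has_normal_form (fun p => U p /\ p <> (0, 0)) F ->
  exists a1 a2 a3 b1 b2 c1 c2, exists P,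
    piece_of P (surface_G a1 a2 a3 b1 b2 c1 c2) /\ im_equivalent (graph_over U F) P.
Proof.
  intros HU HFc (a1 & a2 & a2' & a3 & b1 & b2 & c1 & c2 & s0 & s1 & s2 & s3 & HE).
  assert (HUo : open U) by apply HU.
  destruct (direction_of_vector a2 a2') as (r & c & s & Hcs & Ea & Ea').
  set (V := fun p : plane => U (c * fst p - s * snd p, s * fst p + c * snd p)).
  set (G' := fun x y => F (c * x - s * y) (s * x + c * y) -
    (s0 * (x ^ 2 + y ^ 2) + s1 * (c * x - s * y) + s2 * (s * x + c * y) + s3)).
  assert (Hlin : forall k l x y, continuity_2d_pt (fun x y => k * x + l * y) x y).
  { intros k l x y. apply continuity_2d_pt_plus.
    - apply (continuity_2d_pt_fst (fun x => k * x)). auto_derive; auto.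
    - apply (continuity_2d_pt_snd (fun y => l * y)). auto_derive; auto. }
  assert (Hlin' : forall x y, continuity_2d_pt (fun x y => c * x - s * y) x y).
  { intros x y. apply (continuity_2d_pt_ext (fun x y => c * x + - s * y)); auto. intros; ring. }
  assert (HT : forall x y, (c * (c * x + s * y) - s * (- s * x + c * y),
     s * (c * x + s * y) + c * (- s * x + c * y)) = (x, y)).
  { intros x y. f_equal.
    - transitivity ((c ^ 2 + s ^ 2) * x); [ring|rewrite Hcs; ring].
    - transitivity ((c ^ 2 + s ^ 2) * y); [ring|rewrite Hcs; ring]. }
  assert (HT' : forall x y, (c * (c * x - s * y) + s * (s * x + c * y),
     - s * (c * x - s * y) + c * (s * x + c * y)) = (x, y)).
  { intros x y. f_equal.
    - transitivity ((c ^ 2 + s ^ 2) * x); [ring|rewrite Hcs; ring].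
    - transitivity ((c ^ 2 + s ^ 2) * y); [ring|rewrite Hcs; ring]. }
  assert (HVT : forall q, V q <-> exists p, U p /\
    (c * fst p + s * snd p, - s * fst p + c * snd p) = q).
  { intros [x y]. unfold V; simpl. split.
    - intros H. exists (c * x - s * y, s * x + c * y). split; auto. apply HT'.
    - intros ([x' y'] & H & E). simpl in E. injection E as <- <-. now rewrite HT. }
  assert (HVo : open V).
  { apply open_ext with (fun p => True /\ V p); [intros p; tauto|].
    apply (open_preimage (fun _ => True) U (fun x y => c * x - s * y) (fun x y => s * x + c *
        y)); auto.
    apply open_true. }
  assert (HV : region V).
  { destruct HU as (_ & Hc & [[x y] Hxy]). split; [auto|split].
    - apply (connected_image U V (fun p => (c * fst p + s * snd p, - s * fst p + c * snd p))); auto.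
      intros p _. apply (continuous_plane_map (fun x y => c * x + s * y) (fun x y => - s * x + c
          * y)); auto.
    - exists (c * x + s * y, - s * x + c * y). apply HVT. now exists (x, y). }
  assert (Hn : forall x y, (c * x - s * y) ^ 2 + (s * x + c * y) ^ 2 = x ^ 2 + y ^ 2).
  { intros x y. transitivity ((c ^ 2 + s ^ 2) * (x ^ 2 + y ^ 2)); [ring|rewrite Hcs; ring]. }
  assert (HG : forall x y, V (x, y) -> (x, y) <> (0, 0) -> G' x y =
    G a1 r a3 (b1 * c - b2 * s) (b1 * s + b2 * c) (c1 * c - c2 * s) (c1 * s + c2 * c) x y).
  { intros x y Hxy H0. unfold G'.
    assert (Hq := sqnorm_pos x y H0).
    rewrite HE.
    2:{ split; [exact Hxy|]. intros E. injection E as E1 E2.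
        assert (N := Hn x y). rewrite E1, E2 in N. lra. }
    unfold normal_form. rewrite Hn. unfold G.
    assert (El : a2 * (c * x - s * y) + a2' * (s * x + c * y) = r * x).
    { rewrite Ea, Ea'. transitivity (r * ((c ^ 2 + s ^ 2) * x)); [ring|rewrite Hcs; ring]. }
    replace (a1 * (x ^ 2 + y ^ 2) + a2 * (c * x - s * y) + a2' * (s * x + c * y) + a3) with
      (a1 * (x ^ 2 + y ^ 2) + (a2 * (c * x - s * y) + a2' * (s * x + c * y)) + a3) by ring.
    rewrite El. field. lra. }
  assert (HGc : V (0, 0) -> continuity_2d_pt G' 0 0).
  { intros H0. apply continuity_2d_pt_minus.
    - apply (continuity_2d_pt_comp F (fun x y => c * x - s * y) (fun x y => s * x + c * y)); auto.
    - repeat apply continuity_2d_pt_plus; try apply continuity_2d_pt_const;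
        (apply continuity_2d_pt_mult; [apply continuity_2d_pt_const|]); auto.
      + apply continuity_2d_pt_sqnorm. }
  exists a1, r, a3, (b1 * c - b2 * s), (b1 * s + b2 * c), (c1 * c - c2 * s), (c1 * s + c2 * c).
  exists (graph_over V G'). split.
  - exists V. split; auto. intros [[x y] z]. unfold graph_over, surface_G; simpl fst.
    destruct (point_eq_or_neq (x, y) (0, 0)) as [E|N].
    + injection E as -> ->. split.
      * intros [H0 ->]. split; auto. right. split; auto.
        now apply (limit_at_origin_of_continuity V G'); auto.
      * intros [[[N _]|[_ Hl]] H0]; [easy|]. split; auto.
        eapply limit_at_origin_unique; [exact Hl|].
        now apply (limit_at_origin_of_continuity V G'); auto.
    + split.
      * intros [H ->]. split; [left; split; [exact N|now apply HG]|exact H].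
      * intros [[[_ ->]|[E _]] H]; [|easy]. split; auto. symmetry. now apply HG.
  - apply (im_equivalent_graphs
      (fun P => ext_rotation c s (ext_add_sphere (-2 * s0) (- s1) (- s2) (- s3) P))
      (fun p => (c * fst p + s * snd p, - s * fst p + c * snd p))); auto.
    + apply im_transformation_comp; [apply im_transformation_add_sphere|].
      now apply im_transformation_rotation.
    + intros [x y] Hxy. unfold ext_add_sphere, ext_rotation, G'; cbn [fst snd].
      apply finite_point_eq; auto.
      assert (E := HT x y). injection E as E1 E2. rewrite E1, E2.
      assert (E3 : (c * x + s * y) ^ 2 + (- s * x + c * y) ^ 2 = x ^ 2 + y ^ 2).
      { transitivity ((c ^ 2 + s ^ 2) * (x ^ 2 + y ^ 2)); [ring|rewrite Hcs; ring]. }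
      rewrite E3. field.
Qed.

Theorem theorem8 (Phi : space -> Prop) (t0 t1 : R) (K : R -> space -> Prop) :
  i_Willmore Phi ->
  im_circle_family t0 t1 K ->
  carries Phi t0 t1 K ->
  top_view_hyperbolic t0 t1 K ->
  exists a1 a2 a3 b1 b2 c1 c2 : R,
  exists P : space -> Prop,
    piece_of P (surface_G a1 a2 a3 b1 b2 c1 c2) /\ im_equivalent Phi P.
Proof.
  intros (U & F & HU & HF & HPhi) HK Hcar (B & HB & Htop).
  (* it suffices to transform the graph of F into a surface with a normal form *)
  assert (Hfinish : forall V H, region V -> biharmonic_on V H ->
    im_equivalent (graph_over U F) (graph_over V H) ->
    has_normal_form (fun p => V p /\ p <> (0, 0)) H ->
    exists a1 a2 a3 b1 b2 c1 c2, exists P,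
      piece_of P (surface_G a1 a2 a3 b1 b2 c1 c2) /\ im_equivalent Phi P).
  { intros V H HV HH Heq HE. destruct (normal_form_piece V H HV)
      as (A1 & A2 & A3 & B1 & B2 & C1 & C2 & P & HP & HPeq); auto.
    - intros x y Hxy. apply (HH x y Hxy).
    - exists A1, A2, A3, B1, B2, C1, C2, P. split; auto.
      apply (im_equivalent_same_set _ _ _ HPhi). now apply im_equivalent_trans with (graph_over
          V H). }
  destruct (hyperbolic_pencil_cases B HB) as [(p1 & p2 & Hp)|(p1 & p2 & q1 & q2 & Hpq & Hp)].
  { apply (Hfinish (shift_region p1 p2 U) (shift_fun p1 p2 F)).
    - now apply region_shift.
    - apply biharmonic_translation; auto. apply HU.
    - apply im_equivalent_shift.
    - now apply (concentric_normal_form Phi t0 t1 K U F B p1 p2). }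
  (* inversion about one of the limit points, if it lies outside the region *)
  assert (Hinvert : forall p1 p2 q1 q2, (p1, p2) <> (q1, q2) -> ~ U (q1, q2) ->
    has_normal_form (fun p => pencil_region p1 p2 q1 q2 U p /\ p <> (0, 0))
      (pencil_fun p1 p2 q1 q2 F) ->
    exists a1 a2 a3 b1 b2 c1 c2, exists P,
      piece_of P (surface_G a1 a2 a3 b1 b2 c1 c2) /\ im_equivalent Phi P).
  { intros u1 u2 v1 v2 Huv Hv.
    apply Hfinish; [now apply region_pencil|now apply biharmonic_pencil|].
    now apply im_equivalent_pencil. }
  assert (E : has_normal_form (fun p => pencil_region p1 p2 q1 q2 U p /\ p <> (0, 0))
    (pencil_fun p1 p2 q1 q2 F)) by now apply (apollonius_normal_form Phi t0 t1 K U F B).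
  destruct (classic (U (q1, q2))) as [Hq|Hq]; [|now apply (Hinvert p1 p2 q1 q2)].
  destruct (classic (U (p1, p2))) as [HUp|HUp].
  - destruct (both_limit_points_sphere U F p1 p2 q1 q2 HU HF Hpq HUp Hq E) as (a & b & c & d & HS).
    apply (Hfinish U F); auto.
    + exists (fun P => P). split.
      * apply im_transformation_of_inverse with (fun P => P); auto; intros a' b' c' d';
          exists a', b', c', d'; tauto.
      * intros Q. split.
        -- intros HQ. now exists Q.
        -- now intros (Q' & HQ' & <-).
    + exists 0, 0, 0, 0, 0, 0, 0, 0, (a / 2), b, c, d.
      intros x y [Hxy _]. rewrite (HS x y Hxy). unfold normal_form, Rdiv. ring.
  - assert (Hqp : (q1, q2) <> (p1, p2)) by (intros Eq; now apply Hpq).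
    apply (Hinvert q1 q2 p1 p2); auto.
    apply (apollonius_normal_form Phi t0 t1 K U F B); auto.
    intros k Hk. destruct (Hp k Hk) as (l & Hl & Hon). exists (/ l).
    split; [now apply Rinv_0_lt_compat|]. intros x y. rewrite Hon.
    split; intros Eq; rewrite Eq; field; lra.
Qed.
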